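(* Let $M$ be any closed oriented triangulated three-dimensional manifold, and let $\rho\colon\pi_1(M)\to\mathrm{PSL}(2,\mathbb C)\cong\mathrm{SO}(3,\mathbb C)$ be a representation that is a regular point in the space of (classes of equivalent) representations. With vertex parameters in general position, the twisted complex $$0\longrightarrow \mathfrak{psl}(2,\mathbb C)_{\rho} \stackrel{f_1}{\longrightarrow} (dz)\oplus (dg) \stackrel{f_2}{\longrightarrow} (dy) \stackrel{f_3}{\longrightarrow} (d\varphi) \stackrel{f_4}{\longrightarrow} (d\alpha)\oplus(d\beta)\oplus (dg)^* \stackrel{f_5}{\longrightarrow} \mathfrak{psl}(2,\mathbb C)_{\rho}^* \longrightarrow 0$$ is acyclic, i.e., this sequence is exact: the image of any mapping coincides with the kernel of the next mapping.
   Context: Group and coordinates. $\mathrm{SO}(3,\mathbb C)$ is realized as the group of (determinant one) $3\times3$ matrices preserving the bilinear scalar product with matrix $\begin{pmatrix}0&0&-1\\0&2&0\\-1&0&0\end{pmatrix}$. It acts on isotropic vectors $(hz^2,hz,h)^{\mathrm T}$; the induced action on $z$ is by fractional-linear transformations and gives the isomorphism $\mathrm{SO}(3,\mathbb C)\cong\mathrm{PSL}(2,\mathbb C)$. The Lie algebra elements are written as $da\,A+db\,B+dc\,C$ with $$A=\begin{pmatrix}2&0&0\\0&0&0\\0&0&-2\end{pmatrix},\quad B=\begin{pmatrix}0&2&0\\0&0&1\\0&0&0\end{pmatrix},\quad C=\begin{pmatrix}0&0&0\\1&0&0\\0&2&0\end{pmatrix},$$ acting infinitesimally on $z$ by $dz=2z\,da+db-z^2\,dc$.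 $\mathfrak{psl}(2,\mathbb C)_\rho$ is the subalgebra commuting with the whole representation $\rho$, and $\mathfrak{psl}(2,\mathbb C)_\rho^*$ is its dual space. Let $\tilde M$ be the universal cover of $M$ with the lifted triangulation. To every vertex $i$ of $\tilde M$ complex numbers $\zeta_i,\varkappa_i$ are assigned so that, with $\vec e_i^{\ \mathrm{initial}}=(\varkappa_i\zeta_i^2,\varkappa_i\zeta_i,\varkappa_i)^{\mathrm T}$, one has $\vec e_{\gamma i}^{\ \mathrm{initial}}=\rho(\gamma)\vec e_i^{\ \mathrm{initial}}$ for all $\gamma\in\pi_1(M)$; otherwise they are arbitrary, in general position with respect to all the algebraic constructions (in particular $\varkappa_i\neq0$, and $\zeta_{ij}:=\zeta_i-\zeta_j\ne0$ for each edge $ij$ of $\tilde M$). A fundamental family of simplices of $\tilde M$ is a family containing exactly one simplex of $\tilde M$ over each simplex of $M$; fix one. Its vertices are called main. Regularity and deformations. $\rho$ is regular in the sense that the classes of equivalent (conjugate) representations $\pi_1(M)\to\mathrm{SO}(3,\mathbb C)$ in some neighborhood of $\rho$ are smoothly parameterized by a finite number of parameters $g$, with $g=0$ corresponding to $\rho$, and one representative $\rho_g$ in each class can be chosen depending smoothly on the same parameters, $\rho_0=\rho$. Deformed coordinates $h_i,z_i$ of all vertices of $\tilde M$ are functions of those of main vertices and of $g$: with $\vec e_i=(h_iz_i^2,h_iz_i,h_i)^{\mathrm T}$, $\vec e_{\gamma i}=\rho_g(\gamma)\vec e_i$ for main $i$. All derivatives below are taken at $h_i=\varkappa_i$, $z_i=\zeta_i$,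 $g=0$. Spaces (over $\mathbb C$): $(dz)$ has coordinates $dz_i$ for main vertices; $(dg)$ is the space of infinitesimal deformation parameters and $(dg)^*$ is its dual; $(dy)$ has one coordinate for each tetrahedron of the fundamental family; $(d\varphi)$ has one coordinate for each edge of the fundamental family; $(d\alpha)$, $(d\beta)$ have one coordinate $d\alpha_i$, resp. $d\beta_i$, for each main vertex. Mappings. $f_1$: $dz_i=2\zeta_i\,da+db-\zeta_i^2\,dc$ for main $i$, and zero component in $(dg)$. $f_2$: for each positively oriented tetrahedron $0123$ of the fundamental family, $dy_{0123}=\dfrac{d\ln x}{\zeta_{02}\zeta_{31}}$, where $x=\dfrac{(z_0-z_1)(z_2-z_3)}{(z_0-z_3)(z_2-z_1)}$ is viewed as a function of the main $z$'s and $g$ (this does not depend on the ordering of vertices). $f_3$: for each edge $ij$ of the fundamental family, $d\varphi_{ij}=\sum\zeta_{i'j'}\zeta_{k'l'}\,dy_{i'j'k'l'}$, the sum over all tetrahedra of $\tilde M$ in the star of $ij$; for such a tetrahedron $ijkl$ (ordered positively), $i'j'k'l'$ is the tetrahedron of the fundamental family lying over the same tetrahedron of $M$, with vertices in the corresponding order. (This is the differential $d\ln\omega_{ij}$ of the logarithm of the product over the star of $ij$ of the cross-ratios corresponding to $ij$.) $f_4=g_2^{\mathrm T}$ and $f_5=g_1^{\mathrm T}$ (matrix transposes), where: $g_1\colon\mathfrak{so}(3,\mathbb C)_\rho\to(d\alpha^* )\oplus(d\beta^* )\oplus(dg)$ is given by $d\alpha_i^*=-da^*+\zeta_i\,dc^*$,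 $d\beta_i^*=2\zeta_i\,da^*+db^*-\zeta_i^2\,dc^*$ for main $i$ (with $(da^*,db^*,dc^* )$ the coordinates of the Lie algebra element) and zero component in $(dg)$; here $d\alpha_i^*=dh_i/(2\varkappa_i)$, $d\beta_i^*=dz_i$ for main $i$; $g_2\colon(d\alpha^* )\oplus(d\beta^* )\oplus(dg)\to(d\varphi^* )$ is the differential of the functions $$\varphi_{ij}^*=\frac12\,\frac{h_ih_j(z_i-z_j)^2}{\varkappa_i\varkappa_j(\zeta_i-\zeta_j)^2},$$ one for each edge $ij$ of the fundamental family, viewed as functions of main $h$'s, $z$'s and $g$.
   Formalization: Regularity of ρ also requires that dg parameterize all first-order deformations of ρ modulo infinitesimal conjugations; smooth parameterization of nearby classes alone does not give this, and exactness at (dy) then fails, e.g. for unipotent ρ on a Heisenberg nilmanifold. *)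

(* Defs.v *)
From HB Require Import structures.
From mathcomp Require Import all_boot all_order all_algebra.
From mathcomp Require Import finmap.
From mathcomp Require Import all_classical all_reals all_analysis.
From mathcomp Require Import complex ring.
Set Implicit Arguments.
Unset Strict Implicit.
Unset Printing Implicit Defensive.
Import Order.TTheory GRing.Theory Num.Theory.
Import numFieldNormedType.Exports.
Local Open Scope ring_scope.

Section Triangulations.
Variable V : finType.
Implicit Types (K L : {set {set V}}) (s A B : {set V}).

(* Finite abstract simplicial complexes: K is the set of the nonempty simplices,
   and every element of V is a vertex. *)
Definition simplicial_complex K : Prop :=
  [/\ finset.set0 \notin K, forall v, [set v]%SET \in K
    & forall s s', s \in K -> s' \subset s -> s' != finset.set0 -> s' \in K].

Definition link K A : {set {set V}} :=
  [set s : {set V} | [&& s != finset.set0, [disjoint s & A] & A :|: s \in K]]%SET.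

Definition simplex_boundary B : {set {set V}} :=
  [set s : {set V} | (s != finset.set0) && (s \proper B)]%SET.

(* Bistellar (Pachner) move: when lk(A) is the boundary of a missing simplex B,
   the subcomplex A * dB is replaced by dA * B. *)
Definition bistellar L L' : Prop := exists A B : {set V},
  [/\ A \in L, B != finset.set0, B \notin L & [disjoint A & B]] /\
  link L A = simplex_boundary B /\
  L' = ([set s in L | ~~ (A \subset s)] :|:
        [set s : {set V} |
           [&& s \subset A :|: B, B \subset s & ~~ (A \subset s)]])%SET.

(* Triangulated 2-spheres: the complexes bistellarly equivalent to the boundary
   of a tetrahedron. The moves stay inside the fixed vertex type V; nothing is
   lost, since a triangulated 2-sphere reduces to the boundary of a tetrahedron
   by flips and by removals of vertices of degree three. *)
Inductive sphere2 : {set {set V}} -> Prop :=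
| sphere2_tetrahedron (S : {set V}) :
    #|S| = 4%N -> sphere2 (simplex_boundary S)
| sphere2_move L L' : sphere2 L -> bistellar L L' -> sphere2 L'.

Definition closed_3manifold K : Prop :=
  simplicial_complex K /\ forall v, sphere2 (link K [set v]%SET).

Definition ordered_tetrahedron K (a b c d : V) : bool :=
  uniq [:: a; b; c; d] && ([set a; b; c; d]%SET \in K).

(* [pos a b c d] says that the ordering a, b, c, d of a tetrahedron is positive;
   the last clause is coherence across the common face abc. *)
Definition orientation K (pos : V -> V -> V -> V -> bool) : Prop :=
  (forall a b c d, ordered_tetrahedron K a b c d ->
     [/\ pos b a c d = ~~ pos a b c d, pos a c b d = ~~ pos a b c d
       & pos a b d c = ~~ pos a b c d]) /\
  (forall a b c d e,
     ordered_tetrahedron K a b c d -> ordered_tetrahedron K a b c e ->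
     d != e -> pos a b c e = ~~ pos a b c d).

Definition edges K := {s : {set V} | (s \in K) && (#|s| == 2%N)}.
Definition tetrahedra K := {s : {set V} | (s \in K) && (#|s| == 4%N)}.

End Triangulations.

Local Open Scope classical_set_scope.

Section UniversalCover.
Variables (V : finType) (K : {set {set V}}) (pos : V -> V -> V -> V -> bool).
Variables (W : choiceType) (Kt : set {fset W}) (p : W -> V).

Definition shadow (sigma : {fset W}) : {set V} :=
  [set v | [exists w : sigma, p (val w) == v]]%SET.

Definition simplicial_covering : Prop :=
  [/\ ~ Kt fset0, forall w, Kt [fset w]%fset,
      forall sigma tau, Kt sigma -> (tau `<=` sigma)%fset ->
        tau != fset0 -> Kt tau
    & forall v, exists w, p w = v] /\
  (forall sigma, Kt sigma ->
     shadow sigma \in K /\ #|shadow sigma| = #|` sigma|%fset) /\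
  (forall w s, s \in K -> p w \in s ->
     exists! sigma, [/\ Kt sigma, w \in sigma & shadow sigma = s]).

Definition adjacent : rel W := fun a b => `[< Kt [fset a; b]%fset >].

Inductive edge_homotopic : seq W -> seq W -> Prop :=
| edge_homotopic_refl s : edge_homotopic s s
| edge_homotopic_sym s t : edge_homotopic s t -> edge_homotopic t s
| edge_homotopic_trans s t u :
    edge_homotopic s t -> edge_homotopic t u -> edge_homotopic s u
| edge_homotopic_stay s1 a s2 :
    edge_homotopic (s1 ++ [:: a, a & s2]) (s1 ++ a :: s2)
| edge_homotopic_face s1 a b c s2 : Kt [fset a; b; c]%fset ->
    edge_homotopic (s1 ++ [:: a, b, c & s2]) (s1 ++ [:: a, c & s2]).

Definition simply_connected : Prop :=
  [/\ exists w : W, True,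
      forall x y, exists2 s, path adjacent x s & last x s = y
    & forall x s, path adjacent x s -> last x s = x ->
        edge_homotopic (x :: s) [:: x]].

(* The universal cover with the lifted triangulation, and the group pi acting on
   it by deck transformations, simply transitively on the fibres: pi is the
   fundamental group of M = Kt / pi. *)
Record universal_cover (pi : groupType) (act : pi -> W -> W) : Prop := {
  cover_covering : simplicial_covering;
  cover_simply_connected : simply_connected;
  deck1 : forall w, act 1%g w = w;
  deckM : forall a b w, act (a * b)%g w = act a (act b w);
  deck_simplicial : forall a (sigma : {fset W}), Kt sigma ->
    Kt [fset act a w | w in sigma]%fset;
  deck_fibre : forall a w, p (act a w) = p w;
  deck_free : forall a w, act a w = w -> a = 1%g;
  deck_transitive : forall w w', p w = p w' -> exists a, act a w = w' }.

(* The chosen simplices of Kt over the vertices, the edges and the tetrahedra of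
   K (those over triangles play no role). Each edge carries some ordering of its
   ends, each tetrahedron some positive ordering of its vertices. *)
Definition fundamental_family (main : V -> W) (edge : edges K -> W * W)
    (tet : tetrahedra K -> W * W * W * W) : Prop :=
  [/\ forall v, p (main v) = v,
      forall e, let: (i, j) := edge e in
        Kt [fset i; j]%fset /\ [set p i; p j]%SET = val e
    & forall t, let: (i0, i1, i2, i3) := tet t in
        [/\ Kt [fset i0; i1; i2; i3]%fset,
            [set p i0; p i1; p i2; p i3]%SET = val t
          & pos (p i0) (p i1) (p i2) (p i3)]].

End UniversalCover.

Section Group.
Variable C : numClosedFieldType.

Definition mx3 (l : seq (seq C)) : 'M[C]_3 :=
  \matrix_(i, j) (nth [::] l i)`_j.

Definition form3 : 'M[C]_3 :=
  mx3 [:: [:: 0; 0; -1]; [:: 0; 2; 0]; [:: -1; 0; 0]].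
Definition lieA : 'M[C]_3 :=
  mx3 [:: [:: 2; 0; 0]; [:: 0; 0; 0]; [:: 0; 0; -2]].
Definition lieB : 'M[C]_3 :=
  mx3 [:: [:: 0; 2; 0]; [:: 0; 0; 1]; [:: 0; 0; 0]].
Definition lieC : 'M[C]_3 :=
  mx3 [:: [:: 0; 0; 0]; [:: 1; 0; 0]; [:: 0; 2; 0]].

Definition SO3 (P : 'M[C]_3) : Prop := P^T *m form3 *m P = form3 /\ \det P = 1.

(* X is the row of coordinates (da, db, dc). *)
Definition lie (X : 'rV[C]_3) : 'M[C]_3 :=
  X 0 0 *: lieA + X 0 1 *: lieB + X 0 2 *: lieC.

Lemma lie_linear a X Y : lie (a *: X + Y) = a *: lie X + lie Y.
Proof.
by apply/matrixP => i j; rewrite !mxE !mulrDl !mulrDr !mulrA [in RHS]addrACA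
  [X in X + _ = _]addrACA.
Qed.

Definition isotropic (h z : C) : 'cV[C]_3 :=
  \col_i [:: h * z ^+ 2; h * z; h]`_i.

Variable pi : groupType.

Definition representation (rho : pi -> 'M[C]_3) : Prop :=
  (forall a, SO3 (rho a)) /\ (forall a b, rho (a * b)%g = rho a *m rho b).

Definition equivalent (rho sigma : pi -> 'M[C]_3) : Prop :=
  exists P, SO3 P /\ forall a, sigma a = P *m rho a *m invmx P.

(* [rho + eps xi] is, to first order in eps, a representation in SO(3). *)
Definition infinitesimal_deformation (rho xi : pi -> 'M[C]_3) : Prop :=
  (forall a b, xi (a * b)%g = xi a *m rho b + rho a *m xi b) /\
  (forall a, (xi a)^T *m form3 *m rho a + (rho a)^T *m form3 *m xi a = 0).

(* The classes of representations near rho are smoothly (over C: holomorphically)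
   parameterized by g in U, with representatives rhog g. A neighbourhood of rho
   is one for pointwise convergence on pi, i.e. it bounds the variation on
   finitely many elements of pi. The last clause is the infinitesimal part of
   regularity: at a regular point the tangent space of the space of classes,
   that is first-order deformations of rho modulo first-order conjugations, is
   parameterized by dg. It does not follow from the clauses on actual
   representations, since the equations defining the representation space may
   be degenerate (non-reduced) at rho. *)
Record regular_family (rho : pi -> 'M[C]_3) (m : nat) (U : set 'rV[C]_m)
    (rhog : 'rV[C]_m -> pi -> 'M[C]_3) : Prop := {
  family_open : open U;
  family_0 : U 0;
  family_base : forall a, rhog 0 a = rho a;
  family_representation : forall g, U g -> representation (rhog g);
  family_smooth : forall g a, U g ->
    differentiable (fun g' : 'rV[C]_m => rhog g' a) g;
  family_distinct : forall g g', U g -> U g' ->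
    equivalent (rhog g) (rhog g') -> g = g';
  family_complete : exists (S : seq pi) (eps : C), 0 < eps /\
    forall sigma, representation sigma ->
      (forall a i j, a \in S -> `|sigma a i j - rho a i j| < eps) ->
      exists g, U g /\ equivalent (rhog g) sigma;
  family_tangent : forall xi, infinitesimal_deformation rho xi ->
    exists! dg : 'rV[C]_m, exists X : 'rV[C]_3, forall a,
      xi a = 'D_dg (fun g : 'rV[C]_m => rhog g a) (0 : 'rV[C]_m)
             + (lie X *m rho a - rho a *m lie X) }.

Definition centralizer (rho : pi -> 'M[C]_3) : {pred 'rV[C]_3} :=
  fun X => `[< forall a, lie X *m rho a = rho a *m lie X >].

Record psl (rho : pi -> 'M[C]_3) := Psl {
  psl_val :> 'rV[C]_3;
  _ : psl_val \in centralizer rho }.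

HB.instance Definition _ rho := [isSub for @psl_val rho].
HB.instance Definition _ rho := [Choice of psl rho by <:].

Lemma centralizer_submod rho : submod_closed (centralizer rho).
Proof.
split=> [|a X Y]; rewrite !unfold_in => /=; last first.
  move=> /asboolP hX /asboolP hY; apply/asboolP => g.
  by rewrite lie_linear mulmxDl mulmxDr -scalemxAl -scalemxAr hX hY.
by apply/asboolP => g; rewrite /lie !mxE !scale0r !addr0 mul0mx mulmx0.
Qed.

HB.instance Definition _ rho :=
  GRing.isSubmodClosed.Build C 'rV[C]_3 (centralizer rho) (centralizer_submod rho).
HB.instance Definition _ rho := [SubChoice_isSubLmodule of psl rho by <:].

Definition psl_dual (rho : pi -> 'M[C]_3) := {linear psl rho -> C^o}.

End Group.

Section Deformation.
Variables (C : numClosedFieldType) (V : finType) (W : choiceType).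
Variables (pi : groupType) (p : W -> V) (act : pi -> W -> W) (main : V -> W).
Variables (m : nat) (rhog : 'rV[C]_m -> pi -> 'M[C]_3).
Variables (zeta kappa : W -> C).
Implicit Types (h z : V -> C) (g : 'rV[C]_m).

(* The deck transformation taking the main vertex of the fibre of w to w. *)
Definition from_main (w : W) : pi := xget 1%g [set a | act a (main (p w)) = w].

Definition deformed_vector (w : W) h z g : 'cV[C]_3 :=
  rhog g (from_main w) *m isotropic (h (p w)) (z (p w)).
Definition deformed_h (w : W) h z g : C := deformed_vector w h z g 2 0.
Definition deformed_z (w : W) h z g : C :=
  deformed_vector w h z g 1 0 / deformed_vector w h z g 2 0.

Definition base_h : V -> C := fun v => kappa (main v).
Definition base_z : V -> C := fun v => zeta (main v).
Definition shift_at (f : V -> C) (v : V) (t : C) : V -> C :=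
  fun u => if u == v then f u + t else f u.

(* Partial derivatives at the base point h = base_h, z = base_z, g = 0. *)
Definition pd_h (F : (V -> C) -> (V -> C) -> 'rV[C]_m -> C) (v : V) : C :=
  derive1 (fun t : C => F (shift_at base_h v t) base_z 0 : C) 0.
Definition pd_z (F : (V -> C) -> (V -> C) -> 'rV[C]_m -> C) (v : V) : C :=
  derive1 (fun t : C => F base_h (shift_at base_z v t) 0 : C) 0.
Definition pd_g (F : (V -> C) -> (V -> C) -> 'rV[C]_m -> C) (k : 'I_m) : C :=
  derive1 (fun t : C => F base_h base_z (t *: delta_mx 0 k) : C) 0.

(* x; it does not depend on h, which f2 below keeps at its base value. *)
Definition cross_ratio (w0 w1 w2 w3 : W) h z g : C :=
  let y w := deformed_z w h z g in
  ((y w0 - y w1) * (y w2 - y w3)) / ((y w0 - y w3) * (y w2 - y w1)).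

Definition phi_star (i j : W) h z g : C :=
  2^-1 * ((deformed_h i h z g * deformed_h j h z g
           * (deformed_z i h z g - deformed_z j h z g) ^+ 2)
          / (kappa i * kappa j * (zeta i - zeta j) ^+ 2)).

End Deformation.

Section Maps.
Variables (C : numClosedFieldType) (V : finType) (K : {set {set V}}).
Variable pos : V -> V -> V -> V -> bool.
Variables (W : choiceType) (Kt : set {fset W}) (p : W -> V).
Variables (pi : groupType) (act : pi -> W -> W).
Variables (main : V -> W) (edge : edges K -> W * W).
Variable tet : tetrahedra K -> W * W * W * W.
Variables (rho : pi -> 'M[C]_3) (m : nat) (rhog : 'rV[C]_m -> pi -> 'M[C]_3).
Variables (zeta kappa : W -> C).

(* (dz) + (dg) *)
Definition space_zg := ({ffun V -> C} * 'rV[C]_m)%type.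
(* (dalpha) + (dbeta) + (dg)^*, and also its dual (dalpha^* ) + (dbeta^* ) + (dg):
   both in coordinates, for dual bases. *)
Definition space_abg := ({ffun V -> C} * {ffun V -> C} * 'rV[C]_m)%type.

Definition dz_lie (w : W) (X : 'rV[C]_3) : C :=
  2 * zeta w * X 0 0 + X 0 1 - zeta w ^+ 2 * X 0 2.

Definition f1 (X : psl rho) : space_zg := ([ffun v => dz_lie (main v) X], 0).

Definition f2 (u : space_zg) : {ffun tetrahedra K -> C} :=
  [ffun t => let: (w0, w1, w2, w3) := tet t in
     let x := cross_ratio p act main rhog w0 w1 w2 w3 in
     let dx := \sum_v pd_z main zeta kappa x v * u.1 v
               + \sum_k pd_g main zeta kappa x k * u.2 0 k in
     let dlnx := dx / x (base_h main kappa) (base_z main zeta) 0 in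
     dlnx / ((zeta w0 - zeta w2) * (zeta w3 - zeta w1))].

(* The vertex over v of the tetrahedron of the fundamental family over t. *)
Definition over (t : tetrahedra K) (v : V) : W :=
  let: (w0, w1, w2, w3) := tet t in
  if p w0 == v then w0 else if p w1 == v then w1
  else if p w2 == v then w2 else w3.

(* The star of ij in the universal cover: each of its tetrahedra appears exactly
   once as (t, k, l), where i, j, k, l are its vertices in a positive order and
   t is its image in K. *)
Definition star (i j : W) : set (tetrahedra K * W * W) :=
  [set x | let: (t, k, l) := x in
     [/\ Kt [fset i; j; k; l]%fset,
         [set p i; p j; p k; p l]%SET = val t & pos (p i) (p j) (p k) (p l)]].

Definition f3 (dy : {ffun tetrahedra K -> C}) : {ffun edges K -> C} :=
  [ffun e => let: (i, j) := edge e in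
     \sum_(x \in star i j)
        (let: (t, k, l) := x in
         (zeta (over t (p i)) - zeta (over t (p j)))
         * (zeta (over t (p k)) - zeta (over t (p l))) * dy t)].

Definition g1 (X : psl rho) : space_abg :=
  ([ffun v => - X 0 0 + zeta (main v) * X 0 2],
   [ffun v => dz_lie (main v) X], 0).

(* Since dalpha_v^* = dh_v / (2 kappa_v), d/dalpha_v^* = 2 kappa_v d/dh_v. *)
Definition g2 (u : space_abg) : {ffun edges K -> C} :=
  [ffun e => let: (i, j) := edge e in
     let phi := phi_star p act main rhog zeta kappa i j in
     \sum_v pd_h main zeta kappa phi v * (2 * kappa (main v) * u.1.1 v)
     + \sum_v pd_z main zeta kappa phi v * u.1.2 v
     + \sum_k pd_g main zeta kappa phi k * u.2 0 k].

Definition unit_at (v : V) : {ffun V -> C} := [ffun u => (u == v)%:R].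

Definition f4 (y : {ffun edges K -> C}) : space_abg :=
  ([ffun v => \sum_e g2 (unit_at v, 0, 0) e * y e],
   [ffun v => \sum_e g2 (0, unit_at v, 0) e * y e],
   \row_k \sum_e g2 (0, 0, delta_mx 0 k) e * y e).

Definition pairing_abg (u x : space_abg) : C :=
  \sum_v u.1.1 v * x.1.1 v + \sum_v u.1.2 v * x.1.2 v
  + \sum_k u.2 0 k * x.2 0 k.

Definition f5_fun (u : space_abg) : psl rho -> C^o :=
  fun X => pairing_abg u (g1 X).

Lemma f5_linear u : linear (f5_fun u).
Proof.
have E (Z : psl rho) (Z' : 'rV[C]_3) : psl_val Z = Z' -> f5_fun u Z = \sum_v u.1.1 v * (- Z' 0 0 + zeta (main v) * Z' 0 2)
                         + \sum_v u.1.2 v * dz_lie (main v) Z'.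
  move=> <-.
  rewrite /f5_fun /pairing_abg /= [X in _ + X]big1 ?addr0 => [|k _]; last by rewrite mxE mulr0.
  by congr (_ + _); apply: eq_bigr => v _; rewrite ffunE.
move=> a X Y; rewrite (E (a *: X + Y) (a *: psl_val X + psl_val Y)); last first.
  exact: (linearP (\val : psl rho -> 'rV[C]_3)).
rewrite (E X _ erefl) (E Y _ erefl) scalerDr [RHS]addrACA !scaler_sumr -!big_split /=.
by apply: eq_bigr => v _; rewrite /dz_lie !mxE /GRing.scale /=; ring.
Qed.
HB.instance Definition _ u :=
  GRing.isLinear.Build C (psl rho) C^o *:%R (f5_fun u) (f5_linear u).

(* f5 = g1^T, the functional on psl being given by its values. *)
Definition f5 (u : space_abg) : psl_dual rho := f5_fun u.

End Maps.

Definition exact_at (A B D : nmodType) (f : A -> B) (g : B -> D) : Prop :=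
  forall y, g y = 0 <-> exists x, f x = y.

(* Main.v *)
Require Import Defs.
From HB Require Import structures.
From mathcomp Require Import all_boot all_order all_algebra.
From mathcomp Require Import finmap.
From mathcomp Require Import all_classical all_reals all_analysis.
From mathcomp Require Import complex ring.
Set Implicit Arguments.
Unset Strict Implicit.
Unset Printing Implicit Defensive.
Import Order.TTheory GRing.Theory Num.Theory.
Import numFieldNormedType.Exports.
Local Open Scope ring_scope.

(** A variation (dh, dz, dg) moves the isotropic vector of every vertex w of the
    universal cover, at the speed [dvec]; these fields of tangent vectors are
    the ones with t (aw) = rho a (t w) + drho a (e w).  The whole complex is
    about such fields, looked at through their z-components (left half) or
    through the scalar products of the moving vectors (right half).

    Left half.  For one tetrahedron, d ln x / (zeta_02 zeta_31) is minus the
    third divided difference of dz on its four vertices.  It vanishes exactly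
    when dz is there a quadratic polynomial in zeta, that is, the field of an
    element of the Lie algebra.  Multiplied by zeta_ij zeta_kl it is the
    difference of two second divided differences, of the triangles ijk and ijl;
    so around an edge ij the sum telescopes, f3 f2 = 0, and conversely a dy
    killed by f3 is, near each edge, given by divided differences of a function
    ([edge_potential], [prescribed_edge_solution]).

    On each tetrahedron the solutions u of this problem differ by elements of
    the three-dimensional Lie algebra, and such an element is determined by its
    values at three vertices.  Hence local solutions can be glued.  Around a
    vertex this is possible because its link, a sphere, is connected with
    connected links of vertices and has no first cohomology; over the whole
    cover because the cover is simply connected ([star_solution], [gluing]).
    For the same reasons fields which come on each tetrahedron from the Lie
    algebra come from a single element of it ([rigidity]).  What is known of a
    sphere is exactly what survives flips ([sphere_like], [flip_sphere_like]).

    A global solution need not be equivariant, but it differs from its translate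
    by a deck transformation a by an element c(a) of the Lie algebra, and c is a
    1-cocycle, in other words a first-order deformation of rho.  Regularity says
    that such a deformation is the derivative of rho_g in a direction dg, up to
    an infinitesimal conjugation ([cocycle_to_family]).  This is how the summand
    (dg) enters and why exactness holds with it.  In the same way, the uniqueness
    of dg shows that a variation which is a field of the Lie algebra has dg = 0
    and commutes with rho ([family_rigid]).

    Right half.  As f4 and f5 are transposes, exactness there is by linear
    algebra ([solvable_dual]) the exactness of the transposed sequence from
    so(3)_rho through (dalpha^* ) + (dbeta^* ) + (dg) to (dphi^* ), continued by
    the transpose of f3.  Now dphi^*_ij is half the logarithmic derivative of
    the scalar product of the vectors i and j, and the transpose of f3 is the
    linear relation between the six scalar products of four isotropic vectors of
    a three-dimensional space ([lengths_tetrahedron], [f3_column_sum]).  Tangent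
    fields with prescribed variations of the scalar products again differ by
    elements of so(3) on each tetrahedron, so gluing, rigidity and the cocycle
    argument apply a second time ([lengths_variation], [g2_exact]). *)

(** * Triangulated spheres *)

Section Spheres.
Import mathcomp.boot.fintype mathcomp.boot.finset.
Variable V : finType.
Implicit Types (L : {set {set V}}) (s t A B F : {set V}).

(** What gluing uses of a 2-sphere, in a form that flips preserve: each simplex
    is in a triangle and each edge in two; the complex (F empty) and the links of its vertices (F a
    vertex) are connected; H^1 vanishes with any coefficients.  Functions and
    cochains take the place of paths and cycles, because they can be modified on
    the few vertices of a flip without subdividing anything. *)
Record sphere_like L : Prop := SphereLike {
  sl_set0 : set0 \notin L;
  sl_closed : forall s t, s \in L -> t \subset s -> t != set0 -> t \in L;
  sl_nonempty : exists s, s \in L;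
  sl_pure : forall s, s \in L -> exists t, [/\ t \in L, s \subset t & #|t| = 3%N];
  sl_edge : forall x y, x != y -> [set x; y]%SET \in L -> exists z z',
    [/\ z != z', z \notin [set x; y]%SET, z' \notin [set x; y]%SET,
        [set x; y; z]%SET \in L & [set x; y; z']%SET \in L];
  sl_connected : forall F (T : Type) (f : V -> T), (#|F| <= 1)%N ->
    (forall x y, x \notin F -> y \notin F -> F :|: [set x; y]%SET \in L -> f x = f y) ->
    forall x y, x \notin F -> y \notin F -> (x |: F)%SET \in L -> (y |: F)%SET \in L ->
    f x = f y;
  sl_H1 : forall (G : zmodType) (D : V -> V -> G),
    (forall x y z, [set x; y; z]%SET \in L -> D x y + D y z = D x z) ->
    exists E : V -> G, forall x y, [set x; y]%SET \in L -> D x y = E y - E x }.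

(** A flip in the symmetric form in which it only concerns the tetrahedron on
    A :|: B: there L has the faces not containing B and L' those not containing
    A, and elsewhere the two complexes agree. *)
Record flip L L' A B : Prop := Flip {
  flip_A : A != set0;
  flip_B : B != set0;
  flip_AB : [disjoint A & B];
  flip_card : #|A :|: B| = 4%N;
  flip_in : forall s, s != set0 -> s \subset A :|: B -> (s \in L) = ~~ (B \subset s);
  flip_in' : forall s, s != set0 -> s \subset A :|: B -> (s \in L') = ~~ (A \subset s);
  flip_out : forall s, ~~ (s \subset A :|: B) -> (s \in L') = (s \in L);
  flip_star : forall s, s \in L -> A \subset s -> s \subset A :|: B;
  flip_set0 : set0 \notin L' }.

(** Purity of L forces A :|: B to have four elements: for b in B a triangle
    containing A and B minus b must be exactly their union. *)
Lemma bistellar_flip L L' : sphere_like L -> bistellar L L' -> exists A B, flip L L' A B.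
Proof.
move=> SL [A [B [[AL B0 BL dAB] [lk ->]]]]; exists A, B.
have A0 : A != set0 by apply: contraNneq (sl_set0 SL) => <-.
have lkE s : s != set0 -> [disjoint s & A] -> (A :|: s \in L) = (s \proper B).
  move=> s0 dsA; have /setP/(_ s) := lk.
  by rewrite !inE s0 dsA.
have dD s : [disjoint s :\: A & A].
  by rewrite -setI_eq0; apply/eqP/setP => x; rewrite !inE; case: (x \in A); rewrite ?andbF.
have BnS s : s \in L -> B \subset s -> False.
  by move=> sL Bs; move/negP: BL; apply; exact: (sl_closed SL sL).
have star s : s \in L -> A \subset s -> s \subset A :|: B.
  move=> sL As; rewrite -subDset.
  have [->|s0] := eqVneq (s :\: A) set0; first exact: sub0set.
  by apply: proper_sub; rewrite -lkE // setDE setUIr setUCr setIT (setUidPr As).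
have AL' s : s \proper B -> A :|: s \in L.
  move=> sB; have [->|s0] := eqVneq s set0; first by rewrite setU0.
  rewrite lkE // -setI_eq0; apply/eqP/setP => x; rewrite !inE.
  apply/negP => /andP[xs xA]; have xB := subsetP (proper_sub sB) _ xs.
  by move: dAB => /pred0P /(_ x) /=; rewrite xA xB.
have inL s : s != set0 -> s \subset A :|: B -> (s \in L) = ~~ (B \subset s).
  move=> s0 sS; apply/idP/idP => [sL|Bs]; first by apply/negP => /(BnS _ sL).
  apply: (sl_closed SL (AL' (s :&: B) _)) => //.
    by rewrite properE subsetIr subsetI subxx andbT.
  by apply/subsetP => x xs; have := subsetP sS _ xs; rewrite !inE xs.
split=> //.
- have [b bB] := set0Pn _ B0.
  have pB : B :\ b \proper B by rewrite properD1.
  have [t [tL st t3]] := sl_pure SL (AL' _ pB).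
  have At : A \subset t by apply: subset_trans st; exact: subsetUl.
  have tB : t :\: A \subset B by rewrite subDset star.
  have Bt : B :\ b \subset t :\: A.
    rewrite subsetD (subset_trans _ st) ?subsetUr //=.
    by apply: disjointWl (proper_sub pB) _; rewrite disjoint_sym.
  have tnB : t :\: A \proper B.
    rewrite properE tB; apply/negP => Bt'; apply: (BnS _ tL).
    by rewrite (subset_trans Bt') ?subsetDl.
  have := subset_leq_card Bt; have := proper_card tnB.
  rewrite cardsD (setIidPr At) t3 (cardsD1 b B) bB add1n ltnS => h1 h2.
  have /eqP := leq_trans h2 (leqnn _); have e : #|B :\ b| = (3 - #|A|)%N by apply/eqP; rewrite eqn_leq h1 h2.
  have A3 : (#|A| <= 3)%N by rewrite -t3 subset_leq_card.
  by rewrite cardsU (disjoint_setI0 dAB) cards0 subn0 (cardsD1 b B) bB e add1n addnS subnKC.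
- move=> s s0 sS; rewrite !inE inL // sS.
  by case: (A \subset s); case: (B \subset s).
- move=> s sS; rewrite !inE (negPf sS) orbF /=; apply: andb_idr => sL.
  by apply/negP => /(star _ sL); exact/negP.
- rewrite !inE (negPf (sl_set0 SL)) /= sub0set subset0 (negPf B0) //.
Qed.

Lemma cards3_le (x y z : V) : (#|[set x; y; z]%SET| <= 3)%N.
Proof.
apply: leq_trans (leq_card_setU _ _) _; rewrite cards1 addn1 ltnS.
by rewrite cards2; case: (x != y).
Qed.

Lemma set3_sub (x y z : V) s : ([set x; y; z]%SET \subset s) = [&& x \in s, y \in s & z \in s].
Proof. by rewrite !subUset !sub1set andbA. Qed.

Lemma tetrahedron_sphere_like (S : {set V}) : #|S| = 4%N -> sphere_like (simplex_boundary S).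
Proof.
move=> S4.
have inB s : (s \in simplex_boundary S) = (s != set0) && (s \proper S) by rewrite inE.
have small s : s \subset S -> (#|s| <= 3)%N -> s \proper S.
  by move=> sS s3; rewrite properEcard sS S4.
have small3 x y z : x \in S -> y \in S -> z \in S -> [set x; y; z]%SET \in simplex_boundary S.
  move=> xS yS zS; rewrite inB small ?cards3_le ?set3_sub ?xS ?yS // andbT.
  by apply/set0Pn; exists x; rewrite !inE eqxx.
have [b bS] : exists b, b \in S by apply/card_gt0P; rewrite S4.
split.
- by rewrite inB eqxx.
- move=> s t; rewrite !inB => /andP[_ sS] ts ->.
  exact: sub_proper_trans ts sS.
- by exists [set b; b; b]%SET; exact: small3.
- move=> s; rewrite inB => /andP[s0 /properP[sS [a aS as']]].
  have E3 : #|S :\ a| = 3%N by move: S4; rewrite (cardsD1 a) aS => -[].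
  by exists (S :\ a); rewrite inB properD1 // andbT -card_gt0 E3 subsetD1 sS.
- move=> x y xy; rewrite inB => /andP[_ /proper_sub]; rewrite subUset !sub1set => /andP[xS yS].
  have : #|S :\: [set x; y]| == 2%N.
    by rewrite cardsD (setIidPr _) ?S4 ?cards2 ?xy // subUset !sub1set xS.
  move=> /cards2P[z [z' [zz E]]]; exists z, z'.
  have : z \in S :\: [set x; y] by rewrite E !inE eqxx.
  have : z' \in S :\: [set x; y] by rewrite E !inE eqxx orbT.
  rewrite !in_setD => /andP[-> zS] /andP[-> zS']; split=> //; exact: small3.
- move=> F T f F1 Hf x y xF yF; rewrite !inB => /andP[_ /proper_sub].
  rewrite subUset sub1set => /andP[xS FS] /andP[_ /proper_sub].
  rewrite subUset sub1set => /andP[yS _].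
  apply: Hf => //; rewrite inB small ?subUset ?FS ?sub1set ?xS //=.
    by rewrite andbT; apply/set0Pn; exists x; rewrite !inE eqxx orbT.
  apply: leq_trans (leq_card_setU _ _) _; rewrite -[3%N]/(1 + 2)%N leq_add //.
  by rewrite cards2; case: (x != y).
- move=> G D HD; exists (D b) => x y; rewrite inB => /andP[_ /proper_sub].
  rewrite subUset !sub1set => /andP[xS yS].
  by rewrite -(HD b x y) ?small3 // addrC addKr.
Qed.

(** The new simplices have all their vertices in the tetrahedron A :|: B, and its
    faces that L' keeps still form a disk; so each property of L' reduces to the
    one of L by an argument inside that tetrahedron. *)
Lemma flip_sphere_like L L' A B : sphere_like L -> flip L L' A B -> sphere_like L'.
Proof.
move=> SL FL; have [A0 B0 dAB S4 inL inL' outL star n0] := FL.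
pose S := A :|: B.
have BnL s : s \in L -> B \subset s -> False.
  move=> sL Bs; have := sl_closed SL sL Bs B0.
  by rewrite inL ?subsetUr // subxx.
have AnL' s : s \in L' -> A \subset s -> False.
  move=> sL As; have [sS|sS] := boolP (s \subset S).
    by move: sL; rewrite inL' ?As //; apply: contraNneq A0 => E; rewrite -subset0 -E.
  by move/negP: (sS); apply; apply: star => //; rewrite -outL.
have AB x : x \in A -> x \in B -> False.
  by move=> xA xB; have /pred0P/(_ x) := dAB; rewrite /= xA xB.
have [a aA] := set0Pn _ A0; have [b bB] := set0Pn _ B0.
have aS : a \in S by rewrite inE aA.
have bS : b \in S by rewrite inE bB orbT.
have bnA : b \notin A by apply/negP => /AB/(_ bB).
have anB : a \notin B by apply/negP => /(AB _ aA).
have closed' s t : s \in L' -> t \subset s -> t != set0 -> t \in L'.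
  move=> sL ts t0; have [tS|tS] := boolP (t \subset S).
    by rewrite inL' //; apply/negP => At; apply: (AnL' _ sL); exact: subset_trans ts.
  have sS : ~~ (s \subset S) by apply: contra tS; exact: subset_trans.
  by rewrite outL //; apply: (sl_closed SL) ts t0; rewrite -outL.
have edgeS x y z : x \in S -> y \in S -> z \in S -> ([set x; y; z]%SET \in L') = ~~ (A \subset [set x; y; z]%SET).
  move=> xS yS zS; rewrite inL' ?set3_sub ?xS ?yS //.
  by apply/set0Pn; exists x; rewrite !inE eqxx.
have edgeSL x y z : x \in S -> y \in S -> z \in S -> ([set x; y; z]%SET \in L) = ~~ (B \subset [set x; y; z]%SET).
  move=> xS yS zS; rewrite inL ?set3_sub ?xS ?yS //.
  by apply/set0Pn; exists x; rewrite !inE eqxx.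
split=> //.
- have [A1|A1] := eqVneq A [set a].
    by exists [set b; b; b]%SET; rewrite edgeS // A1 sub1set !inE !orbb; apply: contraTneq bB => <-.
  exists [set a; a; a]%SET; rewrite edgeS // !setUid; apply: contra A1 => As.
  by rewrite eqEsubset As sub1set aA.
- move=> s sL; have [sS|sS] := boolP (s \subset S); last first.
    have [t [tL st t3]] := sl_pure SL (etrans (esym (outL _ sS)) sL).
    exists t; split=> //; rewrite outL //; apply: contra sS; exact: subset_trans.
  have /subsetPn[a' aA' as'] : ~~ (A \subset s) by apply/negP; exact: AnL'.
  have aS' : a' \in S by rewrite inE aA'.
  have E3 : #|S :\ a'| = 3%N by move: S4; rewrite -/S (cardsD1 a') aS' => -[].
  exists (S :\ a'); split=> //; last by rewrite subsetD1 sS.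
  rewrite inL' ?subD1set -?card_gt0 ?E3 //.
  by apply/negP => /subsetP/(_ _ aA'); rewrite !inE eqxx.
- move=> x y xy xyL; have [|xyS] := boolP ([set x; y]%SET \subset S); last first.
    have [z [z' [zz zn zn' zL zL']]] := sl_edge SL xy (etrans (esym (outL _ xyS)) xyL).
    exists z, z'; split=> //; rewrite outL //; apply: contra xyS; apply: subset_trans; exact: subsetUl.
  rewrite subUset !sub1set => /andP[xS yS].
  have : #|S :\: [set x; y]| == 2%N.
    by rewrite cardsD (setIidPr _) ?S4 ?cards2 ?xy // subUset !sub1set xS.
  have Axy : ~~ (A \subset [set x; y]) by apply/negP; exact: AnL'.
  move=> /cards2P[z [z' [zz E]]].
  wlog zA : z z' zz E / z \in A.
    have /subsetPn[a' aA' as'] := Axy.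
    have : a' \in S :\: [set x; y] by rewrite in_setD as' inE aA'.
    rewrite E in_set2 => /orP[/eqP az|/eqP az] W; first by apply: (W z z') => //; rewrite -az.
    by apply: (W z' z); [rewrite eq_sym|rewrite setUC|rewrite -az].
  have : z \in S :\: [set x; y] by rewrite E !inE eqxx.
  have : z' \in S :\: [set x; y] by rewrite E !inE eqxx orbT.
  rewrite !in_setD => /andP[z'n zS'] /andP[zn zS].
  have z'L : [set x; y; z']%SET \in L'.
    rewrite edgeS //; apply/negP => /subsetP/(_ _ zA).
    by rewrite in_setU in_set1 (negPf zz) (negPf zn).
  have [z'A|z'B] := boolP (z' \in A).
    exists z, z'; split=> //; rewrite edgeS //; apply/negP => /subsetP/(_ _ z'A).
    by rewrite in_setU in_set1 eq_sym (negPf zz) (negPf z'n).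
  have {}z'B : z' \in B by move: zS'; rewrite inE (negPf z'B).
  have zn' : [set x; y; z]%SET \in L.
    rewrite edgeSL //; apply/negP => /subsetP/(_ _ z'B).
    by rewrite in_setU in_set1 eq_sym (negPf zz) (negPf z'n).
  (* Now A is contained in x y z and B in x y z': the new triangle x y z'
     replaces x y z, and the other triangle on the edge x y is taken from L. *)
  have z'nL : [set x; y; z']%SET \notin L.
    rewrite edgeSL // negbK; apply/subsetP => u uB.
    have uS : u \in S by rewrite inE uB orbT.
    have uz : u != z by apply: contraTneq uB => ->; apply/negP; exact: AB.
    rewrite in_setU; have [//|uxy] := boolP (u \in [set x; y]).
    have : u \in S :\: [set x; y] by rewrite in_setD uxy.
    by rewrite E in_set2 (negPf uz) in_set1.
  have xyL' : [set x; y]%SET \in L by apply: (sl_closed SL zn'); rewrite ?subsetUl //; apply/set0Pn; exists x; rewrite !inE eqxx.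
  have [u [u' [uu un un' uL uL']]] := sl_edge SL xy xyL'.
  wlog uz : u u' uu un un' uL uL' / u != z.
    have [uz|uz] := eqVneq u z; last by move=> W; apply: (W u u').
    by move=> W; apply: (W u' u) => //; rewrite eq_sym // -uz.
  have uS : u \notin S.
    apply/negP => uS; have : u \in S :\: [set x; y] by rewrite in_setD un.
    by rewrite E in_set2 (negPf uz) => /eqP uz'; move: z'nL; rewrite -uz' uL.
  exists u, z'; split=> //; first by apply: contraNneq uS => ->.
  by rewrite outL // set3_sub (negPf uS) !andbF.
(* In the tetrahedron A :|: B the link of F in L' is connected, so that f can
   be replaced there by a constant, which makes it compatible with L. *)
- move=> F T f F1 Hf x y xF yF xL yL.
  have F0 z : (z |: F) != set0 by apply/set0Pn; exists z; rewrite !inE eqxx.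
  have F0' (z t : V) : F :|: [set z; t] != set0 by apply/set0Pn; exists z; rewrite !inE eqxx orbT.
  have outS z : z \notin S -> ~~ (z |: F \subset S) by move=> zS; rewrite subUset sub1set (negPf zS).
  have outS' (z t : V) : z \notin S -> ~~ (F :|: [set z; t] \subset S).
    by move=> zS; rewrite !subUset !sub1set (negPf zS) andbF.
  have [FS|FS] := boolP (F \subset S); last first.
    have FSU (s : {set V}) : ~~ (s :|: F \subset S) by rewrite subUset (negPf FS) andbF.
    apply: (sl_connected SL F1 (f := f)) => //; rewrite -?outL //.
    by move=> u v uF vF uvL; apply: Hf => //; rewrite outL // setUC.
  have inS x' y' : x' \in S -> y' \in S -> x' \notin F -> y' \notin F ->
      x' |: F \in L' -> y' |: F \in L' -> f x' = f y'.
    move=> xS yS xF' yF' xL' yL'; have [<-//|xy] := eqVneq x' y'.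
    have [|] := boolP (F :|: [set x'; y'] \in L'); first exact: Hf.
    rewrite inL' ?negbK // ?subUset ?FS ?sub1set ?xS // => AF.
    have yA : y' \in A.
      apply: contraT => yA; case: (AnL' _ xL'); apply/subsetP => u uA.
      have := subsetP AF _ uA; rewrite !inE.
      by rewrite (_ : (u == y') = false) ?orbF 1?orbC //; apply: contraNF yA => /eqP <-.
    have xA : x' \in A.
      apply: contraT => xA; case: (AnL' _ yL'); apply/subsetP => u uA.
      have := subsetP AF _ uA; rewrite !inE.
      by rewrite (_ : (u == x') = false) 1?orbC //; apply: contraNF xA => /eqP <-.
    have [z zS zn] : exists2 z, z \in S & z \notin F :|: [set x'; y'].
      apply/subsetPn; apply/negP => /subset_leq_card; rewrite S4 leqNgt.
      apply/negP; rewrite negbK ltnS; apply: leq_trans (leq_card_setU _ _) _.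
      by rewrite -[3%N]/(1 + 2)%N leq_add // cards2; case: (x' != y').
    move: zn; rewrite !inE !negb_or => /and3P[zF zx zy].
    rewrite (Hf x' z) ?(Hf z y') // inL' // ?subUset ?FS ?sub1set ?xS ?yS ?zS //;
      apply/negP => /subsetP.
      by move=> /(_ _ xA); rewrite !inE (negPf xF') (negPf xy) eq_sym (negPf zx).
    by move=> /(_ _ yA); rewrite !inE (negPf yF') eq_sym (negPf xy) eq_sym (negPf zy).
  have [BF|BF] := boolP (B \subset F).
    have BS z : z |: F \in L' -> z \in S.
      move=> zL; apply: contraT => /outS; move=> /outL E; case: (BnL (z |: F)); rewrite -?E //.
      by apply: subset_trans BF _; exact: subsetUr.
    by apply: inS => //; exact: BS.
  have [c Hc] : exists c, forall z, z \in S -> z \notin F -> z |: F \in L' -> f z = c.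
    have [[r [rS rF rL]]|H] := pselect (exists r, [/\ r \in S, r \notin F & r |: F \in L']).
      by exists (f r) => z zS zF zL; exact: inS.
    by exists (f y) => z zS zF zL; case: H; exists z.
  pose f' z := if z \in S then c else f z.
  have f'E z : z \notin F -> z |: F \in L' -> f' z = f z.
    by move=> zF zL; rewrite /f'; case: ifP => // zS; rewrite (Hc z).
  have f'L : forall u v, u \notin F -> v \notin F -> F :|: [set u; v]%SET \in L -> f' u = f' v.
    move=> u v uF vF uvL; have [|uvS] := boolP (F :|: [set u; v] \subset S).
      by rewrite !subUset !sub1set => /and3P[_ uS vS]; rewrite /f' uS vS.
    have uvL' : F :|: [set u; v] \in L' by rewrite outL.
    rewrite !f'E ?(Hf u v) //; apply: closed' uvL' _ _ => //.
      by rewrite setUC; apply: setUS; rewrite sub1set !inE eqxx ?orbT.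
    by rewrite setUC; apply: setUS; rewrite sub1set !inE eqxx ?orbT.
  have toL x' : x' \notin F -> x' |: F \in L' -> exists x'', [/\ x'' \notin F, x'' |: F \in L & f' x'' = f x'].
    move=> xF' xL'; have [xS|xS] := boolP (x' \in S); last first.
      by exists x'; rewrite -outL ?f'E ?outS.
    have [Bx|Bx] := boolP (B \subset x' |: F); last first.
      by exists x'; rewrite inL ?subUset ?sub1set ?xS ?f'E.
    have xB : x' \in B.
      apply: contraR BF => xB; apply/subsetP => u uB; have := subsetP Bx _ uB.
      by rewrite !inE => /orP[/eqP ux|//]; rewrite -ux uB in xB.
    have [z zS zn] : exists2 z, z \in S & z \notin x' |: F.
      apply/subsetPn; apply/negP => /subset_leq_card; rewrite S4 leqNgt.
      apply/negP; rewrite negbK ltnS; apply: leq_trans (leq_card_setU _ _) _.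
      by rewrite cards1 -[3%N]/(1 + 2)%N leq_add // (leq_trans F1).
    move: zn; rewrite !inE negb_or => /andP[zx zF]; exists z; split=> //.
      rewrite inL ?subUset ?sub1set ?zS //; apply/negP => /subsetP/(_ _ xB).
      by rewrite !inE eq_sym (negPf zx) (negPf xF').
    by rewrite -f'E // /f' xS zS.
  have [x1 [x1F x1L <-]] := toL _ xF xL; have [y1 [y1F y1L <-]] := toL _ yF yL.
  exact: (sl_connected SL F1 f'L).
(* The vertex b of B is a hub of the part of L' in the tetrahedron: there D is
   the coboundary of D b, which extends it to the edges that only L has. *)
- move=> G D HD.
  have hub x y : x \in S -> y \in S -> [set x; y]%SET \in L' -> D b x + D x y = D b y.
    move=> xS yS xyL; apply: HD; rewrite edgeS //; apply/negP => Ab.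
    apply: (AnL' _ xyL); apply/subsetP => u uA; have := subsetP Ab _ uA.
    by rewrite !inE => /orP[/orP[/eqP ub|->]|->]; rewrite ?orbT //; rewrite -ub uA in bnA.
  pose D1 x y := if (x \in S) && (y \in S) then D b y - D b x else D x y.
  have D1E x y : [set x; y]%SET \in L' -> D1 x y = D x y.
    by move=> xyL; rewrite /D1; case: andP => // -[xS yS]; rewrite -(hub _ _ xS yS xyL) addrC addKr.
  have D1c x y z : [set x; y; z]%SET \in L -> D1 x y + D1 y z = D1 x z.
    move=> xyzL; have [|xyzS] := boolP ([set x; y; z]%SET \subset S).
      by rewrite set3_sub => /and3P[xS yS zS]; rewrite /D1 xS yS zS /= addrC addrA subrK.
    have xyzL' : [set x; y; z]%SET \in L' by rewrite outL.
    have pair u v : u \in [set x; y; z]%SET -> v \in [set x; y; z]%SET -> [set u; v]%SET \in L'.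
      move=> ux vx; apply: (closed' _ _ xyzL'); first by rewrite subUset !sub1set ux.
      by apply/set0Pn; exists u; rewrite !inE eqxx.
    by rewrite !D1E ?HD //; apply: pair; rewrite !inE eqxx ?orbT.
  have [E HE] := sl_H1 SL D1c.
  exists (fun x => if x \in S then E a + D1 a x else E x) => x y xyL.
  have pairn u v : [set u; v]%SET != set0 by apply/set0Pn; exists u; rewrite !inE eqxx.
  have ES u v : u \in S -> v \notin S -> [set u; v]%SET \in L' -> E a + D1 a u = E u.
    move=> uS vS uvL; have auL : [set a; u]%SET \in L.
      rewrite inL ?subUset ?sub1set ?aS ?uS //; apply/negP => Bau.
      have uL : [set u]%SET \in L.
        apply: (sl_closed SL (s := [set u; v]%SET)); rewrite ?subsetUl //.
          by rewrite -outL // subUset !sub1set (negPf vS) andbF.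
        by apply/set0Pn; exists u; rewrite inE.
      apply: (BnL _ uL); apply/subsetP => w wB; have := subsetP Bau _ wB.
      by rewrite !inE => /orP[/eqP wa|//]; rewrite -wa wB in anB.
    by rewrite (HE _ _ auL) addrC subrK.
  have [xS|xS] := boolP (x \in S); have [yS|yS] := boolP (y \in S).
  - rewrite -(D1E _ _ xyL) /D1 xS yS aS /= opprD addrACA subrr add0r.
    by rewrite opprB addrA subrK.
  - rewrite (ES x y) // -HE; last by rewrite -outL // subUset !sub1set (negPf yS) andbF.
    by rewrite D1E.
  - rewrite (ES y x) //; last by rewrite setUC.
    rewrite -HE; last by rewrite -outL // subUset !sub1set (negPf xS).
    by rewrite D1E.
  - rewrite -HE; last by rewrite -outL // subUset !sub1set (negPf xS).
    by rewrite D1E.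
Qed.

Lemma sphere2_like L : sphere2 L -> sphere_like L.
Proof.
elim=> [S S4|L1 L2 _ SL B12]; first exact: tetrahedron_sphere_like.
by have [A [B]] := bistellar_flip SL B12; exact: flip_sphere_like.
Qed.
End Spheres.

(** * Links and orientation *)

Section ManifoldLinks.
Import mathcomp.boot.fintype mathcomp.boot.finset.
Variables (V : finType) (K : {set {set V}}) (pos : V -> V -> V -> V -> bool).
Hypothesis K_manifold : closed_3manifold K.

Lemma simplex_face (s t : {set V}) : s \in K -> t \subset s -> t != set0 -> t \in K.
Proof. by case: K_manifold => -[_ _ H] _; exact: H. Qed.

Lemma link_like v : sphere_like (link K [set v]%SET).
Proof. by case: K_manifold => _ H; exact: sphere2_like. Qed.

Lemma in_link v (s : {set V}) : (s \in link K [set v]%SET) = [&& s != set0, v \notin s & v |: s \in K].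
Proof. by rewrite inE disjoint_sym disjoints1. Qed.

Lemma simplex_in_tetrahedron (s : {set V}) : s \in K -> s != set0 ->
  exists t, [/\ t \in K, s \subset t & #|t| = 4%N].
Proof.
move=> sK s0; have [v vs] := set0Pn _ s0.
have [t [tL st t3]] : exists t, [/\ t \in link K [set v]%SET, s :\ v \subset t & #|t| = 3%N].
  have [E|sv0] := eqVneq (s :\ v) set0.
    have [u uL] := sl_nonempty (link_like v); have [t [tL _ t3]] := sl_pure (link_like v) uL.
    by exists t; rewrite E sub0set.
  by apply: (sl_pure (link_like v)); rewrite in_link sv0 setD11 setD1K.
move: tL; rewrite in_link => /and3P[_ vt vtK]; exists (v |: t); split=> //.
  by rewrite -(setD1K vs) setUS.
by rewrite cardsU1 vt t3.
Qed.

Lemma triangle_two_tetrahedra x y z : uniq [:: x; y; z] -> [set x; y; z]%SET \in K ->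
  exists d d', [/\ d != d', ordered_tetrahedron K x y z d & ordered_tetrahedron K x y z d'].
Proof.
move=> U xyzK; have : [set y; z]%SET \in link K [set x]%SET.
  rewrite in_link setUA xyzK andbT; apply/andP; split; first by apply/set0Pn; exists y; rewrite !inE eqxx.
  by move: U; rewrite /= !inE => /and3P[].
have yz : y != z by move: U; rewrite /= !inE => /and3P[].
move=> /(sl_edge (link_like x) yz)[d [d' [dd dn dn']]].
rewrite !in_link !setUA => /and3P[_ xd dK] /and3P[_ xd' dK'].
exists d, d'; split=> //; rewrite /ordered_tetrahedron ?dK ?dK' andbT.
  by move: U xd dn; rewrite /= !inE !negb_or !(eq_sym d) => /and3P[/andP[-> ->] -> _] /andP[/andP[_ _] ->] /andP[-> ->].
by move: U xd' dn'; rewrite /= !inE !negb_or !(eq_sym d') => /and3P[/andP[-> ->] -> _] /andP[/andP[_ _] ->] /andP[-> ->].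
Qed.

Section Orientation.
Hypothesis K_oriented : orientation K pos.
Definition pos_tet x y z d := ordered_tetrahedron K x y z d && pos x y z d.

Lemma ordered_tetrahedron_swap12 a b c d : ordered_tetrahedron K b a c d = ordered_tetrahedron K a b c d.
Proof.
rewrite /ordered_tetrahedron (setUC [set b]%SET [set a]%SET) /= !inE (eq_sym b a).
rewrite !negb_or; congr (_ && _); by case: (a != b); case: (a != c); case: (a != d); case: (b != c); case: (b != d).
Qed.

Lemma ordered_tetrahedron_swap23 a b c d : ordered_tetrahedron K a c b d = ordered_tetrahedron K a b c d.
Proof.
rewrite /ordered_tetrahedron (setUAC [set a]%SET) /= !inE (eq_sym c b).
rewrite !negb_or; congr (_ && _); by case: (a != b); case: (a != c); case: (a != d); case: (b != c); case: (b != d); case: (c != d).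
Qed.

Lemma ordered_tetrahedron_swap34 a b c d : ordered_tetrahedron K a b d c = ordered_tetrahedron K a b c d.
Proof.
rewrite /ordered_tetrahedron (setUAC _ [set d]%SET) /= !inE (eq_sym d c).
rewrite !negb_or; congr (_ && _); by case: (a != b); case: (a != c); case: (a != d); case: (b != c); case: (b != d); case: (c != d).
Qed.

Lemma pos_unique x y z d e : pos_tet x y z d -> pos_tet x y z e -> d = e.
Proof.
move=> /andP[td pd] /andP[te pe]; apply/eqP; apply: contraT => de.
by have := K_oriented.2 _ _ _ _ _ td te de; rewrite pd pe.
Qed.

(** Coherence makes the two tetrahedra on a triangle opposite to each other, so
    that one of them is positive. *)
Lemma pos_exists x y z : uniq [:: x; y; z] -> [set x; y; z]%SET \in K -> exists d, pos_tet x y z d.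
Proof.
move=> U xyzK; have [d [d' [dd td td']]] := triangle_two_tetrahedra U xyzK.
have := K_oriented.2 _ _ _ _ _ td td' dd; case pd: (pos x y z d) => /= pd'.
  by exists d; rewrite /pos_tet td pd.
by exists d'; rewrite /pos_tet td' pd'.
Qed.

Lemma pos_swap12 a b c d : ordered_tetrahedron K a b c d -> pos b a c d = ~~ pos a b c d.
Proof. by move=> /K_oriented.1[]. Qed.
Lemma pos_swap23 a b c d : ordered_tetrahedron K a b c d -> pos a c b d = ~~ pos a b c d.
Proof. by move=> /K_oriented.1[]. Qed.
Lemma pos_swap34 a b c d : ordered_tetrahedron K a b c d -> pos a b d c = ~~ pos a b c d.
Proof. by move=> /K_oriented.1[]. Qed.

Lemma pos_tet_rot a b c d : pos_tet a b c d -> pos_tet a c d b.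
Proof.
move=> /andP[t pd]; have t1 : ordered_tetrahedron K a c b d by rewrite ordered_tetrahedron_swap23.
by rewrite /pos_tet ordered_tetrahedron_swap34 t1 pos_swap34 // pos_swap23 // pd.
Qed.
Lemma pos_tet_swap a b c d : pos_tet a b c d -> pos_tet b a d c.
Proof.
move=> /andP[t pd]; have t1 : ordered_tetrahedron K b a c d by rewrite ordered_tetrahedron_swap12.
by rewrite /pos_tet ordered_tetrahedron_swap34 t1 pos_swap34 // pos_swap12 // pd.
Qed.
End Orientation.
End ManifoldLinks.

(** * Simplices of the universal cover *)

Section Covering.
Import mathcomp.boot.fintype mathcomp.boot.finset mathcomp.finmap.finmap.
Variables (V : finType) (K : {set {set V}}).
Hypothesis K_manifold : closed_3manifold K.
Variables (W : choiceType) (Kt : set {fset W}) (p : W -> V).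
Hypothesis covering : simplicial_covering K Kt p.
Implicit Types (w a b c d : W) (sigma tau : {fset W}).

Lemma Kt_face sigma tau : Kt sigma -> (tau `<=` sigma)%fset -> tau != fset0 -> Kt tau.
Proof. by case: covering => -[_ _ H _] _; exact: H. Qed.

Lemma Kt_mem sigma tau w : Kt sigma -> (tau `<=` sigma)%fset -> w \in tau -> Kt tau.
Proof. by move=> H ts wt; apply: Kt_face H ts _; apply/fset0Pn; exists w. Qed.

Lemma shadow_simplex sigma : Kt sigma -> shadow p sigma \in K.
Proof. by case: covering => _ [H _] /H[]. Qed.

Lemma in_shadow sigma v : (v \in shadow p sigma) = [exists w : sigma, p (val w) == v].
Proof. by rewrite inE. Qed.

Lemma shadowP sigma v : reflect (exists2 w, w \in sigma & p w = v) (v \in shadow p sigma).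
Proof.
rewrite in_shadow; apply: (iffP existsP) => [[w /eqP E]|[w ws E]].
  by exists (val w) => //; exact: valP.
by exists [` ws]%fset; rewrite /= E.
Qed.

Lemma shadow4 a b c d : shadow p [fset a; b; c; d]%fset = [set p a; p b; p c; p d]%SET.
Proof.
apply/setP => v; apply/shadowP/idP => [[w]|].
  by rewrite !inE => /orP[/orP[/orP[]|]|] /eqP -> <-; rewrite eqxx ?orbT.
by rewrite !inE; case/orP => [/orP[/orP[]|]|] /eqP ->; [exists a|exists b|exists c|exists d]; rewrite ?inE ?eqxx ?orbT.
Qed.

Lemma Kt_inj sigma : Kt sigma -> {in sigma &, injective p}.
Proof.
case: covering => _ [H _] /H[_ E] a b aS bS pab.
have /imset_injP inj : #|[set p (val x) | x in [set: sigma]]%SET| == #|[set: sigma]%SET|.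
  rewrite cardsT -cardfE -E; apply/eqP; congr #|pred_of_set _|; apply/setP => v.
  rewrite inE; apply/imsetP/existsP => [[x _ ->]|[x /eqP <-]]; first by exists x.
  by exists x.
by have := inj [` aS]%fset [` bS]%fset; rewrite !inE /= => /(_ erefl erefl pab) /(congr1 val).
Qed.

Lemma simplex_lift w (s : {set V}) : s \in K -> p w \in s ->
  exists sigma, [/\ Kt sigma, w \in sigma, shadow p sigma = s &
    forall tau, Kt tau -> w \in tau -> shadow p tau = s -> tau = sigma].
Proof.
case: covering => _ [_ H] sK ws; have [sigma [[k1 k2 k3] u]] := H w s sK ws.
by exists sigma; split=> // tau t1 t2 t3; rewrite (u tau).
Qed.

(** The vertex over x among the neighbours of w: the link of w in the cover is
    identified with the link of p w by x |-> lift_at w x. *)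
Definition lift_at (w : W) (x : V) : W :=
  xget w (fun w' => Kt [fset w; w']%fset /\ p w' = x).

Lemma shadow2 a b : shadow p [fset a; b]%fset = [set p a; p b]%SET.
Proof.
have -> : [fset a; b]%fset = [fset a; a; a; b]%fset by rewrite !fsetUid.
by rewrite shadow4 !setUid.
Qed.

Lemma neighbour_unique w a a' : Kt [fset w; a]%fset -> Kt [fset w; a']%fset -> p a = p a' -> a = a'.
Proof.
move=> ka ka' E.
have [||sigma [_ _ _ u]] := @simplex_lift w (shadow p [fset w; a]%fset).
- exact: shadow_simplex.
- by rewrite shadow2 !inE eqxx.
have e1 := u _ ka (fset21 _ _) erefl.
have e2 := u _ ka' (fset21 _ _); rewrite !shadow2 -E -e1 in e2; have {}e2 := e2 erefl.
have : a \in [fset w; a']%fset by rewrite e2 !inE eqxx orbT.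
have : a' \in [fset w; a]%fset by rewrite -e2 !inE eqxx orbT.
by rewrite !inE => /orP[/eqP->|/eqP->//] /orP[/eqP->|/eqP->].
Qed.

Lemma lift_at_p w a : Kt [fset w; a]%fset -> lift_at w (p a) = a.
Proof.
move=> ka; rewrite /lift_at; case: xgetP => [b _ [kb E]|/(_ a)[]//].
exact: neighbour_unique kb ka E.
Qed.

Lemma pairs_in sigma w a : Kt sigma -> w \in sigma -> a \in sigma -> Kt [fset w; a]%fset.
Proof.
move=> k ws asi; apply: (Kt_mem k (w := w)); last by rewrite !inE eqxx.
by apply/fsubsetP => u; rewrite !inE => /orP[] /eqP ->.
Qed.

Lemma lift_at_simplex w (s : {set V}) : s \in K -> p w \in s ->
  exists sigma, [/\ Kt sigma, w \in sigma, shadow p sigma = s &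
    forall x, x \in s -> lift_at w x \in sigma /\ p (lift_at w x) = x].
Proof.
move=> sK ws; have [sigma [k wsi sh u]] := simplex_lift sK ws; exists sigma; split=> // x.
rewrite -sh => /shadowP[a asi <-]; by rewrite lift_at_p //; exact: (pairs_in k).
Qed.

Lemma lift_at4 w x y z : [set p w; x; y; z]%SET \in K ->
  [/\ Kt [fset w; lift_at w x; lift_at w y; lift_at w z]%fset,
   p (lift_at w x) = x, p (lift_at w y) = y & p (lift_at w z) = z].
Proof.
move=> sK; have [|sigma [k wsi sh H]] := @lift_at_simplex w _ sK; first by rewrite !inE eqxx.
have [x1 x2] : lift_at w x \in sigma /\ p (lift_at w x) = x by apply: H; rewrite !inE eqxx ?orbT.
have [y1 y2] : lift_at w y \in sigma /\ p (lift_at w y) = y by apply: H; rewrite !inE eqxx ?orbT.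
have [z1 z2] : lift_at w z \in sigma /\ p (lift_at w z) = z by apply: H; rewrite !inE eqxx ?orbT.
split=> //; apply: (Kt_mem k (w := w)); last by rewrite !inE eqxx.
by apply/fsubsetP => u; rewrite !inE => /orP[/orP[/orP[]|]|] /eqP ->.
Qed.

Lemma simplex_in_tet sigma w : Kt sigma -> w \in sigma ->
  exists T, [/\ Kt T, (sigma `<=` T)%fset & #|` T|%fset = 4%N].
Proof.
move=> k ws; have pws : p w \in shadow p sigma by apply/shadowP; exists w.
have [|t [tK st t4]] := simplex_in_tetrahedron K_manifold (shadow_simplex k).
  by apply/set0Pn; exists (p w).
have [|T [kT wT sh H]] := @lift_at_simplex w t tK; first exact: (subsetP st).
exists T; split=> //.
  apply/fsubsetP => u us; rewrite -(lift_at_p (pairs_in k ws us)).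
  by apply: (H _ _).1; apply: (subsetP st); apply/shadowP; exists u.
by case: covering => _ [/(_ _ kT)[_ <-] _]; rewrite sh.
Qed.

Lemma tet_cases T a b c : #|` T|%fset = 4%N -> uniq [:: a; b; c] -> ([fset a; b; c] `<=` T)%fset ->
  exists d, T = [fset a; b; c; d]%fset /\ uniq [:: a; b; c; d].
Proof.
move=> T4 U sT.
have c3 : #|` [fset a; b; c]|%fset = 3%N.
  move: U; rewrite /= !inE negb_or => /and3P[/andP[ab ac] bc _].
  rewrite fsetUC cardfsU1 !inE negb_or !(eq_sym c) ac bc cardfs2 ab //.
have : #|` (T `\` [fset a; b; c])|%fset = 1%N.
  by rewrite cardfsD (fsetIidPr sT) T4 c3.
move=> /eqP/cardfs1P[d E]; exists d.
have dn : d \notin [fset a; b; c]%fset.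
  have : d \in (T `\` [fset a; b; c])%fset by rewrite E inE.
  by rewrite in_fsetD => /andP[].
split.
  apply/fsetP => u; rewrite in_fsetU -E in_fsetD.
  by have [/(fsubsetP sT)->|] := boolP (u \in [fset a; b; c]%fset).
by move: dn; rewrite -[[:: a; b; c; d]]/(rcons [:: a; b; c] d) rcons_uniq U andbT !inE orbA.
Qed.

(** The link of w is isomorphic to that of p w in K, which is a sphere. *)
Lemma link_connected w (T : Type) (f : W -> T) :
  (forall a b, a != w -> b != w -> Kt [fset w; a; b]%fset -> f a = f b) ->
  forall a b, a != w -> b != w -> Kt [fset w; a]%fset -> Kt [fset w; b]%fset -> f a = f b.
Proof.
move=> Hf a b aw bw ka kb.
have pn u : u != w -> Kt [fset w; u]%fset -> p u != p w.
  move=> uw ku; apply: contra uw => /eqP E; apply/eqP.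
  by apply: (Kt_inj ku) => //; rewrite !inE eqxx ?orbT.
have inL u : u != w -> Kt [fset w; u]%fset -> p u |: set0 \in link K [set p w]%SET.
  move=> uw ku; rewrite in_link setU0 !inE (eq_sym (p w)) pn //=; apply/andP; split.
    by apply/set0Pn; exists (p u); rewrite inE.
  by rewrite -shadow2; exact: shadow_simplex.
have ka' := inL _ aw ka; have kb' := inL _ bw kb.
rewrite -(lift_at_p ka) -(lift_at_p kb).
apply: (sl_connected (link_like K_manifold (p w)) (F := set0) (f := fun x => f (lift_at w x))); rewrite ?in_set0 ?cards0 //.
move=> x y _ _; rewrite set0U in_link => /and3P[_ wn kK].
have [|k1 px py _] := @lift_at4 w x y y; first by rewrite -setUA setUid -setUA.
move: wn; rewrite !inE negb_or => /andP[wx wy].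
apply: Hf.
- by apply: contraNneq wx => E; rewrite -px E.
- by apply: contraNneq wy => E; rewrite -py E.
by move: k1; rewrite -fsetUA fsetUid.
Qed.

(** The tetrahedra around an edge form a cycle: the link of w' in the sphere
    around w is connected. *)
Lemma edge_link_connected w w' (T : Type) (f : W -> T) : w != w' -> Kt [fset w; w']%fset ->
  (forall a b, a \notin [fset w; w']%fset -> b \notin [fset w; w']%fset ->
     Kt [fset w; w'; a; b]%fset -> f a = f b) ->
  forall a b, a \notin [fset w; w']%fset -> b \notin [fset w; w']%fset ->
    Kt [fset w; w'; a]%fset -> Kt [fset w; w'; b]%fset -> f a = f b.
Proof.
move=> ww' kw Hf a b an bn ka kb.
have kk u : Kt [fset w; w'; u]%fset -> Kt [fset w; u]%fset.
  by move=> ku; apply: (pairs_in ku); rewrite !inE eqxx ?orbT.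
have pn u v : v \in [fset w; w']%fset -> u \notin [fset w; w']%fset -> Kt [fset w; w'; u]%fset -> p u != p v.
  move=> vw un ku; apply: contra un => /eqP E.
  suff -> : u = v by [].
  by apply: (Kt_inj ku _ _ E); rewrite in_fsetU ?vw // in_fset1 eqxx orbT.
have pw : p w != p w'.
  apply: contra ww' => /eqP E; apply/eqP.
  by apply: (Kt_inj kw) => //; rewrite !inE eqxx ?orbT.
have inL u : u \notin [fset w; w']%fset -> Kt [fset w; w'; u]%fset -> p u |: [set p w']%SET \in link K [set p w]%SET.
  move=> un ku; have puw : p u != p w by apply: pn => //; rewrite !inE eqxx.
  rewrite in_link in_setU1 in_set1 negb_or pw (eq_sym (p w)) puw; apply/and3P; split=> //.
    by apply/set0Pn; exists (p u); rewrite !inE eqxx.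
  have := shadow_simplex ku; have -> : [fset w; w'; u]%fset = [fset w; w; w'; u]%fset by rewrite fsetUid.
  by rewrite shadow4 setUid setUA setUAC.
have ka' := inL _ an ka; have kb' := inL _ bn kb.
have pun u : u \notin [fset w; w']%fset -> Kt [fset w; w'; u]%fset -> p u \notin [set p w']%SET.
  by move=> un ku; rewrite inE pn // !inE eqxx orbT.
rewrite -(lift_at_p (kk _ ka)) -(lift_at_p (kk _ kb)).
apply: (sl_connected (link_like K_manifold (p w)) (F := [set p w']%SET) (f := fun x => f (lift_at w x))); rewrite ?cards1 ?pun //.
move=> x y; rewrite !in_set1 => xw' yw'; rewrite in_link => /and3P[_ wn kK].
have [|k1 pw1 px py] := @lift_at4 w (p w') x y; first by rewrite -!setUA in kK *.
rewrite lift_at_p // in k1 pw1.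
move: wn; rewrite !inE !negb_or => /and3P[_ wx wy].
apply: Hf => //; rewrite !inE negb_or; apply/andP; split; apply/eqP => E.
- by move: wx; rewrite -px E eqxx.
- by move: xw'; rewrite -px E eqxx.
- by move: wy; rewrite -py E eqxx.
- by move: yw'; rewrite -py E eqxx.
Qed.

Lemma link_H1 w (G : zmodType) (D : W -> W -> G) :
  (forall a b c, a != w -> b != w -> c != w -> Kt [fset w; a; b; c]%fset -> D a b + D b c = D a c) ->
  exists E : W -> G, forall a b, a != w -> b != w -> Kt [fset w; a; b]%fset -> D a b = E b - E a.
Proof.
move=> HD.
have [|E HE] := sl_H1 (link_like K_manifold (p w)) (D := fun x y => D (lift_at w x) (lift_at w y)).
  move=> x y z; rewrite in_link => /and3P[_ wn kK].
  have [|k1 px py pz] := @lift_at4 w x y z; first by rewrite -!setUA in kK *.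
  move: wn; rewrite !inE !negb_or => /andP[/andP[wx wy] wz].
  apply: HD k1.
  - by apply: contraNneq wx => E; rewrite -px E.
  - by apply: contraNneq wy => E; rewrite -py E.
  - by apply: contraNneq wz => E; rewrite -pz E.
exists (fun a => E (p a)) => a b aw bw k.
have pn u : u != w -> Kt [fset w; u]%fset -> p u != p w.
  move=> uw ku; apply: contra uw => /eqP E'; apply/eqP.
  by apply: (Kt_inj ku) => //; rewrite !inE eqxx ?orbT.
have ka : Kt [fset w; a]%fset by apply: (pairs_in k); rewrite !inE eqxx ?orbT.
have kb : Kt [fset w; b]%fset by apply: (pairs_in k); rewrite !inE eqxx ?orbT.
rewrite -HE ?lift_at_p // in_link; apply/and3P; split.
- by apply/set0Pn; exists (p a); rewrite !inE eqxx.
- by rewrite !inE negb_or !(eq_sym (p w)) !pn.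
have := shadow_simplex k; have -> : [fset w; a; b]%fset = [fset w; w; a; b]%fset by rewrite fsetUid.
by rewrite shadow4 setUid -setUA.
Qed.
End Covering.

(** * Passing from tetrahedron to tetrahedron *)

Section StrongConnectivity.
Import mathcomp.finmap.finmap.
Variables (V : finType) (K : {set {set V}}).
Hypothesis K_manifold : closed_3manifold K.
Variables (W : choiceType) (Kt : set {fset W}) (p : W -> V).
Hypothesis covering : simplicial_covering K Kt p.
Implicit Types (w a b c d x y : W) (T : {fset W}).

Definition is_tet T := Kt T /\ #|` T|%fset = 4%N.

Lemma tet_edge T x y : is_tet T -> x \in T -> y \in T -> Kt [fset x; y]%fset.
Proof. by case=> k _; exact: (pairs_in covering k). Qed.

Lemma fset_sub3 T a b c : ([fset a; b; c] `<=` T)%fset = [&& a \in T, b \in T & c \in T].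
Proof. by rewrite !fsubUset !fsub1set andbA. Qed.

Lemma fset_neq_sub T T' : (T' `<=` T)%fset -> (#|` T'| < #|` T|)%N -> exists2 x, x \in T & x \notin T'.
Proof.
move=> sT c; have : (T `\` T')%fset != fset0.
  by rewrite -cardfs_gt0 cardfsD (fsetIidPr sT) subn_gt0.
by case/fset0Pn => x; rewrite in_fsetD => /andP[? ?]; exists x.
Qed.

Lemma tet_complete2 T a b : is_tet T -> a != b -> a \in T -> b \in T ->
  exists c d, T = [fset a; b; c; d]%fset /\ uniq [:: a; b; c; d].
Proof.
move=> [k T4] ab aT bT.
have [||c cT cn] := @fset_neq_sub T [fset a; b]%fset; first by rewrite !fsubUset !fsub1set aT.
  by rewrite T4 cardfs2 ab.
have U : uniq [:: a; b; c].
  by move: cn; rewrite /= !inE !negb_or ab !(eq_sym c) => /andP[-> ->].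
have [|d [E U4]] := @tet_cases _ T a b c T4 U; first by rewrite fset_sub3 aT bT.
by exists c, d.
Qed.

Lemma tet_complete1 T a : is_tet T -> a \in T ->
  exists b c d, T = [fset a; b; c; d]%fset /\ uniq [:: a; b; c; d].
Proof.
move=> tT aT; have [k T4] := tT.
have [||b bT bn] := @fset_neq_sub T [fset a]%fset; first by rewrite fsub1set.
  by rewrite T4 cardfs1.
have [|c [d H]] := tet_complete2 tT _ aT bT; last by exists b, c, d.
by move: bn; rewrite !inE eq_sym.
Qed.

Lemma tet_nonempty T : is_tet T -> exists a, a \in T.
Proof. by case=> _ T4; apply/fset0Pn; rewrite -cardfs_gt0 T4. Qed.

Lemma tet_around sigma w : Kt sigma -> w \in sigma -> exists T, is_tet T /\ (sigma `<=` T)%fset.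
Proof. by move=> k ws; have [T [kT sT T4]] := simplex_in_tet K_manifold covering k ws; exists T. Qed.

Lemma tet_at w : exists2 T, is_tet T & w \in T.
Proof.
have k1 : Kt [fset w]%fset by case: covering => -[_ H _ _] _; exact: H.
have [|T [tT sT]] := tet_around k1 (w := w); first by rewrite inE.
by exists T => //; rewrite -fsub1set.
Qed.

(** Strong connectivity of the triangulation is used as a statement on functions
    of tetrahedra: if X does not change across common triangles, it is constant,
    first around an edge, then around a vertex, then everywhere. *)
Section Constancy.
Variables (L : Type) (X : {fset W} -> L).

Lemma edge_star_constant w w' : w != w' -> Kt [fset w; w']%fset ->
  (forall T T' k, is_tet T -> is_tet T' -> k \notin [fset w; w']%fset ->
    ([fset w; w'; k] `<=` T)%fset -> ([fset w; w'; k] `<=` T')%fset -> X T = X T') ->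
  forall T T', is_tet T -> is_tet T' -> w \in T -> w' \in T -> w \in T' -> w' \in T' -> X T = X T'.
Proof.
move=> ww kw H T T' tT tT' wT wT2 wT' wT2'.
(* The values of X are carried by the vertices k opposite to the edge; T is a
   default for the other vertices. *)
pose f k := X (xget T (fun S => is_tet S /\ ([fset w; w'; k] `<=` S)%fset)).
have fE k S : k \notin [fset w; w']%fset -> is_tet S -> ([fset w; w'; k] `<=` S)%fset -> f k = X S.
  move=> kn tS sS; rewrite /f; case: xgetP => [S' _ [tS' sS']|/(_ S)[]//].
  exact: (H _ _ k).
have [a [b [ET U]]] := tet_complete2 tT ww wT wT2.
have [a' [b' [ET' U']]] := tet_complete2 tT' ww wT' wT2'.
have na : a \notin [fset w; w']%fset.
  by move: U; rewrite /= !inE !negb_or !(eq_sym a) => /and4P[/and3P[_ -> _] /andP[-> _] _ _].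
have na' : a' \notin [fset w; w']%fset.
  by move: U'; rewrite /= !inE !negb_or !(eq_sym a') => /and4P[/and3P[_ -> _] /andP[-> _] _ _].
have sT : ([fset w; w'; a] `<=` T)%fset by rewrite fset_sub3 wT wT2 ET !inE eqxx !orbT.
have sT' : ([fset w; w'; a'] `<=` T')%fset by rewrite fset_sub3 wT' wT2' ET' !inE eqxx !orbT.
rewrite -(fE a T) // -(fE a' T') //.
have kT := tT.1; have kT' := tT'.1.
have k3 S k : is_tet S -> ([fset w; w'; k] `<=` S)%fset -> Kt [fset w; w'; k]%fset.
  by move=> [kS _] s; apply: (Kt_mem covering kS s (w := w)); rewrite !inE eqxx.
apply: (edge_link_connected K_manifold covering ww kw) => //; try exact: k3 sT; try exact: k3 sT'.
move=> k l kn ln kl; have [|S [tS sS]] := tet_around kl (w := w); first by rewrite !inE eqxx.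
by rewrite (fE k S) ?(fE l S) //; apply: fsubset_trans sS; apply/fsubsetP => u;
  rewrite !inE => /orP[/orP[]|] /eqP ->; rewrite eqxx ?orbT.
Qed.

Lemma vertex_star_constant w :
  (forall T T' a b, is_tet T -> is_tet T' -> uniq [:: w; a; b] ->
    ([fset w; a; b] `<=` T)%fset -> ([fset w; a; b] `<=` T')%fset -> X T = X T') ->
  forall T T', is_tet T -> is_tet T' -> w \in T -> w \in T' -> X T = X T'.
Proof.
move=> H T T' tT tT' wT wT'.
pose f k := X (xget T (fun S => [/\ is_tet S, w \in S & k \in S])).
have edge a : a != w -> Kt [fset w; a]%fset ->
    forall S S', is_tet S -> is_tet S' -> w \in S -> a \in S -> w \in S' -> a \in S' -> X S = X S'.
  move=> aw ka; apply: edge_star_constant => //; first by rewrite eq_sym.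
  move=> S S' k tS tS' kn; apply: (H S S' a k) => //.
  by move: kn; rewrite /= !inE !negb_or (eq_sym w a) aw !(eq_sym k) => /andP[-> ->].
have fE k S : k != w -> is_tet S -> w \in S -> k \in S -> f k = X S.
  move=> kw tS wS kS; rewrite /f; case: xgetP => [S' _ [tS' wS' kS']|/(_ S)[]//].
  by apply: (edge k kw) => //; exact: (tet_edge tS).
have [a [b [c [ET U]]]] := tet_complete1 tT wT.
have [a' [b' [c' [ET' U']]]] := tet_complete1 tT' wT'.
have aw : a != w by move: U; rewrite /= !inE !negb_or eq_sym => /and4P[/and3P[]].
have aw' : a' != w by move: U'; rewrite /= !inE !negb_or eq_sym => /and4P[/and3P[]].
have aT : a \in T by rewrite ET !inE eqxx !orbT.
have aT' : a' \in T' by rewrite ET' !inE eqxx !orbT.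
rewrite -(fE a T) // -(fE a' T') //.
apply: (link_connected K_manifold covering _ aw aw' (tet_edge tT wT aT) (tet_edge tT' wT' aT')).
move=> k l kw lw kl; have [|S [tS]] := tet_around kl (w := w); first by rewrite !inE eqxx.
by rewrite fset_sub3 => /and3P[wS kS lS]; rewrite (fE k S) ?(fE l S).
Qed.

Lemma tet_constant : simply_connected Kt ->
  (forall T T' a b c, is_tet T -> is_tet T' -> uniq [:: a; b; c] ->
    ([fset a; b; c] `<=` T)%fset -> ([fset a; b; c] `<=` T')%fset -> X T = X T') ->
  forall T T', is_tet T -> is_tet T' -> X T = X T'.
Proof.
move=> [_ conn _] H T T' tT tT'.
have [x xT] := tet_nonempty tT; have [y yT'] := tet_nonempty tT'.
have [s] := conn x y; elim: s x T tT xT => [|z s IH] x T tT xT /=.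
  by move=> _ xy; apply: (@vertex_star_constant y) => //; [move=> ? ? a b; exact: H|rewrite -xy].
move=> /andP[/asboolP xz ps] ls.
have [|S [tS]] := tet_around xz (w := x); first by rewrite !inE eqxx.
rewrite fsubUset !fsub1set => /andP[xS zS].
rewrite -(IH z S) //; apply: (@vertex_star_constant x) => //.
by move=> ? ? a b; exact: H.
Qed.
End Constancy.
End StrongConnectivity.

(** * Gluing local solutions *)

(** [v X w] is the velocity at the vertex w of the infinitesimal motion X.  It is
    kept abstract because gluing is used twice, for the z-components (M = C) and
    for the isotropic vectors (M = C^3).  [P T u] says that u solves the problem
    at hand on the tetrahedron T. *)
Section Gluing.
Import mathcomp.finmap.finmap.
Variables (V : finType) (K : {set {set V}}).
Hypothesis K_manifold : closed_3manifold K.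
Variables (W : choiceType) (Kt : set {fset W}) (p : W -> V).
Hypothesis covering : simplicial_covering K Kt p.
Hypothesis Kt_sc : simply_connected Kt.
Variables (G M : zmodType) (v : G -> W -> M).
Hypothesis vB : forall X Y w, v (X - Y) w = v X w - v Y w.
Hypothesis v_inj : forall a b c X, uniq [:: a; b; c] -> Kt [fset a; b; c]%fset ->
  v X a = 0 -> v X b = 0 -> v X c = 0 -> X = 0.
Implicit Types (w a b c d x y : W) (T : {fset W}) (u : W -> M).
Local Notation is_tet := (is_tet Kt).

Lemma v0 w : v 0 w = 0.
Proof. by rewrite -(subrr 0) vB subrr. Qed.
Lemma vN X w : v (- X) w = - v X w.
Proof. by rewrite -[- X]add0r vB v0 add0r. Qed.
Lemma vD X Y w : v (X + Y) w = v X w + v Y w.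
Proof. by rewrite -{1}[Y]opprK vB vN opprK. Qed.

Lemma v_tri T a b c X Y : is_tet T -> uniq [:: a; b; c] -> ([fset a; b; c] `<=` T)%fset ->
  (forall x, x \in [fset a; b; c]%fset -> v X x = v Y x) -> X = Y.
Proof.
move=> [kT _] U sT E; apply/eqP; rewrite -subr_eq0; apply/eqP.
have kt : Kt [fset a; b; c]%fset by apply: (Kt_mem covering kT sT (w := a)); rewrite !inE eqxx.
by apply: (v_inj U kt); rewrite vB E ?subrr // !inE eqxx ?orbT.
Qed.

Lemma v_tet T X Y : is_tet T -> (forall x, x \in T -> v X x = v Y x) -> X = Y.
Proof.
move=> tT E; have [a aT] := tet_nonempty tT.
have [b [c [d [ET U]]]] := tet_complete1 tT aT.
apply: (@v_tri T a b c) => //.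
- by move: U; rewrite -[[:: a; b; c; d]]/(rcons [:: a; b; c] d) rcons_uniq => /andP[].
- by rewrite fset_sub3 ET !inE !eqxx !orbT.
by move=> x xs; apply: E; rewrite ET; move: xs; rewrite !inE => ->.
Qed.

(** Two tetrahedra with a common triangle have the same X, because X is determined
    by its values at three vertices; so X is the same everywhere. *)
Lemma rigidity u : (forall T, is_tet T -> exists X, forall x, x \in T -> u x = v X x) ->
  exists X, forall x, u x = v X x.
Proof.
move=> H; have /choice[XT HXT] : forall T, exists X, is_tet T -> forall x, x \in T -> u x = v X x.
  move=> T; have [tT|n] := pselect (is_tet T); last by exists 0.
  by have [X HX] := H T tT; exists X.
have const := tet_constant K_manifold covering (X := XT) Kt_sc.
have [[x0 _] _ _] := Kt_sc; have [T0 tT0 _] := tet_at K_manifold covering x0.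
exists (XT T0) => x; have [T tT xT] := tet_at K_manifold covering x.
rewrite (const _ T0 T) //; first exact: HXT.
move=> S S' a b c tS tS' U s s'; apply: (v_tri tS U s) => y ys.
by rewrite -!HXT //; [apply: (fsubsetP s')|apply: (fsubsetP s)].
Qed.

Variable P : {fset W} -> (W -> M) -> Prop.
Hypothesis P_torsor : forall T u u', is_tet T -> P T u -> P T u' ->
  exists X, forall x, x \in T -> u' x = u x + v X x.
Hypothesis P_shift : forall T u u' X, is_tet T -> P T u ->
  (forall x, x \in T -> u' x = u x + v X x) -> P T u'.
Hypothesis edge_solution : forall i j, i != j -> Kt [fset i; j]%fset ->
  exists u, forall T, is_tet T -> i \in T -> j \in T -> P T u.

(** Let ue a solve the problem on the star of the edge wa.  On the tetrahedra
    that contain w, a and b, the solutions ue b and ue a differ by one motion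
    D a b, and D is a 1-cocycle on the link of w.  As the link has no H^1, D is a
    coboundary E b - E a, and the corrected solutions ue a - E a fit together. *)
Lemma star_solution w : exists u, forall T, is_tet T -> w \in T -> P T u.
Proof.
have /choice[ue Hue] : forall a, exists u, a != w -> Kt [fset w; a]%fset ->
    forall T, is_tet T -> w \in T -> a \in T -> P T u.
  move=> a; have [aw|n] := boolP (a != w); last by exists (fun=> 0).
  have [ka|n] := pselect (Kt [fset w; a]%fset); last by exists (fun=> 0).
  by have [|u Hu] := @edge_solution w a _ ka; [rewrite eq_sym|exists u].
have sub3 T a b : w \in T -> a \in T -> b \in T -> ([fset w; a; b] `<=` T)%fset.
  by move=> wT aT bT; rewrite fset_sub3 wT aT.
have ex2 (ab : W * W) : exists X, ab.1 != w -> ab.2 != w -> forall T, is_tet T -> w \in T -> ab.1 \in T -> ab.2 \in T ->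
    forall x, x \in T -> ue ab.2 x = ue ab.1 x + v X x.
  case: ab => a b /=; have [<-|ab] := eqVneq a b.
    by exists 0 => _ _ T _ _ _ _ x _; rewrite v0 addr0.
  have [aw|n] := boolP (a != w); last by exists 0.
  have [bw|n] := boolP (b != w); last by exists 0.
  have [[T [tT wT aT bT]]|n] := pselect (exists T, [/\ is_tet T, w \in T, a \in T & b \in T]); last first.
    by exists 0 => _ _ T tT wT aT bT; case: n; exists T.
  have PT c S : c != w -> is_tet S -> w \in S -> c \in S -> P S (ue c).
    by move=> cw tS wS cS; apply: Hue => //; exact: (tet_edge covering tS).
  have [X HX] := P_torsor tT (PT _ _ aw tT wT aT) (PT _ _ bw tT wT bT).
  exists X => _ _ S tS wS aS bS; have [Y HY] := P_torsor tS (PT _ _ aw tS wS aS) (PT _ _ bw tS wS bS).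
  suff -> : X = Y by [].
  apply: (@v_tri T w a b) => //; last 1 first.
  - move=> x; rewrite !inE => xs; apply: (addrI (ue a x)); rewrite -HX -?HY //;
    by move: xs => /orP[/orP[]|] /eqP ->.
  - by rewrite /= !inE negb_or !(eq_sym w) aw bw ab.
  - exact: sub3.
have /choice[D' HD'] := ex2; pose D a b := D' (a, b).
have HD a b := HD' (a, b); rewrite /= -/(D _ _) in HD.
have [|E HE] := link_H1 K_manifold covering (w := w) (D := D).
  move=> a b c aw bw cw k; have [|T [tT sT]] := tet_around K_manifold covering k (w := w).
    by rewrite !inE eqxx.
  have [wT aT bT cT] : [/\ w \in T, a \in T, b \in T & c \in T].
    by split; apply: (fsubsetP sT); rewrite !inE eqxx ?orbT.
  apply: (v_tet tT) => x xT; apply: (addrI (ue a x)).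
  by rewrite vD addrA -(HD a b aw bw T) // -(HD b c bw cw T) // -(HD a c aw cw T).
pose u' a x := ue a x - v (E a) x.
have u'E a b T : a != w -> b != w -> is_tet T -> w \in T -> a \in T -> b \in T ->
    forall x, x \in T -> u' a x = u' b x.
  move=> aw bw tT wT aT bT x xT; rewrite /u' (HD a b aw bw T) // -/(D a b) HE //.
    by rewrite vB addrA addrAC addrK.
  by apply: (Kt_mem covering tT.1 (w := w)); [exact: sub3|rewrite !inE eqxx].
have [T0 tT0 wT0] := tet_at K_manifold covering w.
have [a0 [b0 [c0 [ET0 U0]]]] := tet_complete1 tT0 wT0.
have a0w : a0 != w by move: U0; rewrite /= !inE !negb_or eq_sym => /and4P[/and3P[]].
have a0T : a0 \in T0 by rewrite ET0 !inE eqxx !orbT.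
have u'w a : a != w -> Kt [fset w; a]%fset -> u' a w = u' a0 w.
  move=> aw ka; apply: (link_connected K_manifold covering (f := fun a => u' a w) _ aw a0w ka (tet_edge covering tT0 wT0 a0T)).
  move=> b c bw cw k; have [|T [tT]] := tet_around K_manifold covering k (w := w).
    by rewrite !inE eqxx.
  by rewrite fset_sub3 => /and3P[wT bT cT]; exact: (u'E b c T).
(* All the u' a take the same value at w, which has no solution of its own. *)
exists (fun x => if x == w then u' a0 w else u' x x) => T tT wT.
have [a [b [c [ET U]]]] := tet_complete1 tT wT.
have aw : a != w by move: U; rewrite /= !inE !negb_or eq_sym => /and4P[/and3P[]].
have aT : a \in T by rewrite ET !inE eqxx !orbT.
have ka : Kt [fset w; a]%fset by exact: (tet_edge covering tT).
apply: (P_shift (u := ue a) (X := - E a)) => //; first exact: Hue.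
move=> x xT; rewrite vN -/(u' a x); have [->|xw] := eqVneq x w; first by rewrite u'w.
exact: (u'E x a T).
Qed.

(** Solutions us a on the stars of the vertices differ along an edge ab by one
    motion D a b.  Now D is a 1-cocycle of the whole cover; its sums along edge
    paths are invariant under edge homotopy, so that simple connectivity makes it
    a coboundary, by which the us a are corrected. *)
Lemma gluing : exists u, forall T, is_tet T -> P T u.
Proof.
have /choice[us Hus] := star_solution.
have ex2 (ab : W * W) : exists X, forall T, is_tet T -> ab.1 \in T -> ab.2 \in T ->
    forall x, x \in T -> us ab.2 x = us ab.1 x + v X x.
  case: ab => a b /=; have [<-|ab] := eqVneq a b.
    by exists 0 => T _ _ _ x _; rewrite v0 addr0.
  have [[T0 [tT0 aT0 bT0]]|n] := pselect (exists T, [/\ is_tet T, a \in T & b \in T]); last first.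
    by exists 0 => T tT aT bT; case: n; exists T.
  have /choice[XT HXT] : forall T, exists X, is_tet T -> a \in T -> b \in T -> forall x, x \in T -> us b x = us a x + v X x.
    move=> T; have [[tT aT bT]|n] := pselect [/\ is_tet T, a \in T & b \in T]; last by exists 0 => tT aT bT; case: n.
    by have [X HX] := P_torsor tT (Hus a T tT aT) (Hus b T tT bT); exists X.
  exists (XT T0) => T tT aT bT; rewrite -(@edge_star_constant _ _ K_manifold _ _ _ covering _ XT a b _ _ _ T T0) //.
  - exact: HXT.
  - exact: (tet_edge covering tT).
  move=> S S' k tS tS' kn s s'; apply: (v_tri tS _ s).
    by move: kn; rewrite /= !inE !negb_or ab !(eq_sym k) => /andP[-> ->].
  move: (s) (s'); rewrite !fset_sub3 => /and3P[aS bS kS] /and3P[aS' bS' kS'].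
  move=> x xs; apply: (addrI (us a x)); rewrite -!HXT //.
    exact: (fsubsetP s').
  exact: (fsubsetP s).
have /choice[D' HD'] := ex2; pose D a b := D' (a, b).
have HD a b := HD' (a, b); rewrite /= -/(D _ _) in HD.
have Dcocycle a b c : Kt [fset a; b; c]%fset -> D a b + D b c = D a c.
  move=> k; have [|T [tT]] := tet_around K_manifold covering k (w := a).
    by rewrite !inE eqxx.
  rewrite fset_sub3 => /and3P[aT bT cT].
  apply: (v_tet tT) => x xT; apply: (addrI (us a x)).
  by rewrite vD addrA -(HD a b T) // -(HD b c T) // -(HD a c T).
have k1 a : Kt [fset a]%fset by case: covering => -[_ H _ _] _; exact: H.
have D0 a : D a a = 0.
  by apply: (addrI (D a a)); rewrite addr0 Dcocycle // !fsetUid.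
have DN a b : Kt [fset a; b]%fset -> D b a = - D a b.
  move=> k; apply/eqP; rewrite -addr_eq0 addrC -(D0 a); apply/eqP/Dcocycle.
  by rewrite fsetUAC fsetUid.
(* The sum of D along a path, given with or without its initial vertex. *)
pose fix psum x s := if s is y :: s' then D x y + psum y s' else 0.
pose qsum s := if s is x :: s' then psum x s' else 0.
have qsum_cat s a s' : qsum (s ++ a :: s') = qsum (rcons s a) + psum a s'.
  case: s => [|x s] /=; first by rewrite add0r.
  by elim: s x => [|y s IH] x /=; rewrite ?addr0 // IH addrA.
have hom s t : edge_homotopic Kt s t -> qsum s = qsum t.
  elim=> // {s t} [s t u _ -> _ ->//|s a t|s a b c t k].
    by rewrite !qsum_cat /= D0 add0r.
  by rewrite !qsum_cat /= [D a b + _]addrA Dcocycle.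
have psum_cat x s t : psum x (s ++ t) = psum x s + psum (last x s) t.
  by elim: s x => [|y s IH] x /=; rewrite ?add0r // IH addrA.
have rev_path x s : path (Defs.adjacent Kt) x s -> exists2 t, path (Defs.adjacent Kt) (last x s) t &
    last (last x s) t = x /\ psum (last x s) t = - psum x s.
  elim: s x => [|y s IH] x /=; first by exists [::] => //=; rewrite oppr0.
  move=> /andP[/asboolP xy /IH[t pt [lt st]]]; exists (rcons t x).
    rewrite rcons_path pt lt /=; apply/asboolP.
    by rewrite fsetUC.
  rewrite last_rcons -cats1 psum_cat st lt /= addr0 opprD addrC; split=> //.
  by rewrite DN.
have [[x0 _] conn loops] := Kt_sc.
have /choice[pth Hpth] : forall y, exists s, path (Defs.adjacent Kt) x0 s /\ last x0 s = y.
  by move=> y; have [s ? ?] := conn x0 y; exists s.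
(* The potential at y is the sum along any path from x0 to y. *)
pose E y := psum x0 (pth y).
have DE a b : Kt [fset a; b]%fset -> D a b = E b - E a.
  move=> k; have [pa la] := Hpth a; have [pb lb] := Hpth b.
  have [t pt [lt st]] := rev_path _ _ pb; rewrite lb in pt lt st.
  have := loops x0 (pth a ++ b :: t); rewrite cat_path pa la /= pt andbT last_cat /=.
  move=> /(_ (asboolT k) lt)/hom /=; rewrite psum_cat la /= st => /eqP.
  by rewrite addrA subr_eq0 /E => /eqP <-; rewrite addrAC subrr add0r.
exists (fun x => us x x - v (E x) x) => T tT; have [w wT] := tet_nonempty tT.
apply: (P_shift (u := us w) (X := - E w)) => //; first exact: Hus.
move=> x xT; rewrite (HD w x T) // -/(D w x) DE; last exact: (tet_edge covering tT).
by rewrite vB vN addrA addrAC addrK.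
Qed.
End Gluing.

Local Open Scope classical_set_scope.
Local Open Scope ring_scope.

(** * The group SO(3) and its Lie algebra *)

Lemma sum_ord3 (A : nmodType) (f : 'I_3 -> A) : \sum_i f i = f 0 + f 1 + f 2.
Proof.
rewrite !big_ord_recl big_ord0 addr0 addrA.
by congr (f _ + f _ + f _); apply: val_inj.
Qed.

Lemma ord3_ind (P : 'I_3 -> Prop) : P 0 -> P 1 -> P 2 -> forall i, P i.
Proof.
move=> P0 P1 P2 [[|[|[|//]]] lti]; [move: P0|move: P1|move: P2];
  by congr P; apply: val_inj.
Qed.

Section SO3Algebra.
Variable C : numClosedFieldType.

Lemma subr_neq0_sym (A : zmodType) (x y : A) : x - y != 0 -> y - x != 0.
Proof. by move=> xy; rewrite -opprB oppr_eq0. Qed.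

(** Solves a linear equation z = 0 for x: the proof of x = y is left as an identity,
    with k the factor by which z has to be multiplied. *)
Lemma lin_solve (x y z k : C) : z = 0 -> x - y = k * z -> x = y.
Proof. by move=> -> /eqP; rewrite mulr0 subr_eq0 => /eqP. Qed.

Lemma lin_solve0 (x y z t k : C) : z = t -> x - y = k * (z - t) -> x = y.
Proof. by move=> -> /eqP; rewrite subrr mulr0 subr_eq0 => /eqP. Qed.

Implicit Types (M P : 'M[C]_3) (X : 'rV[C]_3) (t : 'cV[C]_3).

Definition so3 M := M^T *m form3 C + form3 C *m M = 0.

Lemma mx3E (l : seq (seq C)) (i j : 'I_3) : mx3 l i j = (nth [::] l i)`_j.
Proof. by rewrite mxE. Qed.

Lemma mul_mx3E k n (M : 'M[C]_(k, 3)) (N : 'M[C]_(3, n)) i j :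
  (M *m N) i j = M i 0 * N 0 j + M i 1 * N 1 j + M i 2 * N 2 j.
Proof. by rewrite mxE sum_ord3. Qed.

Lemma lieE X (i j : 'I_3) : lie X i j =
  (nth [::] [:: [:: 2 * X 0 0; 2 * X 0 1; 0]; [:: X 0 2; 0; X 0 1]; [:: 0; 2 * X 0 2; - 2 * X 0 0]] i)`_j.
Proof.
rewrite /lie !mxE; move: i j; apply: ord3_ind; apply: ord3_ind => /=; by ring.
Qed.

Lemma so3_lie X : so3 (lie X).
Proof.
apply/matrixP; apply: ord3_ind; apply: ord3_ind;
rewrite mxE !mul_mx3E ?(mxE _ (fun i j => lie X j i)) !lieE !mx3E mxE /=; by ring.
Qed.

Lemma lie_of_so3 M : so3 M -> exists X, M = lie X.
Proof.
move=> /matrixP H.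
exists (\row_j [:: M 0 0 / 2; M 1 2; M 1 0]`_j).
have E i j := H i j.
move: (E 0 0) (E 0 1) (E 0 2) (E 1 1) (E 1 2) (E 2 2).
rewrite !(mxE _ (fun i j => (M^T *m form3 C) i j + (form3 C *m M) i j)) !mul_mx3E !(mxE _ (fun i j => M j i)) !mx3E !(mxE _ (fun _ _ => 0)) /= => e00 e01 e02 e11 e12 e22.
have m20 : M 2 0 = 0 by apply: (lin_solve (k := - 2^-1) e00); field.
have m21 : M 2 1 = 2 * M 1 0 by apply: (lin_solve (k := - 1) e01); field.
have m22 : M 2 2 = - M 0 0 by apply: (lin_solve (k := - 1) e02); field.
have m11 : M 1 1 = 0 by apply: (lin_solve (k := 4^-1) e11); field.
have m01 : M 0 1 = 2 * M 1 2 by apply: (lin_solve (k := - 1) e12); field.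
have m02 : M 0 2 = 0 by apply: (lin_solve (k := - 2^-1) e22); field.
apply/matrixP; apply: ord3_ind; apply: ord3_ind; rewrite lieE !mxE /= ?m20 ?m21 ?m22 ?m11 ?m01 ?m02 //; by field.
Qed.

Definition bil (s t : 'cV[C]_3) : C := (s^T *m form3 C *m t) 0 0.

Lemma bilE s t : bil s t = - s 0 0 * t 2 0 + 2 * s 1 0 * t 1 0 - s 2 0 * t 0 0.
Proof. by rewrite /bil !mul_mx3E !(mxE _ (fun i j => s j i)) !mx3E /=; ring. Qed.

Lemma bilC s t : bil s t = bil t s.
Proof. by rewrite !bilE; ring. Qed.

Lemma bil_SO3 P s t : SO3 P -> bil (P *m s) (P *m t) = bil s t.
Proof. by case=> H _; rewrite /bil -[in RHS]H trmx_mul !mulmxA. Qed.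

Lemma bil_so3 M s t : so3 M -> bil (M *m s) t + bil s (M *m t) = 0.
Proof.
move=> H; have -> : bil (M *m s) t + bil s (M *m t) =
    (s^T *m (M^T *m form3 C + form3 C *m M) *m t) 0 0.
  by rewrite mulmxDr mulmxDl [RHS]mxE /bil trmx_mul !mulmxA.
by rewrite H mulmx0 mul0mx mxE.
Qed.

Lemma SO3_unit P : SO3 P -> P \in unitmx.
Proof. by case=> _ dP; rewrite unitmxE dP unitr1. Qed.

Lemma so3_Ad P M : SO3 P -> so3 M -> so3 (P *m M *m invmx P).
Proof.
move=> HP HM; have uP := SO3_unit HP; have [H _] := HP.
have HF : form3 C *m P = (invmx P)^T *m form3 C.
  by rewrite -{2}H trmx_inv !mulmxA mulVmx ?unitmx_tr // mul1mx.
have HF' : P^T *m form3 C = form3 C *m invmx P.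
  by rewrite -{2}H -!mulmxA mulmxV // mulmx1.
rewrite /so3 !trmx_mul -!mulmxA HF' [form3 C *m (P *m _)]mulmxA HF.
by rewrite -!mulmxA -mulmxDr [M^T *m _]mulmxA [form3 C *m (M *m _)]mulmxA -mulmxDl HM mul0mx mulmx0.
Qed.

Lemma sqr_form (x y z : C) : y ^+ 2 = 4 * x * z ->
  exists c d, [/\ x = c ^+ 2, y = 2 * c * d & z = d ^+ 2].
Proof.
move=> H; have [x0|xn0] := eqVneq x 0.
  exists 0, (sqrtC z); rewrite sqrtCK expr0n; split=> //.
  by apply/eqP; rewrite mulr0 mul0r -sqrf_eq0 H x0 mulr0 mul0r.
have cn : sqrtC x != 0 by rewrite sqrtC_eq0.
exists (sqrtC x), (y / (2 * sqrtC x)); rewrite sqrtCK; split=> //; first by field.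
by rewrite expr_div_n H exprMn sqrtCK; field.
Qed.

(** The action of a matrix [a b; c d] on the symmetric square of the plane, for
    which the isotropic vectors are the squares. *)
Definition sym2 (a b c d : C) : 'M[C]_3 :=
  mx3 [:: [:: a ^+ 2; 2 * a * b; b ^+ 2]; [:: a * c; a * d + b * c; b * d];
          [:: c ^+ 2; 2 * c * d; d ^+ 2]].

Definition form3V : 'M[C]_3 :=
  mx3 [:: [:: 0; 0; -1]; [:: 0; 2^-1; 0]; [:: -1; 0; 0]].

Lemma det_mx3 P : \det P = P 0 0 * (P 1 1 * P 2 2 - P 2 1 * P 1 2)
  - P 1 0 * (P 0 1 * P 2 2 - P 2 1 * P 0 2) + P 2 0 * (P 0 1 * P 1 2 - P 1 1 * P 0 2).
Proof.
rewrite (expand_det_col _ 0) sum_ord3 /cofactor.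
rewrite !(expand_det_row _ 0) !big_ord_recl !big_ord0 /cofactor !det_mx11 !mxE /=.
have [q Pq] : exists q, forall i j : 'I_3, P i j = q (nat_of_ord i) (nat_of_ord j).
  by exists (fun i j => P (inord i) (inord j)) => i j; rewrite !inord_val.
rewrite !Pq /= /bump /= !addn0 !add0n
  (_ : (1 %% 3)%N = 1%N) // (_ : (1 + 1)%N = 2%N) // (_ : (2 %% 3)%N = 2%N) //; ring.
Qed.

(** The isomorphism with PSL(2).  The rows 0 and 2 of P are isotropic for the
    inverse form, hence squares (a^2, 2ab, b^2) and (c^2, 2cd, d^2); their product
    gives (ad - bc)^2 = 1, where the sign of (c, d) is free.  Orthogonality to
    them and det P = 1 are three linear equations for the row 1. *)
Lemma SO3_sym2 P : SO3 P -> exists a b c d, a * d - b * c = 1 /\ P = sym2 a b c d.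
Proof.
move=> HP; have uP := SO3_unit HP; have [H dP] := HP.
have FV : form3V *m form3 C = 1%:M.
  apply/matrixP; apply: ord3_ind; apply: ord3_ind; rewrite mul_mx3E !mx3E mxE /=; by field.
have PG : P *m form3V *m P^T = form3V.
  have H1 : P *m (form3V *m P^T *m form3 C) = 1%:M.
    by apply: mulmx1C; rewrite -FV -!mulmxA (mulmxA P^T) H.
  by rewrite -[RHS]mul1mx -H1 -!mulmxA (mulmx1C FV) mulmx1.
have G i j : P i 1 * P j 1 = 2 * (P i 0 * P j 2 + P i 2 * P j 0) + 2 * form3V i j.
  rewrite -PG !mul_mx3E !mx3E !(mxE _ (fun i j => P j i)) /=; by field.
have [a [b [pa pb pc]]] : exists a b, [/\ P 0 0 = a ^+ 2, P 0 1 = 2 * a * b & P 0 2 = b ^+ 2].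
  by apply: sqr_form; rewrite expr2 G mx3E /=; ring.
have [c [d [pd pe pf]]] : exists c d, [/\ P 2 0 = c ^+ 2, P 2 1 = 2 * c * d & P 2 2 = d ^+ 2].
  by apply: sqr_form; rewrite expr2 G mx3E /=; ring.
have : (a * d - b * c) ^+ 2 = 1.
  have := G 0 2; rewrite mx3E /= pa pb pc pd pe pf => G02.
  by apply: (lin_solve0 (k := - 2^-1) G02); field.
move=> /eqP; rewrite sqrf_eq1 => /orP dets.
wlog det1 : c d dets pd pe pf / a * d - b * c = 1.
  case: dets => /eqP; first by move=> E W; apply: (W c d) => //; left; apply/eqP.
  move=> E W; have E' : a * - d - b * - c = 1 by rewrite -[RHS]opprK -E; ring.
  by apply: (W (- c) (- d)); rewrite ?sqrrN // ?E' ?eqxx //; [left|rewrite pe; ring].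
exists a, b, c, d; split=> //.
have A1 := G 0 1; have A2 := G 2 1; have A3 : \det P = 1 := dP.
rewrite mx3E /= pa pb pc in A1; rewrite mx3E /= pd pe pf in A2.
rewrite det_mx3 pa pb pc pd pe pf in A3.
have {}A3 : - 2 * b * d * P 1 0 + (a * d + b * c) * P 1 1 - 2 * a * c * P 1 2 = 1.
  by apply: (etrans _ A3); rewrite -[LHS]mulr1 -[X in _ * X = _]det1; ring.
have det2 : (a * d - b * c) ^+ 2 = 1 by rewrite det1 expr1n.
(* Cramer's rule: the three equations have a determinant that is a power of
   ad - bc. *)
have solve (x y r s t : C) : r = 0 -> s = 0 -> t = 1 ->
    x * (a * d - b * c) ^+ 2 = r + s + y * t -> x = y.
  by move=> -> -> ->; rewrite det2 !mulr1 !add0r.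
have B1 : a * b * P 1 1 - a ^+ 2 * P 1 2 - b ^+ 2 * P 1 0 = 0.
  by apply: (lin_solve0 (k := 2^-1) A1); field.
have B2 : c * d * P 1 1 - c ^+ 2 * P 1 2 - d ^+ 2 * P 1 0 = 0.
  by apply: (lin_solve0 (k := 2^-1) A2); field.
have mul0 (u v : C) : v = 0 -> u * v = 0 by move=> ->; rewrite mulr0.
have x1 : P 1 0 = a * c.
  by apply: (solve _ _ _ _ _ (mul0 (- c ^+ 2) _ B1) (mul0 (- a ^+ 2) _ B2) A3); ring.
have x2 : P 1 1 = a * d + b * c.
  by apply: (solve _ _ _ _ _ (mul0 (- 2 * c * d) _ B1) (mul0 (- 2 * a * b) _ B2) A3); ring.
have x3 : P 1 2 = b * d.
  by apply: (solve _ _ _ _ _ (mul0 (- d ^+ 2) _ B1) (mul0 (- b ^+ 2) _ B2) A3); ring.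
by apply/matrixP; apply: ord3_ind; apply: ord3_ind; rewrite mx3E.
Qed.
End SO3Algebra.

(** * Derivatives along curves *)

Section FamilyDerivative.
Variables (C : numClosedFieldType) (pi : groupType) (m : nat).
Variable rhog : 'rV[C]_m -> pi -> 'M[C]_3.
Hypothesis diff0 : forall a, differentiable (fun g : 'rV[C]_m => rhog g a) (0 : 'rV[C]_m).

Definition drho (dg : 'rV[C]_m) (a : pi) : 'M[C]_3 :=
  'D_dg (fun g : 'rV[C]_m => rhog g a) (0 : 'rV[C]_m).

Lemma mx_entry_linear i j : linear (fun M : 'M[C]_3 => M i j : C^o).
Proof. by move=> k M N; rewrite !mxE. Qed.

(** Reading the directional derivative of a matrix entrywise reduces every
    derivative below to functions of one variable. *)
Lemma is_derive_rho_entry dg a i j :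
  is_derive (0 : C) 1 (fun t : C => rhog (t *: dg) a i j : C) (drho dg a i j).
Proof.
pose f g := rhog g a i j : C.
pose c := (fun M : 'M[C]_3 => M i j : C).
have dc : differentiable c (rhog 0 a) by exact: differentiable_coord.
have df : differentiable f (0 : 'rV[C]_m).
  exact: (@differentiable_comp _ _ _ _ (fun g => rhog g a) c).
have dff : 'D_dg f 0 = drho dg a i j.
  rewrite /drho (deriveE _ df) (deriveE _ (diff0 a)).
  rewrite (_ : f = c \o (fun g => rhog g a)) // (diff_comp (diff0 a) dc) /=.
  pose cl := GRing.isLinear.Build C 'M[C]_3 C^o *:%R c (mx_entry_linear i j).
  pose cL : {linear 'M[C]_3 -> C^o} := HB.pack c cl.
  have cc : continuous cL by exact: coord_continuous.
  by rewrite (_ : 'd c (rhog 0 a) = 'd cL (rhog 0 a) :> (_ -> _)) // (diff_lin _ cc).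
have E : (fun h : C => h^-1 *: (f (h *: dg + 0) - f 0)) =
    (fun h : C => h^-1 *: ((fun t : C => f (t *: dg)) (h *: 1 + 0) - (fun t : C => f (t *: dg)) 0)).
  by apply/funext => h; rewrite /= !addr0 scale0r /GRing.scale /= mulr1.
have dd : derivable f 0 dg by exact: diff_derivable.
split.
  by rewrite /derivable -E; exact: dd.
by rewrite /derive -E; exact: dff.
Qed.
End FamilyDerivative.

Section DeriveRules.
Variable C : numClosedFieldType.
Implicit Types f g : C -> C.
Lemma is_deriveM_fun f g (x df dg : C) : is_derive x 1 f df -> is_derive x 1 g dg ->
  is_derive x 1 (fun t => f t * g t : C) (df * g x + f x * dg).
Proof.
move=> Hf Hg; have := is_deriveM Hf Hg.
by rewrite /GRing.scale /= addrC [g x * df]mulrC; apply.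
Qed.
Lemma is_deriveD_fun f g (x df dg : C) : is_derive x 1 f df -> is_derive x 1 g dg ->
  is_derive x 1 (fun t => f t + g t : C) (df + dg).
Proof. by move=> Hf Hg; exact: is_deriveD. Qed.
Lemma is_deriveB_fun f g (x df dg : C) : is_derive x 1 f df -> is_derive x 1 g dg ->
  is_derive x 1 (fun t => f t - g t : C) (df - dg).
Proof. by move=> Hf Hg; exact: is_deriveB. Qed.
Lemma is_deriveV_fun f (x df : C) : f x != 0 -> is_derive x 1 f df ->
  is_derive x 1 (fun t => (f t)^-1 : C) (- df / f x ^+ 2).
Proof.
move=> fx0 [Df <-]; have dV := derivableV fx0 Df.
split; first exact: dV.
rewrite (deriveV fx0 Df) /GRing.scale /= mulNr.
by rewrite mulrC -exprVn mulNr.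
Qed.
Lemma is_derive_div_fun f g (x df dg : C) : g x != 0 ->
  is_derive x 1 f df -> is_derive x 1 g dg ->
  is_derive x 1 (fun t => f t / g t : C) ((df - f x / g x * dg) / g x).
Proof.
move=> gx0 Hf Hg; apply: is_derive_eq.
  exact: (is_deriveM_fun Hf (is_deriveV_fun gx0 Hg)).
by rewrite mulrBl; congr (_ + _); rewrite -[RHS]mulNr -mulNr; move: (f x) (g x) gx0 => a b b0; field.
Qed.
Lemma is_derive_sum_fun n (F : 'I_n -> C -> C) (x : C) (dF : 'I_n -> C) :
  (forall i, is_derive x 1 (F i) (dF i)) ->
  is_derive x 1 (fun t => \sum_i F i t : C) (\sum_i dF i).
Proof.
move=> H; have := @is_derive_sum _ _ _ n F x 1 dF H.
by rewrite (_ : \sum_i F i = fun t => \sum_i F i t) //; apply/funext => t; rewrite fct_sumE.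
Qed.
Lemma is_derive_cst_fun (a x : C) : is_derive x 1 (fun=> a : C) 0.
Proof. exact: is_derive_cst. Qed.
End DeriveRules.

(** * The variation of the vertices *)

Section DeformedVectors.
Variables (C : numClosedFieldType) (V : finType) (W : choiceType).
Variables (pi : groupType) (p : W -> V) (act : pi -> W -> W) (main : V -> W).
Variables (m : nat) (rho : pi -> 'M[C]_3) (rhog : 'rV[C]_m -> pi -> 'M[C]_3).
Variables (zeta kappa : W -> C).
Hypothesis rhog_diff : forall a, differentiable (fun g : 'rV[C]_m => rhog g a) (0 : 'rV[C]_m).
Hypothesis rhog0 : forall a, rhog 0 a = rho a.
Hypothesis equivariant : forall a w,
       isotropic (kappa (act a w)) (zeta (act a w))
       = rho a *m isotropic (kappa w) (zeta w).
Hypothesis kappa_neq0 : forall w, kappa w != 0.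
Hypothesis from_mainP : forall w, act (from_main p act main w) (main (p w)) = w.

Local Notation e w := (isotropic (kappa w) (zeta w)).
Local Notation fm := (from_main p act main).
Local Notation dvh := (deformed_h p act main rhog).
Local Notation dvz := (deformed_z p act main rhog).

(** The derivative of [isotropic h z] in the direction (dh, dz). *)
Definition cone_tangent (h z dh dz : C) : 'cV[C]_3 :=
  \col_i [:: dh * z ^+ 2 + 2 * h * z * dz; dh * z + h * dz; dh]`_i.

(** The derivative of the deformed vector of w, by the product rule: w is the image
    of the main vertex of its fibre by [fm w], so that both rho_g (fm w) and the
    main vector vary. *)
Definition dvec (dh dz : V -> C) (dg : 'rV[C]_m) (w : W) : 'cV[C]_3 :=
  drho rhog dg (fm w) *m e (main (p w)) +
  rho (fm w) *m cone_tangent (kappa (main (p w))) (zeta (main (p w))) (dh (p w)) (dz (p w)).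

(** For t tangent to the cone at w, [z_part w t] and [h_part w t] are dz and
    dh / (2 kappa), the coordinates dbeta^* and dalpha^* of t. *)
Definition z_part (w : W) (t : 'cV[C]_3) : C := (t 1 0 - zeta w * t 2 0) / kappa w.
Definition h_part (w : W) (t : 'cV[C]_3) : C := t 2 0 / (2 * kappa w).

Section Curve.
Variables (H Z : C -> V -> C) (dh dz : V -> C) (dg : 'rV[C]_m).
Hypothesis H0 : H 0 = base_h main kappa.
Hypothesis Z0 : Z 0 = base_z main zeta.
Hypothesis dH : forall v, is_derive (0 : C) 1 (fun t => H t v : C) (dh v).
Hypothesis dZ : forall v, is_derive (0 : C) 1 (fun t => Z t v : C) (dz v).

Lemma deformed_vector0 w : deformed_vector p act main rhog w
  (base_h main kappa) (base_z main zeta) 0 = e w.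
Proof. by rewrite /deformed_vector rhog0 -equivariant from_mainP. Qed.

Lemma is_derive_deformed_vector w i :
  is_derive (0 : C) 1 (fun t => deformed_vector p act main rhog w (H t) (Z t) (t *: dg) i 0 : C)
    (dvec dh dz dg w i 0).
Proof.
have Hiso j : is_derive (0 : C) 1 (fun t => isotropic (H t (p w)) (Z t (p w)) j 0 : C)
    (cone_tangent (kappa (main (p w))) (zeta (main (p w))) (dh (p w)) (dz (p w)) j 0).
  have E0 : H 0 (p w) = kappa (main (p w)) by rewrite H0.
  have E1 : Z 0 (p w) = zeta (main (p w)) by rewrite Z0.
  rewrite !mxE; case: j => [[|[|[|//]]] i0] /=.
  - have -> : (fun t => isotropic (H t (p w)) (Z t (p w)) (Ordinal i0) 0 : C) =
       (fun t => H t (p w) * (Z t (p w) * Z t (p w))) by apply/funext => t; rewrite !mxE.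
    apply: (is_derive_eq (is_deriveM_fun (dH _) (is_deriveM_fun (dZ _) (dZ _)))).
    by rewrite E0 E1; ring.
  - have -> : (fun t => isotropic (H t (p w)) (Z t (p w)) (Ordinal i0) 0 : C) =
       (fun t => H t (p w) * Z t (p w)) by apply/funext => t; rewrite !mxE.
    apply: (is_derive_eq (is_deriveM_fun (dH _) (dZ _))).
    by rewrite E0 E1; ring.
  - have -> : (fun t => isotropic (H t (p w)) (Z t (p w)) (Ordinal i0) 0 : C) =
       (fun t => H t (p w)) by apply/funext => t; rewrite !mxE.
    exact: dH.
have -> : (fun t => deformed_vector p act main rhog w (H t) (Z t) (t *: dg) i 0 : C) =
   (fun t => \sum_j rhog (t *: dg) (fm w) i j * isotropic (H t (p w)) (Z t (p w)) j 0 : C).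
  by apply/funext => t; rewrite mxE.
apply: (is_derive_eq (is_derive_sum_fun (fun j =>
  is_deriveM_fun (is_derive_rho_entry rhog_diff dg (fm w) i j) (Hiso j)))).
by rewrite !mxE -big_split /=; apply: eq_bigr => j _; rewrite scale0r rhog0 H0 Z0.
Qed.

Lemma deformed_h0 w : dvh w (base_h main kappa) (base_z main zeta) 0 = kappa w.
Proof. by rewrite /deformed_h deformed_vector0 !mxE. Qed.

Lemma deformed_z0 w : dvz w (base_h main kappa) (base_z main zeta) 0 = zeta w.
Proof. by rewrite /deformed_z deformed_vector0 !mxE /= mulrAC divff // mul1r. Qed.

Lemma is_derive_deformed_h w :
  is_derive (0 : C) 1 (fun t => dvh w (H t) (Z t) (t *: dg) : C) (dvec dh dz dg w 2 0).
Proof. exact: is_derive_deformed_vector. Qed.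

Lemma is_derive_deformed_z w :
  is_derive (0 : C) 1 (fun t => dvz w (H t) (Z t) (t *: dg) : C) (z_part w (dvec dh dz dg w)).
Proof.
have D0 i : deformed_vector p act main rhog w (H 0) (Z 0) (0 *: dg) i 0 = e w i 0.
  by rewrite H0 Z0 scale0r deformed_vector0.
have N0 : deformed_vector p act main rhog w (H 0) (Z 0) (0 *: dg) 2 0 != 0.
  by rewrite D0 !mxE /=.
apply: (is_derive_eq (is_derive_div_fun N0 (is_derive_deformed_vector w 1)
  (is_derive_deformed_vector w 2))).
by rewrite !D0 /z_part !(mxE _ _ 1) !(mxE _ _ 2) /=; field.
Qed.
End Curve.

(** The third divided difference of u on the nodes zeta a, zeta b, zeta c, zeta d. *)
Definition div_diff (u : W -> C) (a b c d : W) : C :=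
  u a / ((zeta a - zeta b) * (zeta a - zeta c) * (zeta a - zeta d)) +
  u b / ((zeta b - zeta a) * (zeta b - zeta c) * (zeta b - zeta d)) +
  u c / ((zeta c - zeta a) * (zeta c - zeta b) * (zeta c - zeta d)) +
  u d / ((zeta d - zeta a) * (zeta d - zeta b) * (zeta d - zeta c)).

Definition dz_of (t : W -> 'cV[C]_3) (w : W) : C := z_part w (t w).
Definition dh_of (t : W -> 'cV[C]_3) (w : W) : C := h_part w (t w).
(** Half the logarithmic derivative of the scalar product of the isotropic vectors
    i and j, in the coordinates of their variations; see [length_diff_bil]. *)
Definition length_diff (t : W -> 'cV[C]_3) (i j : W) : C :=
  dh_of t i + dh_of t j + (dz_of t i - dz_of t j) / (zeta i - zeta j).

Lemma drho_linear dg : drho rhog dg = \sum_k dg 0 k *: drho rhog (delta_mx 0 k).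
Proof.
apply/funext => a; rewrite fct_sumE /drho.
rewrite (deriveE _ (rhog_diff a)) {1}[dg]row_sum_delta linear_sum; apply: eq_bigr => k _.
by rewrite linearZ fctE (deriveE _ (rhog_diff a)).
Qed.

Lemma drho0 a : drho rhog 0 a = 0.
Proof. by rewrite drho_linear fct_sumE big1 // => k _; rewrite fctE mxE scale0r. Qed.

Definition unit_fun (v u : V) : C := (u == v)%:R.

Lemma dvec_sum dh dz dg : dvec dh dz dg =
  \sum_v dh v *: dvec (unit_fun v) 0 0 + \sum_v dz v *: dvec 0 (unit_fun v) 0
  + \sum_k dg 0 k *: dvec 0 0 (delta_mx 0 k).
Proof.
apply/funext => w; rewrite !fctE !fct_sumE.
have T0 h z : cone_tangent h z 0 0 = 0.
  by apply/colP => -[[|[|[|//]]] lti]; rewrite !mxE /= ?mul0r ?mulr0 ?addr0.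
have -> : \sum_v (dh v *: dvec (unit_fun v) 0 0) w =
    rho (fm w) *m cone_tangent (kappa (main (p w))) (zeta (main (p w))) (dh (p w)) 0.
  rewrite (bigD1 (p w)) //= big1 ?addr0 => [|v /negPf vn].
    rewrite fctE /dvec drho0 mul0mx add0r scalemxAr /unit_fun eqxx; congr (_ *m _).
    by apply/colP => -[[|[|[|//]]] lti]; rewrite !mxE /= ?mulr0 ?addr0 ?mul1r ?mulr1 // mulrA.
  by rewrite fctE /dvec drho0 mul0mx add0r /unit_fun eq_sym vn T0 mulmx0 scaler0.
have -> : \sum_v (dz v *: dvec 0 (unit_fun v) 0) w =
    rho (fm w) *m cone_tangent (kappa (main (p w))) (zeta (main (p w))) 0 (dz (p w)).
  rewrite (bigD1 (p w)) //= big1 ?addr0 => [|v /negPf vn].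
    rewrite fctE /dvec drho0 mul0mx add0r scalemxAr /unit_fun eqxx; congr (_ *m _).
    by apply/colP => -[[|[|[|//]]] lti]; rewrite !mxE /= -?[(0 : V -> C) (p w)]/(0 : C) ?mulr1n; ring.
  by rewrite fctE /dvec drho0 mul0mx add0r /unit_fun eq_sym vn T0 mulmx0 scaler0.
have -> : \sum_k (dg 0 k *: dvec 0 0 (delta_mx 0 k)) w = drho rhog dg (fm w) *m e (main (p w)).
  rewrite [in RHS]drho_linear fct_sumE mulmx_suml; apply: eq_bigr => k _.
  by rewrite !fctE /dvec T0 mulmx0 addr0 scalemxAl.
rewrite /dvec addrC -mulmxDr; congr (_ + _); congr (_ *m _).
by apply/colP => -[[|[|[|//]]] lti]; rewrite !mxE /=; ring.
Qed.

(** [dvec] is linear in (dh, dz, dg), so that a linear functional of it is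
    determined by its values on the coordinate directions. *)
Lemma total_differential (L : (W -> 'cV[C]_3) -> C) dh dz dg :
  (forall a s t, L (a *: s + t) = a * L s + L t) ->
  L (dvec dh dz dg) = \sum_v dh v * L (dvec (unit_fun v) 0 0)
    + \sum_v dz v * L (dvec 0 (unit_fun v) 0)
    + \sum_k dg 0 k * L (dvec 0 0 (delta_mx 0 k)).
Proof.
move=> Ll.
pose cl := GRing.isLinear.Build C (W -> 'cV[C]_3) C^o *:%R L Ll.
pose LL : {linear (W -> 'cV[C]_3) -> C^o} := HB.pack L cl.
rewrite -[L _]/(LL _) dvec_sum !linearD !linear_sum.
by congr (_ + _ + _); apply: eq_bigr => k _; rewrite linearZ.
Qed.

Lemma div_diff_linear a b c d (r : C) s t :
  div_diff (dz_of (r *: s + t)) a b c d =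
  r * div_diff (dz_of s) a b c d + div_diff (dz_of t) a b c d.
Proof.
rewrite /div_diff /dz_of /z_part !fctE !mxE.
by ring.
Qed.

Lemma length_diff_linear i j (r : C) s t :
  length_diff (r *: s + t) i j = r * length_diff s i j + length_diff t i j.
Proof. rewrite /length_diff /dh_of /dz_of /h_part /z_part !fctE !mxE; ring. Qed.

Lemma is_derive_shift_at (f : V -> C) v u :
  is_derive (0 : C) 1 (fun t => shift_at f v t u : C) (unit_fun v u).
Proof.
rewrite /shift_at /unit_fun; case: eqP => _ /=; last exact: is_derive_cst_fun.
have := @is_deriveD_fun C (cst (f u)) id 0 0 1 (is_derive_cst_fun _ _) (is_derive_id _ _).
by rewrite add0r.
Qed.

Lemma shift_at0 (f : V -> C) v : shift_at f v 0 = f.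
Proof. by apply/funext => u; rewrite /shift_at addr0 if_same. Qed.

(** The cross-ratio and phi^* are differentiated along arbitrary curves, where the
    chain rule gives a linear functional L of the variation of the vectors; the
    partial derivatives are the values of L in the coordinate directions. *)
Section Partial.
Variables (F : (V -> C) -> (V -> C) -> 'rV[C]_m -> C) (L : (W -> 'cV[C]_3) -> C).
Hypothesis dF : forall (H Z : C -> V -> C) (dh dz : V -> C) (dg : 'rV[C]_m),
  H 0 = base_h main kappa -> Z 0 = base_z main zeta ->
  (forall v, is_derive (0 : C) 1 (fun t => H t v : C) (dh v)) ->
  (forall v, is_derive (0 : C) 1 (fun t => Z t v : C) (dz v)) ->
  is_derive (0 : C) 1 (fun t => F (H t) (Z t) (t *: dg) : C) (L (dvec dh dz dg)).

Lemma pd_hE v : pd_h main zeta kappa F v = L (dvec (unit_fun v) 0 0).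
Proof.
have D := @dF (shift_at (base_h main kappa) v) (fun=> base_z main zeta) (unit_fun v) 0 0
  (shift_at0 _ _) erefl (is_derive_shift_at _ _) (fun v => is_derive_cst_fun _ _).
rewrite /pd_h derive1E -(@derive_val _ _ _ _ _ _ _ D).
by apply: (congr1 (fun f : C -> C => 'D_1 f (0 : C))); apply/funext => t; rewrite scaler0.
Qed.

Lemma pd_zE v : pd_z main zeta kappa F v = L (dvec 0 (unit_fun v) 0).
Proof.
have D := @dF (fun=> base_h main kappa) (shift_at (base_z main zeta) v) 0 (unit_fun v) 0
  erefl (shift_at0 _ _) (fun v => is_derive_cst_fun _ _) (is_derive_shift_at _ _).
rewrite /pd_z derive1E -(@derive_val _ _ _ _ _ _ _ D).
by apply: (congr1 (fun f : C -> C => 'D_1 f (0 : C))); apply/funext => t; rewrite scaler0.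
Qed.

Lemma pd_gE k : pd_g main zeta kappa F k = L (dvec 0 0 (delta_mx 0 k)).
Proof.
have D := @dF (fun=> base_h main kappa) (fun=> base_z main zeta) 0 0 (delta_mx 0 k)
  erefl erefl (fun v => is_derive_cst_fun _ _) (fun v => is_derive_cst_fun _ _).
by rewrite /pd_g derive1E -(@derive_val _ _ _ _ _ _ _ D).
Qed.
End Partial.

Section CrossRatio.
Variables (w0 w1 w2 w3 : W).
Hypotheses (n01 : zeta w0 - zeta w1 != 0) (n02 : zeta w0 - zeta w2 != 0)
  (n03 : zeta w0 - zeta w3 != 0) (n12 : zeta w1 - zeta w2 != 0)
  (n13 : zeta w1 - zeta w3 != 0) (n23 : zeta w2 - zeta w3 != 0).
Let x := cross_ratio p act main rhog w0 w1 w2 w3.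
Let x0 := x (base_h main kappa) (base_z main zeta) 0.

Lemma cross_ratio0 : x0 = ((zeta w0 - zeta w1) * (zeta w2 - zeta w3)) /
  ((zeta w0 - zeta w3) * (zeta w2 - zeta w1)).
Proof. by rewrite /x0 /x /cross_ratio !deformed_z0. Qed.

(** The logarithmic derivative of the cross-ratio of four points is a multiple of
    the divided difference because both vanish on the quadratic fields, along which
    the cross-ratio is invariant. *)
Lemma is_derive_cross_ratio (H Z : C -> V -> C) (dh dz : V -> C) (dg : 'rV[C]_m) :
  H 0 = base_h main kappa -> Z 0 = base_z main zeta ->
  (forall v, is_derive (0 : C) 1 (fun t => H t v : C) (dh v)) ->
  (forall v, is_derive (0 : C) 1 (fun t => Z t v : C) (dz v)) ->
  is_derive (0 : C) 1 (fun t => x (H t) (Z t) (t *: dg) : C)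
   (- (x0 * ((zeta w0 - zeta w2) * (zeta w3 - zeta w1))) *
    div_diff (dz_of (dvec dh dz dg)) w0 w1 w2 w3).
Proof.
move=> H0 Z0 dH dZ.
have D w := is_derive_deformed_z dg H0 Z0 dH dZ w.
have E w : dvz w (H 0) (Z 0) (0 *: dg) = zeta w by rewrite H0 Z0 scale0r deformed_z0.
have n21 := subr_neq0_sym n12.
pose den t : C := (dvz w0 (H t) (Z t) (t *: dg) - dvz w3 (H t) (Z t) (t *: dg)) *
  (dvz w2 (H t) (Z t) (t *: dg) - dvz w1 (H t) (Z t) (t *: dg)).
have N0 : den 0 != 0 by rewrite /den !E mulf_neq0.
have Dden : is_derive (0 : C) 1 den _ :=
  is_deriveM_fun (is_deriveB_fun (D w0) (D w3)) (is_deriveB_fun (D w2) (D w1)).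
apply: (is_derive_eq (is_derive_div_fun N0
  (is_deriveM_fun (is_deriveB_fun (D w0) (D w1)) (is_deriveB_fun (D w2) (D w3))) Dden)).
rewrite /den !E cross_ratio0 /div_diff -!/(dz_of _ _).
move: (dz_of _ w0) (dz_of _ w1) (dz_of _ w2) (dz_of _ w3) => u0 u1 u2 u3.
have n10 := subr_neq0_sym n01.
have n20 := subr_neq0_sym n02.
have n30 := subr_neq0_sym n03.
have n31 := subr_neq0_sym n13.
have n32 := subr_neq0_sym n23.
by field; rewrite n01 n02 n03 n12 n13 n23 n10 n20 n30 n21 n31 n32.
Qed.

Lemma dln_cross_ratio (dz : V -> C) (dg : 'rV[C]_m) :
  (\sum_v pd_z main zeta kappa x v * dz v + \sum_k pd_g main zeta kappa x k * dg 0 k)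
   / x0 / ((zeta w0 - zeta w2) * (zeta w3 - zeta w1)) =
  - div_diff (dz_of (dvec 0 dz dg)) w0 w1 w2 w3.
Proof.
pose L t : C := - (x0 * ((zeta w0 - zeta w2) * (zeta w3 - zeta w1))) * div_diff (dz_of t) w0 w1 w2 w3.
have n31 := subr_neq0_sym n13.
have n21 := subr_neq0_sym n12.
have x0n : x0 != 0 by rewrite cross_ratio0 !(mulf_neq0, invr_eq0).
have LE : L (dvec 0 dz dg) = \sum_v pd_z main zeta kappa x v * dz v + \sum_k pd_g main zeta kappa x k * dg 0 k.
  rewrite (@total_differential L); last first.
    by move=> a s t; rewrite /L div_diff_linear; ring.
  rewrite big1 ?add0r => [|v _]; last by rewrite mul0r.
  by congr (_ + _); apply: eq_bigr => v _;
    rewrite ((pd_zE (L := L)) is_derive_cross_ratio, (pd_gE (L := L)) is_derive_cross_ratio) mulrC.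
by rewrite -LE /L; field; rewrite x0n n02 n31.
Qed.
End CrossRatio.

Lemma is_derive_phi_star i j (H Z : C -> V -> C) (dh dz : V -> C) (dg : 'rV[C]_m) :
  zeta i - zeta j != 0 ->
  H 0 = base_h main kappa -> Z 0 = base_z main zeta ->
  (forall v, is_derive (0 : C) 1 (fun t => H t v : C) (dh v)) ->
  (forall v, is_derive (0 : C) 1 (fun t => Z t v : C) (dz v)) ->
  is_derive (0 : C) 1 (fun t => phi_star p act main rhog zeta kappa i j (H t) (Z t) (t *: dg) : C)
   (length_diff (dvec dh dz dg) i j).
Proof.
move=> nij H0 Z0 dH dZ.
have Dz w := is_derive_deformed_z dg H0 Z0 dH dZ w.
have Dh w := is_derive_deformed_h dg H0 Z0 dH dZ w.
have Ez w : dvz w (H 0) (Z 0) (0 *: dg) = zeta w by rewrite H0 Z0 scale0r deformed_z0.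
have Eh w : dvh w (H 0) (Z 0) (0 *: dg) = kappa w by rewrite H0 Z0 scale0r deformed_h0.
pose q := 2^-1 * (kappa i * kappa j * (zeta i - zeta j) ^+ 2)^-1.
have -> : (fun t => phi_star p act main rhog zeta kappa i j (H t) (Z t) (t *: dg) : C) =
  (fun t => q * ((dvh i (H t) (Z t) (t *: dg) * dvh j (H t) (Z t) (t *: dg)) *
    ((dvz i (H t) (Z t) (t *: dg) - dvz j (H t) (Z t) (t *: dg)) *
     (dvz i (H t) (Z t) (t *: dg) - dvz j (H t) (Z t) (t *: dg))))).
  by apply/funext => t; rewrite /phi_star /q; ring.
apply: (is_derive_eq (is_deriveM_fun (is_derive_cst_fun q 0)
  (is_deriveM_fun (is_deriveM_fun (Dh i) (Dh j))
    (is_deriveM_fun (is_deriveB_fun (Dz i) (Dz j)) (is_deriveB_fun (Dz i) (Dz j)))))).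
rewrite /= !Ez !Eh /length_diff /dh_of /h_part -!/(dz_of _ _) /q.
move: (dz_of _ i) (dz_of _ j) (kappa_neq0 i) (kappa_neq0 j) => ui uj ki kj.
by field; rewrite nij ki kj.
Qed.

Lemma d_phi_star i j (al be : V -> C) (dg : 'rV[C]_m) : zeta i - zeta j != 0 ->
  let phi := phi_star p act main rhog zeta kappa i j in
  \sum_v pd_h main zeta kappa phi v * (2 * kappa (main v) * al v)
     + \sum_v pd_z main zeta kappa phi v * be v
     + \sum_k pd_g main zeta kappa phi k * dg 0 k =
  length_diff (dvec (fun v => 2 * kappa (main v) * al v) be dg) i j.
Proof.
move=> nij phi; pose L t := length_diff t i j.
have D := fun H Z dh dz dg => @is_derive_phi_star i j H Z dh dz dg nij.
rewrite -[RHS]/(L _) (total_differential (L := L)); last exact: length_diff_linear.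
by congr (_ + _ + _); apply: eq_bigr => v _;
  rewrite ((pd_hE (L := L)) D, (pd_zE (L := L)) D, (pd_gE (L := L)) D) mulrC.
Qed.
End DeformedVectors.

(** * The derivative of the family of representations *)

Section InfDef.
Variables (C : numClosedFieldType) (pi : groupType) (m : nat).
Variables (rho : pi -> 'M[C]_3) (rhog : 'rV[C]_m -> pi -> 'M[C]_3) (U : set 'rV[C]_m).
Hypothesis reg : regular_family rho U rhog.

Lemma family_near (dg : 'rV[C]_m) : \forall t \near (0 : C), U (t *: dg).
Proof.
have Un : nbhs (0 : 'rV[C]_m) U by apply: open_nbhs_nbhs; split; [exact: family_open reg|exact: family_0 reg].
have Ct : {for (0 : C), continuous (fun t : C => t *: dg : 'rV[C]_m)} by exact: scalel_continuous.
by apply: Ct; rewrite scale0r.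
Qed.

Lemma family_diff a : differentiable (fun g : 'rV[C]_m => rhog g a) (0 : 'rV[C]_m).
Proof. exact: (family_smooth reg a (family_0 reg)). Qed.

Lemma is_derive_near (f g : C -> C) (df dg : C) :
  (\forall t \near (0 : C), f t = g t) ->
  is_derive (0 : C) 1 f df -> is_derive (0 : C) 1 g dg -> df = dg.
Proof.
by move=> fg [_ <-] [_ <-]; apply: near_eq_derive.
Qed.

(** Differentiating rho_g (ab) = rho_g a rho_g b and the invariance of the scalar
    product along g = t dg, for t near 0, where t dg is in U. *)
Lemma drho_infinitesimal dg : infinitesimal_deformation rho (drho rhog dg).
Proof.
have D a i j := is_derive_rho_entry family_diff dg a i j.
have E a : rhog (0 *: dg) a = rho a by rewrite scale0r (family_base reg).
split=> [a b|a]; apply/matrixP => i j.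
  have DS := is_derive_sum_fun (fun k => is_deriveM_fun (D a i k) (D b k j)).
  apply: etrans; first apply: (is_derive_near _ (D (a * b)%g i j) DS).
    near=> t; have [_ ->] : representation (rhog (t *: dg)).
      by apply: (family_representation reg); near: t; exact: family_near.
    by rewrite mxE.
  by rewrite !mxE -big_split /=; apply: eq_bigr => k _; rewrite !E.
have DS := is_derive_sum_fun (fun k => is_deriveM_fun
    (is_derive_sum_fun (fun l => is_deriveM_fun (D a l i) (is_derive_cst_fun (form3 C l k) 0)))
    (D a k j)).
have N : \forall t \near (0 : C),
    \sum_k (\sum_l rhog (t *: dg) a l i * form3 C l k) * rhog (t *: dg) a k j = form3 C i j.
  near=> t; have rep : representation (rhog (t *: dg)).
    by apply: (family_representation reg); near: t; exact: family_near.
  have [Hf _] := rep.1 a; rewrite -[in RHS]Hf !mxE; apply: eq_bigr => k _; congr (_ * _).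
  by rewrite !mxE; apply: eq_bigr => l _; rewrite !mxE.
rewrite [RHS]mxE -(is_derive_near N DS (is_derive_cst_fun (form3 C i j) 0)).
  rewrite !mxE -big_split /=; apply: eq_bigr => k _; rewrite !E.
  rewrite !mxE; congr (_ * _ + _ * _); apply: eq_bigr => l _; rewrite !mxE ?E //.
  by rewrite mulr0 addr0.
Unshelve. all: by end_near. Qed.
End InfDef.

(** * Linear systems *)

Section Duality.
Variable F : fieldType.

(** The Fredholm alternative, for families indexed by finite types: the unknowns
    are here indexed by edges, by tetrahedra and by sums of types. *)
Lemma solvable_dual (I J : finType) (A : I -> J -> F) (b : J -> F) :
  (forall y : J -> F, (forall i, \sum_j A i j * y j = 0) -> \sum_j b j * y j = 0) ->
  exists x : I -> F, forall j, \sum_i x i * A i j = b j.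
Proof.
move=> H.
pose MA : 'M[F]_(#|I|, #|J|) := \matrix_(i, j) A (enum_val i) (enum_val j).
pose mb : 'rV[F]_#|J| := \row_j b (enum_val j).
have sumE (L : finType) (f : L -> F) : \sum_l f l = \sum_(k < #|L|) f (enum_val k).
  by rewrite (reindex (@enum_val L L)) //; apply: onW_bij; exact: enum_val_bij.
have : (mb <= MA)%MS.
  rewrite submxE; apply/eqP/rowP => k.
  pose y j := cokermx MA (enum_rank j) k.
  rewrite [RHS]mxE -(H y) => [|i].
    by rewrite [RHS]sumE mxE; apply: eq_bigr => l _; rewrite mxE /y enum_valK.
  have /matrixP/(_ (enum_rank i) k) := mulmx_coker MA; rewrite [LHS]mxE [RHS]mxE => E0.
  by rewrite -[RHS]E0 [LHS]sumE; apply: eq_bigr => l _; rewrite mxE /y enum_rankK enum_valK.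
move=> /submxP[D E]; exists (fun i => D 0 (enum_rank i)) => j.
have /rowP/(_ (enum_rank j)) := E; rewrite [LHS]mxE [RHS]mxE enum_rankK => ->.
by rewrite [LHS]sumE; apply: eq_bigr => l _; rewrite mxE enum_rankK enum_valK.
Qed.
End Duality.

(** A subspace of which only a predicate is known is spanned by the rows of a matrix
    of maximal rank among those with rows in the subspace. *)
Lemma submod_basis (F : fieldType) (S : {pred 'rV[F]_3}) : submod_closed S ->
  exists B : 'M[F]_3, (forall i, row i B \in S) /\ forall X, X \in S -> (X <= B)%MS.
Proof.
move=> [S0 SD].
have S_sub n (B : 'M[F]_(n, 3)) X : (forall i, row i B \in S) -> (X <= B)%MS -> X \in S.
  move=> HB /submxP[D ->]; rewrite mulmx_sum_row.
  elim/big_rec: _ => // i Y _ YS; exact: SD.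
pose P r := `[< exists2 B : 'M[F]_3, (forall i, row i B \in S) & \rank B = r >].
have P0 : exists r, P r.
  by exists 0%N; apply/asboolP; exists 0; [move=> i; rewrite row0|rewrite mxrank0].
have Pb r : P r -> (r <= 3)%N by move=> /asboolP[B _ <-]; exact: rank_leq_row.
have [r /asboolP[B HB rB] max] := ex_maxnP P0 Pb.
exists B; split=> // X XS; apply: contraT => nX.
have HBX : forall i, row i <<col_mx B X>>%MS \in S.
  move=> i; apply: (@S_sub _ (col_mx B X)).
    move=> j; rewrite -(fintype.splitK j); case: (fintype.split j) => j' /=; first by rewrite rowKu.
    by rewrite rowKd (_ : row j' X = X) //; apply/rowP => k; rewrite mxE ord1.
  by apply: submx_trans (row_sub _ _) _; rewrite genmxE.
have : P (\rank <<col_mx B X>>%MS) by apply/asboolP; exists <<col_mx B X>>%MS.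
move=> /max; rewrite mxrank_gen leqNgt -rB => /negP[].
have -> : \rank (col_mx B X) = \rank (B + X)%MS by rewrite -addsmxE.
by rewrite rank_ltmx // ltmxE addsmxSl /= addsmx_sub submx_refl.
Qed.

(** * Tangent vectors of the isotropic cone and quadratic fields *)

Section Geometry.
Variables (C : numClosedFieldType) (W : choiceType) (zeta kappa : W -> C).
Hypothesis kappa_neq0 : forall w, kappa w != 0.
Implicit Types (X : 'rV[C]_3) (t : 'cV[C]_3) (w a b c d : W).
Local Notation e w := (isotropic (kappa w) (zeta w)).
Local Notation zp := (z_part zeta kappa).
Local Notation hp := (h_part kappa).
Local Notation vz X w := (dz_lie zeta w X).
Local Notation dd := (div_diff zeta).

Lemma isotropicE h z (i : 'I_3) : isotropic h z i 0 = [:: h * z ^+ 2; h * z; h]`_i :> C.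
Proof. by rewrite mxE. Qed.

Lemma lie_isotropic X w : lie X *m e w =
  cone_tangent (kappa w) (zeta w) (2 * kappa w * (- X 0 0 + zeta w * X 0 2)) (vz X w).
Proof.
apply/colP; apply: ord3_ind; rewrite mul_mx3E !lieE !isotropicE mxE /dz_lie /=; by ring.
Qed.

Lemma z_part_cone w dh dz : zp w (cone_tangent (kappa w) (zeta w) dh dz) = dz.
Proof. by rewrite /z_part !mxE /=; field. Qed.

Lemma h_part_cone w al dz : hp w (cone_tangent (kappa w) (zeta w) (2 * kappa w * al) dz) = al.
Proof. by rewrite /h_part !mxE /=; field. Qed.

Lemma z_part_lie X w : zp w (lie X *m e w) = vz X w.
Proof. by rewrite lie_isotropic z_part_cone. Qed.

Lemma h_part_lie X w : hp w (lie X *m e w) = - X 0 0 + zeta w * X 0 2.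
Proof. by rewrite lie_isotropic h_part_cone. Qed.

Lemma z_partD w t t' : zp w (t + t') = zp w t + zp w t'.
Proof. by rewrite /z_part !mxE; ring. Qed.
Lemma z_partN w t : zp w (- t) = - zp w t.
Proof. by rewrite /z_part !mxE; ring. Qed.
(** Tangency to the cone t.t = 0 at the isotropic vector of w. *)
Definition tangent w t := bil t (e w) = 0.

(** Tangency is one linear equation; the two remaining parameters are dh and dz. *)
Lemma tangentE w t : tangent w t -> t = cone_tangent (kappa w) (zeta w) (2 * kappa w * hp w t) (zp w t).
Proof.
rewrite /tangent bilE !isotropicE /= => H.
have t0 : t 0 0 = 2 * zeta w * t 1 0 - zeta w ^+ 2 * t 2 0.
  by apply: (lin_solve (k := - (kappa w)^-1) H); field.
by apply/colP; apply: ord3_ind; rewrite ?t0 !mxE /z_part /h_part /=; field.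
Qed.

Lemma tangent_cone w dh dz : tangent w (cone_tangent (kappa w) (zeta w) dh dz).
Proof. by rewrite /tangent bilE !mxE /=; ring. Qed.

Lemma tangentD w t t' : tangent w t -> tangent w t' -> tangent w (t + t').
Proof. by rewrite /tangent !bilE !mxE /= => H H'; rewrite -[RHS]addr0 -{1}H -H'; ring. Qed.
Lemma tangentN w t : tangent w t -> tangent w (- t).
Proof. by rewrite /tangent !bilE !mxE /= => H; rewrite -[RHS]oppr0 -H; ring. Qed.

Lemma tangent_lie w X : tangent w (lie X *m e w).
Proof. by rewrite lie_isotropic; exact: tangent_cone. Qed.

Lemma dz_lieB X Y w : vz (X - Y) w = vz X w - vz Y w.
Proof. by rewrite /dz_lie !mxE; ring. Qed.
Lemma dz_lieD X Y w : vz (X + Y) w = vz X w + vz Y w.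
Proof. by rewrite /dz_lie !mxE; ring. Qed.

(** The fields of the Lie algebra are the quadratic polynomials in zeta, so they are
    determined by three values; this is what makes gluing work. *)
Lemma dz_lie_inj X a b c : zeta a - zeta b != 0 -> zeta a - zeta c != 0 -> zeta b - zeta c != 0 ->
  vz X a = 0 -> vz X b = 0 -> vz X c = 0 -> X = 0.
Proof.
rewrite /dz_lie => ab ac bc Ha Hb Hc.
have x2 : X 0 2 = 0.
  apply: (mulIf ab); apply: (mulIf ac); apply: (mulIf bc); rewrite !mul0r.
  rewrite -[RHS](_ : (2 * zeta a * X 0 0 + X 0 1 - zeta a ^+ 2 * X 0 2) * - (zeta b - zeta c)
   + (2 * zeta b * X 0 0 + X 0 1 - zeta b ^+ 2 * X 0 2) * (zeta a - zeta c)
   - (2 * zeta c * X 0 0 + X 0 1 - zeta c ^+ 2 * X 0 2) * (zeta a - zeta b) = 0).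
    by ring.
  by rewrite Ha Hb Hc !mul0r subr0 addr0.
have x0 : X 0 0 = 0.
  have E : (2 * zeta a * X 0 0 + X 0 1 - zeta a ^+ 2 * X 0 2) -
           (2 * zeta b * X 0 0 + X 0 1 - zeta b ^+ 2 * X 0 2) = 0 by rewrite Ha Hb subr0.
  by apply: (lin_solve (k := (2 * (zeta a - zeta b))^-1) E); rewrite x2; field.
have x1 : X 0 1 = 0 by rewrite -Ha x0 x2; ring.
by apply/rowP; apply: ord3_ind; rewrite mxE.
Qed.

Lemma div_diff_lie X a b c d : zeta a - zeta b != 0 -> zeta a - zeta c != 0 -> zeta a - zeta d != 0 ->
  zeta b - zeta c != 0 -> zeta b - zeta d != 0 -> zeta c - zeta d != 0 ->
  dd (fun w => vz X w) a b c d = 0.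
Proof.
rewrite /div_diff /dz_lie => ab ac ad bc bd cd.
have ba := subr_neq0_sym ab.
have ca := subr_neq0_sym ac.
have da := subr_neq0_sym ad.
have cb := subr_neq0_sym bc.
have db := subr_neq0_sym bd.
have dc := subr_neq0_sym cd.
by field; rewrite ab ac ad bc bd cd ba ca da cb db dc.
Qed.

(** Newton's interpolation formula. *)
Lemma interpolation (u : W -> C) a b c : zeta a - zeta b != 0 -> zeta a - zeta c != 0 -> zeta b - zeta c != 0 ->
  exists X, [/\ u a = vz X a, u b = vz X b & u c = vz X c].
Proof.
move=> ab ac bc.
pose ab1 := (u a - u b) / (zeta a - zeta b); pose bc1 := (u b - u c) / (zeta b - zeta c).
pose abc := (ab1 - bc1) / (zeta a - zeta c).
exists (\row_j [:: (ab1 - (zeta a + zeta b) * abc) / 2; u a - zeta a * ab1 + zeta a * zeta b * abc; - abc]`_j).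
rewrite /dz_lie !mxE /= /abc /ab1 /bc1; split; by field; rewrite ?ab ?ac ?bc.
Qed.

(** The quadratic polynomial that interpolates u in three nodes takes the right
    value in the fourth one if the divided difference vanishes. *)
Lemma div_diff0 (u : W -> C) a b c d : zeta a - zeta b != 0 -> zeta a - zeta c != 0 -> zeta a - zeta d != 0 ->
  zeta b - zeta c != 0 -> zeta b - zeta d != 0 -> zeta c - zeta d != 0 ->
  dd u a b c d = 0 -> exists X, [/\ u a = vz X a, u b = vz X b, u c = vz X c & u d = vz X d].
Proof.
move=> ab ac ad bc bd cd H; have [X [Xa Xb Xc]] := interpolation u ab ac bc.
exists X; split=> //; have HX := div_diff_lie X ab ac ad bc bd cd.
have da := subr_neq0_sym ad.
have db := subr_neq0_sym bd.
have dc := subr_neq0_sym cd.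
have k0 : (zeta d - zeta a) * (zeta d - zeta b) * (zeta d - zeta c) != 0 by rewrite !mulf_neq0.
apply: (mulIf (invr_neq0 k0)); move: H; rewrite -HX /div_diff Xa Xb Xc.
by move=> /addrI.
Qed.
End Geometry.

(** * Deck transformations and the family *)

Section Equivariance.
Variables (C : numClosedFieldType) (V : finType) (W : choiceType).
Variables (pi : groupType) (p : W -> V) (act : pi -> W -> W) (main : V -> W).
Variables (m : nat) (rho : pi -> 'M[C]_3) (rhog : 'rV[C]_m -> pi -> 'M[C]_3).
Variables (U : set 'rV[C]_m) (zeta kappa : W -> C).
Hypothesis rho_rep : representation rho.
Hypothesis reg : regular_family rho U rhog.
Hypothesis equivariant : forall a w,
       isotropic (kappa (act a w)) (zeta (act a w))
       = rho a *m isotropic (kappa w) (zeta w).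
Hypothesis kappa_neq0 : forall w, kappa w != 0.
Hypothesis act1 : forall w, act 1%g w = w.
Hypothesis actM : forall a b w, act (a * b)%g w = act a (act b w).
Hypothesis act_p : forall a w, p (act a w) = p w.
Hypothesis act_free : forall a w, act a w = w -> a = 1%g.
Hypothesis act_transitive : forall w w', p w = p w' -> exists a, act a w = w'.
Hypothesis mainP : forall v, p (main v) = v.
Implicit Types (s : 'cV[C]_3) (X Y : 'rV[C]_3) (t : W -> 'cV[C]_3) (w : W) (a b : pi) (u : W -> C).
Local Notation e w := (isotropic (kappa w) (zeta w)).
Local Notation zp := (z_part zeta kappa).
Local Notation hp := (h_part kappa).
Local Notation vz X w := (dz_lie zeta w X).
Local Notation dd := (div_diff zeta).
Local Notation tang := (tangent zeta kappa).
Local Notation fm := (from_main p act main).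
Local Notation dv := (dvec p act main rho rhog zeta kappa).
Local Notation dr := (drho rhog).
Hypothesis dz_lie_inj_all : forall X, (forall w, vz X w = 0) -> X = 0.

Lemma from_mainP w : act (fm w) (main (p w)) = w.
Proof.
have [a Ha] := act_transitive (mainP (p w)).
by rewrite /from_main; case: xgetP => [b _ ->//|/(_ a)[]].
Qed.

Lemma act_uniq a b w : act a w = act b w -> a = b.
Proof.
move=> E; have : act (b^-1 * a)%g w = w by rewrite actM E -actM mulVg act1.
by move=> /act_free E1; rewrite -[b]mulg1 -E1 mulgA mulgV mul1g.
Qed.

Lemma from_main_act a w : fm (act a w) = (a * fm w)%g.
Proof. by apply: (@act_uniq _ _ (main (p w))); rewrite actM from_mainP -{1}(act_p a) from_mainP. Qed.

Lemma from_main_main v : fm (main v) = 1%g.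
Proof. by apply: (@act_uniq _ _ (main v)); rewrite act1 -[in LHS](mainP v) -{2}(mainP v) mainP from_mainP. Qed.

Lemma rho_unit a : rho a \in unitmx.
Proof. exact: SO3_unit (rho_rep.1 a). Qed.

Lemma rho1 : rho 1%g = 1%:M.
Proof.
have := rho_rep.2 1%g 1%g; rewrite mulg1 => E.
by have := congr1 (mulmx (invmx (rho 1%g))) E; rewrite mulKmx ?rho_unit // mulVmx ?rho_unit.
Qed.

Lemma tangent_so3 M w : so3 M -> tang w (M *m e w).
Proof.
move=> HM; have := bil_so3 (e w) (e w) HM; rewrite /tangent [bil (e w) (M *m _)]bilC => /eqP.
by rewrite -mulr2n mulrn_eq0 /= => /eqP.
Qed.

Lemma tangent_rho a w s : tang w s -> tang (act a w) (rho a *m s).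
Proof. by rewrite /tangent equivariant bil_SO3 //; exact: rho_rep.1. Qed.

(** As an element of PSL(2), rho a is a Moebius transformation of zeta; with mu its
    denominator, differences of zeta and tangent vectors transform by
    factors mu. *)
Lemma moebius a : exists mu : W -> C,
  [/\ forall w, mu w != 0, forall w, kappa (act a w) = kappa w * mu w ^+ 2,
      forall w w', zeta (act a w) - zeta (act a w') = (zeta w - zeta w') / (mu w * mu w')
    & forall w s, tang w s -> zp (act a w) (rho a *m s) = zp w s / mu w ^+ 2].
Proof.
have [x [y [z [t [det1 Erho]]]]] := SO3_sym2 (rho_rep.1 a).
pose mu w := z * zeta w + t.
have K w : kappa (act a w) = kappa w * mu w ^+ 2.
  have /colP/(_ 2) := equivariant a w.
  by rewrite Erho mul_mx3E !isotropicE !mx3E /= /mu => ->; ring.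
have mu0 w : mu w != 0.
  by apply: contraNneq (kappa_neq0 (act a w)) => E; rewrite K E expr0n mulr0.
have Z w : zeta (act a w) = (x * zeta w + y) / mu w.
  have /colP/(_ 1) := equivariant a w.
  rewrite Erho mul_mx3E !isotropicE !mx3E /= K => E.
  apply: (mulfI (kappa_neq0 w)); apply: (mulIf (mu0 w)); apply: (mulIf (mu0 w)).
  rewrite (_ : _ * _ * mu w * mu w = kappa w * mu w ^+ 2 * zeta (act a w)); last by ring.
  by rewrite E; have := mu0 w; rewrite /mu => n; field.
exists mu; split=> //.
  move=> w w'; rewrite !Z; rewrite -[in RHS](mulr1 (zeta w - zeta w')) -det1 /mu.
  by field; rewrite mu0 mu0.
move=> w s /(tangentE kappa_neq0) ->; rewrite z_part_cone //.
move: (2 * kappa w * hp w s) (zp w s) => dh dz.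
have -> : dz / mu w ^+ 2 = dz * (x * t - y * z) / mu w ^+ 2 by rewrite det1 mulr1.
have n := mu0 w; rewrite /z_part !(mul_mx3E (rho a)) Erho !mx3E !mxE /= K Z /mu.
by field; rewrite kappa_neq0 n.
Qed.

Lemma z_part_rho a w s : tang w s ->
  zp (act a w) (rho a *m s) = kappa w / kappa (act a w) * zp w s.
Proof.
move=> tt; have [mu [mu0 K _ ->//]] := moebius a.
by rewrite K; field; rewrite kappa_neq0 mu0.
Qed.

Lemma bil_act a w w' : bil (e (act a w)) (e (act a w')) = bil (e w) (e w').
Proof. by rewrite !equivariant bil_SO3 //; exact: rho_rep.1. Qed.

(** The scalar product of the vectors i and j is - h_i h_j (z_i - z_j)^2. *)
Lemma length_diff_bil t i j : zeta i - zeta j != 0 -> tang i (t i) -> tang j (t j) ->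
  length_diff zeta kappa t i j = 2^-1 * (bil (t i) (e j) + bil (e i) (t j)) / bil (e i) (e j).
Proof.
move=> nij /(tangentE kappa_neq0) Ei /(tangentE kappa_neq0) Ej.
rewrite Ei Ej /length_diff /dh_of /dz_of.
move: (hp i (t i)) (hp j (t j)) (zp i (t i)) (zp j (t j)) => ai aj bi bj.
rewrite !bilE !isotropicE !mxE /=.
have N : - (kappa i * zeta i ^+ 2) * kappa j + 2 * (kappa i * zeta i) * (kappa j * zeta j) -
   kappa i * (kappa j * zeta j ^+ 2) != 0.
  rewrite (_ : _ - _ = - (kappa i * kappa j * (zeta i - zeta j) ^+ 2)); last by ring.
  by rewrite oppr_eq0 !mulf_neq0 ?expf_neq0.
by field; rewrite nij N.
Qed.

Lemma drho_inf (dg : 'rV[C]_m) : infinitesimal_deformation rho (dr dg).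
Proof. exact: drho_infinitesimal reg dg. Qed.

Lemma so3_drho dg a : so3 (dr dg a *m invmx (rho a)).
Proof.
have [_ H] := drho_inf dg; have uP := rho_unit a; have [HF _] := rho_rep.1 a.
have HF' : (invmx (rho a))^T *m form3 C = form3 C *m rho a.
  by rewrite -{1}HF trmx_inv !mulmxA mulVmx ?unitmx_tr // mul1mx.
rewrite /so3 trmx_mul.
have -> : form3 C *m (dr dg a *m invmx (rho a)) =
    (invmx (rho a))^T *m ((rho a)^T *m form3 C *m dr dg a) *m invmx (rho a).
  by rewrite !mulmxA trmx_inv mulVmx ?unitmx_tr // mul1mx.
have -> : (invmx (rho a))^T *m (dr dg a)^T *m form3 C =
    (invmx (rho a))^T *m ((dr dg a)^T *m form3 C *m rho a) *m invmx (rho a).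
  by rewrite -!mulmxA mulmxV // mulmx1.
by rewrite -mulmxDl -mulmxDr H mulmx0 mul0mx.
Qed.

Lemma drho_e dg a w : dr dg a *m e w = (dr dg a *m invmx (rho a)) *m e (act a w).
Proof. by rewrite equivariant mulmxA mulmxKV ?rho_unit. Qed.

(** The defect of equivariance of a variation is given by dg alone. *)
Lemma dvec_act dh dz dg a w : dv dh dz dg (act a w) = rho a *m dv dh dz dg w + dr dg a *m e w.
Proof.
have [H _] := drho_inf dg.
rewrite /dvec from_main_act act_p H rho_rep.2 mulmxDl mulmxDr -!mulmxA -equivariant from_mainP.
by rewrite -[LHS]addrA [LHS]addrC.
Qed.

Lemma drho1 dg : dr dg 1%g = 0.
Proof.
have [H _] := drho_inf dg; have := H 1%g 1%g.
by rewrite mulg1 rho1 mulmx1 mul1mx => /eqP; rewrite -subr_eq subrr eq_sym => /eqP.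
Qed.

Lemma dvec_main dh dz dg v : dv dh dz dg (main v) =
  cone_tangent (kappa (main v)) (zeta (main v)) (dh v) (dz v).
Proof. by rewrite /dvec from_main_main mainP drho1 rho1 mul0mx mul1mx add0r. Qed.

Lemma tangent_dvec dh dz dg w : tang w (dv dh dz dg w).
Proof.
rewrite -{1 2}(from_mainP w) dvec_act; apply: tangentD.
  by apply: tangent_rho; rewrite dvec_main; exact: tangent_cone.
by rewrite drho_e; apply: tangent_so3; exact: so3_drho.
Qed.

(** A tangent field with the defect of equivariance of dg is determined by its values
    on the main vertices, so it is a variation [dvec]. *)
Lemma dvec_unique dg t : (forall a w, t (act a w) = rho a *m t w + dr dg a *m e w) ->
  (forall v, tang (main v) (t (main v))) ->
  t = dv (fun v => 2 * kappa (main v) * hp (main v) (t (main v)))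
         (fun v => zp (main v) (t (main v))) dg.
Proof.
move=> H T; apply/funext => w; rewrite -(from_mainP w) H dvec_act dvec_main.
by rewrite -tangentE.
Qed.

(** The same for the z-components, on which rho a acts independently of the
    h-components. *)
Lemma dvec_z_unique dg u dh : (forall a w, u (act a w) =
     kappa w / kappa (act a w) * u w + zp (act a w) (dr dg a *m e w)) ->
  forall w, u w = zp w (dv dh (fun v => u (main v)) dg w).
Proof.
move=> H w; rewrite -(from_mainP w) H dvec_act z_partD z_part_rho; last exact: tangent_dvec.
by rewrite dvec_main z_part_cone.
Qed.

Lemma so3D (M N : 'M[C]_3) : so3 M -> so3 N -> so3 (M + N).
Proof.
rewrite /so3 => HM HN; rewrite linearD /= mulmxDl mulmxDr addrACA HM HN.
by rewrite addr0.
Qed.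

Lemma lieN X : lie (- X) = - lie X.
Proof.
have := lie_linear (-1) X 0; rewrite addr0 !scaleN1r => ->.
by rewrite /lie !mxE !scale0r !addr0.
Qed.

(** If u is equivariant up to the fields c a, comparing u at (ab) w computed in two
    ways shows that c is a 1-cocycle for the adjoint action; this means that
    a |-> c a rho a is a first-order deformation of rho, and regularity applies. *)
Lemma cocycle_to_family u (c : pi -> 'rV[C]_3) :
  (forall a w, u (act a w) = kappa w / kappa (act a w) * u w + vz (c a) (act a w)) ->
  exists dg X, forall a, lie (c a) *m rho a = dr dg a + (lie X *m rho a - rho a *m lie X).
Proof.
move=> H; pose xi a := lie (c a) *m rho a.
have inf : infinitesimal_deformation rho xi.
  split=> [a b|a]; last first.
    rewrite /xi trmx_mul -!mulmxA -mulmxDr [form3 C *m (_ *m _)]mulmxA [(lie _)^T *m _]mulmxA.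
    by rewrite -mulmxDl so3_lie mul0mx mulmx0.
  have [Y EY] := lie_of_so3 (so3_Ad (rho_rep.1 a) (so3_lie (c b))).
  have vY w : vz Y (act a w) = kappa w / kappa (act a w) * vz (c b) w.
    rewrite -(z_part_lie zeta kappa_neq0) -EY equivariant -!mulmxA mulKmx ?rho_unit //.
    by rewrite z_part_rho ?z_part_lie //; exact: tangent_lie.
  have Ec : c (a * b)%g = c a + Y.
    apply/eqP; rewrite -subr_eq0; apply/eqP; apply: dz_lie_inj_all => w.
    have -> : w = act (a * b)%g (act (a * b)^-1%g w) by rewrite -actM mulgV act1.
    move: (act _^-1%g w) => w'; rewrite dz_lieB dz_lieD; apply/eqP; rewrite subr_eq0; apply/eqP.
    apply: (addrI (kappa w' / kappa (act (a * b)%g w') * u w')).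
    by rewrite -H actM H H vY; field; rewrite !kappa_neq0.
  rewrite /xi Ec rho_rep.2 -[lie (c a + Y)](_ : lie (c a) + lie Y = _); last first.
    by rewrite -[c a]scale1r lie_linear !scale1r.
  by rewrite mulmxDl -EY !mulmxA mulmxKV ?rho_unit.
have [dg [[X HX] _]] := family_tangent reg inf.
by exists dg, X => a; rewrite -HX.
Qed.

(** When dz is the field of X, comparing its values at w and aw shows that drho a
    is the infinitesimal conjugation by X.  Regularity allows only dg = 0 for
    that, and then X commutes with rho. *)
Lemma family_rigid dh dz dg X : (forall w, zp w (dv dh dz dg w) = vz X w) ->
  dg = 0 /\ X \in centralizer rho.
Proof.
move=> H.
have N a : dr dg a + (rho a *m lie X - lie X *m rho a) = 0.
  have [Y EY] : exists Y, dr dg a *m invmx (rho a) + rho a *m lie X *m invmx (rho a) + lie (- X) = lie Y.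
    apply: lie_of_so3; apply: so3D; last exact: so3_lie.
    by apply: so3D; [exact: so3_drho|apply: so3_Ad; [exact: rho_rep.1|exact: so3_lie]].
  have EN : dr dg a + (rho a *m lie X - lie X *m rho a) = lie Y *m rho a.
    by rewrite -EY lieN mulmxBl (mulmxDl (_ *m invmx _)) !(mulmxKV (rho_unit a)) addrA.
  suff Y0 : Y = 0 by rewrite EN Y0 /lie !mxE !scale0r !addr0 mul0mx.
  apply: dz_lie_inj_all => w.
  have -> : w = act a (act a^-1%g w) by rewrite -actM mulgV act1.
  move: (act a^-1%g w) => w'.
  rewrite -(z_part_lie zeta kappa_neq0) equivariant mulmxA -EN mulmxDl mulmxBl.
  have := H (act a w'); rewrite dvec_act z_partD z_part_rho ?H; last exact: tangent_dvec.
  move=> E; rewrite z_partD z_partD z_partN -!mulmxA -equivariant z_part_lie // z_part_rho ?z_part_lie //; last exact: tangent_lie.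
  by rewrite -E; ring.
have inf0 : infinitesimal_deformation rho (fun=> 0).
  by split=> [a b|a]; rewrite ?trmx0 ?mulmx0 ?mul0mx ?addr0.
have [g [_ uniq]] := family_tangent reg inf0.
have Edg : g = dg.
  apply: uniq; exists (- X) => a; rewrite -/(drho rhog dg a) -[LHS](N a).
  by rewrite lieN mulNmx mulmxN opprK [in RHS]addrC addrC [_ - _]addrC.
have dg0 : dg = 0.
  rewrite -Edg; apply: uniq; exists 0 => a.
  rewrite -/(drho rhog 0 a) (drho0 (family_diff reg)).
  by rewrite /lie !mxE !scale0r !addr0 mul0mx mulmx0 subr0 addr0.
split=> //; rewrite unfold_in; apply/asboolP => a.
have := N a; rewrite dg0 (drho0 (family_diff reg)) add0r => /eqP.
by rewrite subr_eq0 => /eqP.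
Qed.

(** Divided differences kill the field X, and the remaining factors mu of the
    Moebius transformation cancel.  So zeta_ij zeta_kl times the divided difference
    descends to M. *)
Lemma div_diff_act a u u' (X : 'rV[C]_3) : (forall w, u' (act a w) = kappa w / kappa (act a w) * u w + vz X (act a w)) ->
  forall i j k l, zeta i - zeta j != 0 -> zeta i - zeta k != 0 -> zeta i - zeta l != 0 ->
  zeta j - zeta k != 0 -> zeta j - zeta l != 0 -> zeta k - zeta l != 0 ->
  (zeta (act a i) - zeta (act a j)) * (zeta (act a k) - zeta (act a l)) *
     dd u' (act a i) (act a j) (act a k) (act a l) =
  (zeta i - zeta j) * (zeta k - zeta l) * dd u i j k l.
Proof.
move=> H i j k l ij ik il jk jl kl.
have [mu [mu0 K Z _]] := moebius a.
have n x y : zeta x - zeta y != 0 -> zeta (act a x) - zeta (act a y) != 0.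
  by move=> xy; rewrite Z mulf_neq0 // invr_eq0 mulf_neq0.
have -> : dd u' (act a i) (act a j) (act a k) (act a l) =
    dd (fun w => u' w - vz X w) (act a i) (act a j) (act a k) (act a l).
  apply/eqP; rewrite -subr_eq0 -(div_diff_lie X (n _ _ ij) (n _ _ ik) (n _ _ il) (n _ _ jk) (n _ _ jl) (n _ _ kl)).
  by apply/eqP; rewrite /div_diff; ring.
have E w : u' (act a w) - vz X (act a w) = u w / mu w ^+ 2.
  by rewrite H addrK K; field; rewrite kappa_neq0 mu0.
rewrite /div_diff !E !Z.
have ji := subr_neq0_sym ij.
have ki := subr_neq0_sym ik.
have li := subr_neq0_sym il.
have kj := subr_neq0_sym jk.
have lj := subr_neq0_sym jl.
have lk := subr_neq0_sym kl.
by field; rewrite !mu0 ij ik il jk jl kl ji ki li kj lj lk.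
Qed.
End Equivariance.

(** * The equations around an edge *)

Section Complex.
Import mathcomp.boot.fintype mathcomp.boot.finset mathcomp.finmap.finmap.
Variables (C : numClosedFieldType).
Variables (V : finType) (K : {set {set V}}) (pos : V -> V -> V -> V -> bool).
Hypotheses (K_manifold : closed_3manifold K) (K_oriented : orientation K pos).
Variables (W : choiceType) (Kt : set {fset W}) (p : W -> V).
Variables (pi : groupType) (act : pi -> W -> W).
Hypothesis cover : universal_cover K Kt p act.
Variables (main : V -> W) (edge : edges K -> W * W).
Variable tet : tetrahedra K -> W * W * W * W.
Hypothesis family : fundamental_family pos Kt p main edge tet.
Variables (rho : pi -> 'M[C]_3) (m : nat) (U : set 'rV[C]_m).
Variable rhog : 'rV[C]_m -> pi -> 'M[C]_3.
Hypotheses (rho_rep : representation rho) (rho_regular : regular_family rho U rhog).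
Variables (zeta kappa : W -> C).
Hypothesis equivariant : forall a w,
       isotropic (kappa (act a w)) (zeta (act a w))
       = rho a *m isotropic (kappa w) (zeta w).
Hypothesis kappa_neq0 : forall w, kappa w != 0.
Hypothesis zeta_edge : forall i j, i != j -> Kt [fset i; j]%fset -> zeta i - zeta j != 0.
Implicit Types (w i j : W) (T : {fset W}) (x y : V) (t : tetrahedra K).

Let covering := cover_covering cover.
Local Notation ov t v := (Defs.over p tet t v).
Local Notation dd := (div_diff zeta).
Local Notation is_tet := (is_tet Kt).
Local Notation F1 := (@f1 _ V W pi main rho m zeta).
Local Notation F2 := (f2 p act main tet rhog zeta kappa).
Local Notation F3 := (f3 pos Kt p edge tet zeta).
Local Notation F4 := (f4 p act main edge rhog zeta kappa).
Local Notation F5 := (@f5 _ V W pi main rho m zeta).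
Local Notation G1 := (@g1 _ V W pi main rho m zeta).
Local Notation G2 := (g2 p act main edge rhog zeta kappa).
Local Notation ldiff := (length_diff zeta kappa).
Local Notation tang := (tangent zeta kappa).

Lemma tet_zeta_neq T i j : is_tet T -> i \in T -> j \in T -> i != j -> zeta i - zeta j != 0.
Proof. by move=> tT iT jT ij; apply: zeta_edge => //; exact: (tet_edge covering tT). Qed.

Lemma set4_uniq a b c d : (#|[set a; b; c; d : V]%SET| == 4%N) = uniq [:: a; b; c; d].
Proof.
have -> : #|[set a; b; c; d]%SET| = #|[:: a; b; c; d]|.
  by apply: eq_card => x; rewrite !inE !orbA.
by apply/eqP/idP => [E|/card_uniqP ->//]; apply/card_uniqP; rewrite E.
Qed.

Definition tet_fset t : {fset W} := let: (w0, w1, w2, w3) := tet t in [fset w0; w1; w2; w3]%fset.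

Lemma tetP t : let: (w0, w1, w2, w3) := tet t in
  [/\ is_tet (tet_fset t), uniq [:: w0; w1; w2; w3], uniq [:: p w0; p w1; p w2; p w3],
      [set p w0; p w1; p w2; p w3]%SET = val t & pos_tet K pos (p w0) (p w1) (p w2) (p w3)].
Proof.
have [_ _ /(_ t)] := family; rewrite /tet_fset; case: (tet t) => [[[w0 w1] w2] w3] [k E ps].
have /andP[tK t4] := valP t.
have Up : uniq [:: p w0; p w1; p w2; p w3] by rewrite -set4_uniq E.
have [_ c] := covering.2.1 _ k; rewrite shadow4 E (eqP t4) in c.
split=> //; last by rewrite /pos_tet /ordered_tetrahedron Up E tK.
by have := Up; rewrite -[[:: p w0; p w1; p w2; p w3]]/(map p [:: w0; w1; w2; w3]) => /map_uniq.
Qed.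

Lemma tet_fsetP t : is_tet (tet_fset t) /\ shadow p (tet_fset t) = val t.
Proof.
have := tetP t; rewrite /tet_fset; case: (tet t) => [[[w0 w1] w2] w3] [tT _ _ E _].
by split=> //; rewrite shadow4.
Qed.

Lemma over_in t w : w \in tet_fset t -> ov t (p w) = w.
Proof.
have := tetP t; rewrite /tet_fset /Defs.over; case: (tet t) => [[[w0 w1] w2] w3] [_ _ Up _ _].
move: Up; rewrite /= !inE !negb_or => /and4P[/and3P[n01 n02 n03] /andP[n12 n13] n23 _].
by case/orP => [/orP[/orP[]|]|] /eqP ->; rewrite ?eqxx // ?(negPf n01) ?(negPf n02) ?(negPf n03) ?(negPf n12) ?(negPf n13) ?(negPf n23).
Qed.

(** A tetrahedron of the cover is a translate of the one in the fundamental family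
    over the same simplex. *)
Lemma over_tet t T : is_tet T -> shadow p T = val t ->
  exists a, [fset act a w | w in T]%fset = tet_fset t /\ forall w, w \in T -> ov t (p w) = act a w.
Proof.
move=> tT sT; have [tt st] := tet_fsetP t; have [w wT] := tet_nonempty tT.
have : p w \in shadow p (tet_fset t) by rewrite st -sT; apply/shadowP; exists w.
case/shadowP => w' wt' pw.
have [a aw] := deck_transitive cover (esym pw); exists a.
have kaT : Kt [fset act a u | u in T]%fset := deck_simplicial cover a tT.1.
have saT : shadow p [fset act a u | u in T]%fset = val t.
  rewrite -sT; apply/setP => v; apply/shadowP/shadowP => [[u /imfsetP[u' /= u'T ->]]|[u uT <-]].
    by rewrite (deck_fibre cover) => <-; exists u'.
  by exists (act a u); rewrite ?(deck_fibre cover) //; apply/imfsetP; exists u.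
have w'aT : w' \in [fset act a u | u in T]%fset by rewrite -aw; apply/imfsetP; exists w.
have [||S [_ _ _ uS]] := @simplex_lift _ _ _ _ _ covering w' (val t).
- by rewrite -st; exact: shadow_simplex covering _ tt.1.
- by rewrite -st; apply/shadowP; exists w'.
have E : [fset act a u | u in T]%fset = tet_fset t.
  by rewrite (uS _ kaT w'aT saT) -(uS _ tt.1 wt' st).
split=> // u uT; rewrite -(deck_fibre cover a); apply: over_in.
by rewrite -E; apply/imfsetP; exists u.
Qed.

Lemma tet_of T : is_tet T -> exists t, val t = shadow p T.
Proof.
move=> [kT T4]; have [sK c] := covering.2.1 _ kT.
have H : (shadow p T \in K) && (#|shadow p T| == 4%N) by rewrite sK c T4.
by exists (exist _ (shadow p T) H).
Qed.

Lemma perm_tet T i j k l : T = [fset i; j; k; l]%fset -> uniq [:: i; j; k; l] -> perm_eq T [:: i; j; k; l].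
Proof.
by move=> E Uq; apply: uniq_perm => // w; rewrite E !inE !orbA.
Qed.

(** The divided difference in a form that shows its symmetry in the vertices. *)
Definition div_diff_tet (u : W -> C) T : C :=
  \sum_(w <- T) u w / \prod_(w' <- T | w' != w) (zeta w - zeta w').

Lemma div_diff_tetE u T i j k l : T = [fset i; j; k; l]%fset -> uniq [:: i; j; k; l] ->
  div_diff_tet u T = dd u i j k l.
Proof.
move=> E Uq; have P := perm_tet E Uq.
rewrite /div_diff_tet (perm_big _ P) /= /div_diff !big_cons big_nil addr0 !addrA.
rewrite !(perm_big _ P) /= !big_cons !big_nil !eqxx /=.
move: Uq; rewrite /= !inE !negb_or => /and4P[/and3P[n1 n2 n3] /andP[n4 n5] n6 _].
rewrite !(eq_sym j i) !(eq_sym k i) !(eq_sym k j) !(eq_sym l i) !(eq_sym l j) !(eq_sym l k).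
by rewrite n1 n2 n3 n4 n5 n6 /= !mulr1 !mulrA.
Qed.

Lemma tet_members T i j k l : T = [fset i; j; k; l]%fset -> [/\ i \in T, j \in T, k \in T & l \in T].
Proof. by move=> ->; rewrite !inE !eqxx !orbT. Qed.

Lemma tet_zeta T i j k l : is_tet T -> T = [fset i; j; k; l]%fset -> uniq [:: i; j; k; l] ->
  [/\ zeta i - zeta j != 0, zeta i - zeta k != 0 & zeta i - zeta l != 0] /\
  [/\ zeta j - zeta k != 0, zeta j - zeta l != 0 & zeta k - zeta l != 0].
Proof.
move=> tT E Uq; have [iT jT kT lT] := tet_members E.
move: Uq; rewrite /= !inE !negb_or => /and4P[/and3P[n1 n2 n3] /andP[n4 n5] n6 _].
by split; split; apply: (tet_zeta_neq tT).
Qed.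

Lemma tet_frame T : is_tet T -> exists i j k l, [/\ T = [fset i; j; k; l]%fset, uniq [:: i; j; k; l],
  [/\ zeta i - zeta j != 0, zeta i - zeta k != 0 & zeta i - zeta l != 0] &
  [/\ zeta j - zeta k != 0, zeta j - zeta l != 0 & zeta k - zeta l != 0]].
Proof.
move=> tT; have [i iT] := tet_nonempty tT; have [j [k [l [E Uq]]]] := tet_complete1 tT iT.
by have [z1 z2] := tet_zeta tT E Uq; exists i, j, k, l.
Qed.

(** The coefficient zeta_ij zeta_kl of f3, read off the tetrahedron of the family. *)
Definition omega t x y z v : C := (zeta (ov t x) - zeta (ov t y)) * (zeta (ov t z) - zeta (ov t v)).

(** A deck transformation multiplies zeta_ij zeta_kl by the inverse of the product
    of mu over the four vertices, the same factor for all orderings. *)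
Lemma omega_scale T t : is_tet T -> shadow p T = val t -> exists2 r : C, r != 0 &
  forall i j k l, T = [fset i; j; k; l]%fset -> uniq [:: i; j; k; l] ->
    omega t (p i) (p j) (p k) (p l) = r * ((zeta i - zeta j) * (zeta k - zeta l)).
Proof.
move=> tT sT; have [a [_ Ha]] := over_tet tT sT.
have [mu [mu0 _ Z _]] := moebius rho_rep equivariant kappa_neq0 a.
exists (\prod_(w <- T) mu w)^-1.
  by rewrite invr_eq0 prodf_seq_neq0; apply/allP => w _; rewrite mu0.
move=> i j k l E Uq; have [iT jT kT lT] := tet_members E.
rewrite (perm_big _ (perm_tet E Uq)) /= !big_cons big_nil mulr1 /omega !Ha // !Z.
by field; rewrite !mu0.
Qed.

(** dy is not invariant under deck transformations, since zeta_ij zeta_kl is not;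
    y is its value on the tetrahedron T of the cover. *)
Lemma lift_dy (dy : tetrahedra K -> C) T : exists y : C, is_tet T ->
  forall t, shadow p T = val t -> forall i j k l, T = [fset i; j; k; l]%fset -> uniq [:: i; j; k; l] ->
    omega t (p i) (p j) (p k) (p l) * dy t = (zeta i - zeta j) * (zeta k - zeta l) * y.
Proof.
have [tT|n] := pselect (is_tet T); last by exists 0.
have [t Et] := tet_of tT; have [r r0 Hr] := omega_scale tT (esym Et).
exists (r * dy t) => _ t' Et' i j k l E Uq.
have -> : t' = t by apply: val_inj; rewrite Et.
by rewrite (Hr _ _ _ _ E Uq); ring.
Qed.

(** The contribution of the tetrahedron xykl to the equation of the edge xy.  The
    sum has at most one term. *)
Definition corner (dy : tetrahedra K -> C) x y k l : C :=
  \sum_(t | val t == [set x; y; k; l]%SET) omega t x y k l * dy t.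

Lemma cornerE dy t x y k l : val t = [set x; y; k; l]%SET -> corner dy x y k l = omega t x y k l * dy t.
Proof.
move=> E; rewrite /corner (big_pred1 t) // => t'; rewrite -E.
by apply/eqP/eqP => [/val_inj|->].
Qed.

Definition star_sum dy x y : C :=
  \sum_(kl : V * V | pos_tet K pos x y kl.1 kl.2) corner dy x y kl.1 kl.2.

Lemma star_sumC dy x y : star_sum dy x y = star_sum dy y x.
Proof.
rewrite /star_sum (reindex (fun kl : V * V => (kl.2, kl.1))) /=; last first.
  by apply: onW_bij; exists (fun kl : V * V => (kl.2, kl.1)); case.
apply: eq_big => [[k l]|[k l] _] /=.
  by apply/idP/idP; exact: pos_tet_swap.
rewrite /corner; have -> : [set x; y; l; k]%SET = [set y; x; k; l]%SET.
  by rewrite setUAC (setUC [set x]%SET).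
by apply: eq_bigr => t _; rewrite /omega; ring.
Qed.

(** By unique lifting, the star of an edge of the cover is in bijection with the
    positive tetrahedra xykl of K. *)
Lemma f3E (dy : {ffun tetrahedra K -> C}) e :
  F3 dy e = star_sum dy (p (edge e).1) (p (edge e).2).
Proof.
have [_ /(_ e) He _] := family.
rewrite /f3 ffunE; case: (edge e) He => i j [kij Eij] /=.
pose Q := [pred z : tetrahedra K * (V * V) | pos_tet K pos (p i) (p j) z.2.1 z.2.2 &
   val z.1 == [set p i; p j; z.2.1; z.2.2]%SET].
pose h (z : tetrahedra K * (V * V)) : tetrahedra K * W * W :=
  (z.1, lift_at Kt p i z.2.1, lift_at Kt p i z.2.2).
have lf t x y : val t = [set p i; p j; x; y]%SET ->
    [/\ Kt [fset i; j; lift_at Kt p i x; lift_at Kt p i y]%fset, p (lift_at Kt p i x) = x & p (lift_at Kt p i y) = y].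
  move=> E; have [|k1 _ px py] := @lift_at4 _ _ _ _ _ covering i (p j) x y.
    by rewrite -E; have /andP[] := valP t.
  by split=> //; move: k1; rewrite (lift_at_p covering kij).
have hinj : {in Q &, injective h}.
  move=> [t [x y]] [t' [x' y']]; rewrite !inE /= => /andP[_ /eqP E] /andP[_ /eqP E'] [Et Ex Ey].
  have [_ px py] := lf _ _ _ E; have [_ px' py'] := lf _ _ _ E'.
  by rewrite Et -px -py -px' -py' Ex Ey.
have -> : star pos Kt p i j = [set` [seq h z | z <- enum Q]].
  apply/seteqP; split=> [[[t k] l] /= [kk E ps]|z /mapP[[t [x y]]]].
    have ki : Kt [fset i; k]%fset by apply: (pairs_in covering kk); rewrite !inE eqxx ?orbT.
    have li : Kt [fset i; l]%fset by apply: (pairs_in covering kk); rewrite !inE eqxx ?orbT.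
    apply/mapP; exists (t, (p k, p l)); last by rewrite /h /= !(lift_at_p covering).
    have E' : val t = [set p i; p j; p k; p l]%SET := esym E.
    rewrite mem_enum inE /= [X in X && _]/pos_tet /ordered_tetrahedron ps -set4_uniq -E'.
    by have /andP[-> ->] := valP t; rewrite eqxx.
  rewrite mem_enum inE /= => /andP[/andP[_ ps] /eqP E] ->.
  by rewrite /h /= /star /=; have [k1 px py] := lf _ _ _ E; rewrite px py E.
rewrite -fsbig_seq ?map_inj_in_uniq ?enum_uniq //; last first.
  by move=> z z'; rewrite !mem_enum; exact: hinj.
rewrite big_map big_enum /= /star_sum /corner.
rewrite [RHS](eq_bigr (fun kl => \sum_(t | val t == [set p i; p j; kl.1; kl.2]%SET) omega t (p i) (p j) kl.1 kl.2 * dy t)) //.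
rewrite pair_big_dep /= (reindex (fun z : V * V * tetrahedra K => (z.2, z.1))) /=; last first.
  by apply: onW_bij; exists (fun z => (z.2, z.1)); case.
apply: eq_big => [[[x y] t]|[[x y] t]]; rewrite ?inE //= => /andP[_ /eqP E].
by have [_ px py] := lf _ _ _ E; rewrite px py.
Qed.

Lemma star_sum_eq0 (dy : {ffun tetrahedra K -> C}) : F3 dy = 0 ->
  forall x y, x != y -> [set x; y]%SET \in K -> star_sum dy x y = 0.
Proof.
move=> /ffunP H x y xy xyK.
have He : ([set x; y]%SET \in K) && (#|[set x; y]%SET| == 2%N) by rewrite xyK cards2 xy.
pose e : edges K := exist _ [set x; y]%SET He; have := H e; rewrite f3E ffunE.
have [_ /(_ e)] := family; case: (edge e) => i j /= [_ E].
have : p i \in [set x; y]%SET by rewrite -E !inE eqxx.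
have : p j \in [set x; y]%SET by rewrite -E !inE eqxx orbT.
have xs : x \in [set p i; p j]%SET by rewrite E !inE eqxx.
have ys : y \in [set p i; p j]%SET by rewrite E !inE eqxx orbT.
move: xs ys; rewrite !inE => xs ys /orP[] /eqP ej /orP[] /eqP ei; rewrite ei ej //.
- by move: ys; rewrite ei ej orbb eq_sym (negPf xy).
- by rewrite star_sumC.
- by move: xs; rewrite ei ej orbb (negPf xy).
Qed.

(** The vertices of the link of the edge xy. *)
Definition opposite x y (z : V) := uniq [:: x; y; z] && ([set x; y; z]%SET \in K).

Lemma pos_tet_opposite x y k l : pos_tet K pos x y k l -> opposite x y k.
Proof.
move=> /andP[/andP[Uq kK] _]; apply/andP; split.
  by move: Uq; rewrite -[[:: x; y; k; l]]/(rcons [:: x; y; k] l) rcons_uniq => /andP[].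
by apply: (simplex_face K_manifold kK); [exact: subsetUl|apply/set0Pn; exists x; rewrite !inE eqxx].
Qed.

Lemma oppositeC x y z : opposite x y z = opposite y x z.
Proof.
rewrite /opposite (setUC [set x]%SET) /= !inE (eq_sym x y) !negb_or.
by congr (_ && _); case: (y != x); case: (x != z); case: (y != z).
Qed.

(** The positive pairs kl orient the cycle of the vertices opposite to xy: each of
    these is the first member of exactly one pair, and likewise the second. *)
Lemma sum_pos_tet_fst (F : V -> C) x y :
  \sum_(kl : V * V | pos_tet K pos x y kl.1 kl.2) F kl.1 = \sum_(k | opposite x y k) F k.
Proof.
rewrite -[LHS](pair_big_dep (fun=> true) (fun k l => pos_tet K pos x y k l) (fun k _ => F k)) /=.
rewrite (bigID (opposite x y)) /= [X in _ + X]big1 ?addr0 => [|k kn].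
  apply: eq_bigr => k /andP[kU kK]; have [l Hl] := pos_exists K_manifold K_oriented kU kK.
  rewrite (big_pred1 l) // => l'; apply/idP/eqP => [Hl'|->//].
  exact: (pos_unique K_oriented Hl' Hl).
by rewrite big1 // => l /pos_tet_opposite; rewrite (negPf kn).
Qed.

Lemma sum_pos_tet_snd (F : V -> C) x y :
  \sum_(kl : V * V | pos_tet K pos x y kl.1 kl.2) F kl.2 = \sum_(k | opposite x y k) F k.
Proof.
rewrite (reindex (fun kl : V * V => (kl.2, kl.1))) /=; last first.
  by apply: onW_bij; exists (fun kl : V * V => (kl.2, kl.1)); case.
rewrite (eq_bigl (fun kl => pos_tet K pos y x kl.1 kl.2)); last first.
  by move=> kl; apply/idP/idP; exact: pos_tet_swap.
by rewrite sum_pos_tet_fst; apply: eq_bigl => k; rewrite oppositeC.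
Qed.

Lemma edge_link_constant (L : Type) (f : V -> L) x y : x != y ->
  (forall k l, pos_tet K pos x y k l -> f k = f l) ->
  forall k k', opposite x y k -> opposite x y k' -> f k = f k'.
Proof.
move=> xy H.
have inL k : opposite x y k -> k \notin [set y]%SET /\ k |: [set y]%SET \in link K [set x]%SET.
  move=> ok; have [xk yk kK] : [/\ x != k, y != k & [set x; y; k]%SET \in K].
    by move: ok; rewrite /opposite /= !inE negb_or => /andP[/and3P[/andP[_ ->] -> _] ->].
  split; first by rewrite in_set1 eq_sym.
  rewrite in_link in_setU1 in_set1 negb_or xk xy /= setUA setUAC kK andbT.
  by apply/set0Pn; exists k; rewrite !inE eqxx.
move=> k k' /inL[k1 k2] /inL[k1' k2'].
apply: (sl_connected (link_like K_manifold x) (F := [set y]%SET)) => //; rewrite ?cards1 //.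
move=> u v; rewrite !in_set1 => uy vy; rewrite in_link => /and3P[_ xn uvK].
have [->//|uv] := eqVneq u v.
move: xn; rewrite !in_setU !in_set1 !negb_or => /and3P[_ xu xv].
have T4 : ordered_tetrahedron K x y u v.
  rewrite /ordered_tetrahedron -!setUA uvK andbT /= !inE !negb_or xy xu xv uv.
  by rewrite !(eq_sym y) uy vy.
have [ps|ps] := boolP (pos x y u v); first by apply: H; rewrite /pos_tet T4.
by apply/esym/H; rewrite /pos_tet ordered_tetrahedron_swap34 T4 (pos_swap34 K_oriented).
Qed.

(** On the cycle of the vertices opposite to xy, a cochain with total zero is a
    coboundary.  By duality this amounts to flows around the cycle being constant,
    for which no enumeration of the cycle is necessary. *)
Lemma edge_potential dy x y : x != y -> star_sum dy x y = 0 ->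
  exists la : V -> C, forall k l, pos_tet K pos x y k l -> la k - la l = corner dy x y k l.
Proof.
move=> xy S0.
pose E (kl : V * V) := pos_tet K pos x y kl.1 kl.2.
pose A (v : V) (kl : V * V) : C := if E kl then (v == kl.1)%:R - (v == kl.2)%:R else 0.
pose b (kl : V * V) : C := if E kl then corner dy x y kl.1 kl.2 else 0.
have [|la Hla] := @solvable_dual C _ _ A b; last first.
  exists la => k l kl; have := Hla (k, l); rewrite /b /E /= kl => <-.
  rewrite /A /E /= kl.
  rewrite (eq_bigr (fun v => la v * (v == k)%:R - la v * (v == l)%:R)); last by move=> v _; rewrite mulrBr.
  rewrite big_split /= sumrN (bigD1 k) //= eqxx mulr1 big1 ?addr0 => [|v /negPf->]; last by rewrite mulr0.
  by rewrite (bigD1 l) //= eqxx mulr1 big1 ?addr0 // => v /negPf->; rewrite mulr0.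
move=> c Hc.
(* The weight c entering a vertex is the weight leaving it. *)
have flow v : \sum_(kl | E kl && (kl.1 == v)) c kl = \sum_(kl | E kl && (kl.2 == v)) c kl.
  apply/eqP; rewrite -subr_eq0 -[X in _ == X](Hc v); apply/eqP.
  rewrite !(big_mkcond (fun kl => E kl && _)) /= -sumrB; apply: eq_bigr => kl _.
  rewrite /A; case: (E kl) => /=; last by rewrite subrr mul0r.
  by rewrite !(eq_sym v); case: eqP; case: eqP => _ _ /=; rewrite ?subr0 ?sub0r ?subrr ?mul1r ?mulN1r ?mul0r.
pose f v := \sum_(kl | E kl && (kl.1 == v)) c kl.
have fst k l : E (k, l) -> f k = c (k, l).
  move=> kl; rewrite /f (big_pred1 (k, l)) // => -[k' l'] /=; apply/andP/eqP => [[kl' /eqP kk]|[-> ->] //=].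
  by rewrite /= in kk; subst k'; congr (_, _); exact: (pos_unique K_oriented kl' kl).
have snd k l : E (k, l) -> f l = c (k, l).
  move=> kl; rewrite /f flow (big_pred1 (k, l)) // => -[k' l'] /=; apply/andP/eqP => [[kl' /eqP kk]|[-> ->] //=].
  rewrite /= in kk; subst l'; congr (_, _).
  exact: (pos_unique K_oriented (pos_tet_swap K_oriented kl') (pos_tet_swap K_oriented kl)).
have const := @edge_link_constant _ f x y xy (fun k l kl => etrans (fst k l kl) (esym (snd k l kl))).
have [[[k0 l0] kl0]|n] := pselect (exists kl, E kl); last first.
  by rewrite big1 // => kl _; rewrite /b; case: ifP => [H|_]; [case: n; exists kl|rewrite mul0r].
rewrite (eq_bigr (fun kl => b kl * f k0)) => [|[k l] _].
  rewrite -mulr_suml; have -> : \sum_kl b kl = star_sum dy x y by rewrite /star_sum [RHS]big_mkcond.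
  by rewrite S0 mul0r.
rewrite /b; case: ifP => [kl|_]; last by rewrite !mul0r.
by rewrite -(fst k l kl) (const k k0) //; [exact: pos_tet_opposite kl|exact: pos_tet_opposite kl0].
Qed.

Lemma fset_swap34 i j k l : [fset i; j; k; l]%fset = [fset i; j; l; k : W]%fset.
Proof. by rewrite fsetUAC. Qed.

Lemma tet_ordered T i j k l : is_tet T -> T = [fset i; j; k; l]%fset -> uniq [:: i; j; k; l] ->
  ordered_tetrahedron K (p i) (p j) (p k) (p l).
Proof.
move=> [kT T4] E Uq; rewrite /ordered_tetrahedron -shadow4 -E (shadow_simplex covering kT) andbT.
rewrite -[[:: _; _; _; _]]/(map p [:: i; j; k; l]) map_inj_in_uniq //.
move=> u v us vs; apply: (Kt_inj covering kT); rewrite E ?inE.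
  by move: us; rewrite !inE !orbA.
by move: vs; rewrite !inE !orbA.
Qed.

(** * Exactness in (dz) + (dg) and in (dy) *)

Let mainP v : p (main v) = v. Proof. by have [H _ _] := family. Qed.
Let from_main_act := from_mainP (deck_transitive cover) mainP.
Local Notation e w := (isotropic (kappa w) (zeta w)).
Local Notation zp := (z_part zeta kappa).
Local Notation hp := (h_part kappa).
Local Notation vz X w := (dz_lie zeta w X).
Local Notation dv := (dvec p act main rho rhog zeta kappa).
Local Notation dr := (drho rhog).
Let dv_act (dh dz : V -> C) dg a w : dv dh dz dg (act a w) = rho a *m dv dh dz dg w + dr dg a *m e w :=
  dvec_act rho_rep rho_regular equivariant (deck1 cover) (deckM cover) (deck_fibre cover)
    (@deck_free _ _ _ _ _ _ _ cover) (deck_transitive cover) mainP dh dz dg a w.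
Let dv_tangent (dh dz : V -> C) dg w : tang w (dv dh dz dg w) :=
  tangent_dvec rho_rep rho_regular equivariant (deck1 cover) (deckM cover) (deck_fibre cover)
    (@deck_free _ _ _ _ _ _ _ cover) (deck_transitive cover) mainP dh dz dg w.
Let dv_main (dh dz : V -> C) dg v : dv dh dz dg (main v) =
    cone_tangent (kappa (main v)) (zeta (main v)) (dh v) (dz v) :=
  dvec_main zeta kappa rho_rep rho_regular (deck1 cover) (deckM cover)
    (@deck_free _ _ _ _ _ _ _ cover) (deck_transitive cover) mainP dh dz dg v.
Let dv_unique dg := dvec_unique rho_rep rho_regular equivariant kappa_neq0 (deck1 cover) (deckM cover) (deck_fibre cover)
    (@deck_free _ _ _ _ _ _ _ cover) (deck_transitive cover) mainP (dg := dg).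
Let dv_z_unique dg u := dvec_z_unique rho_rep rho_regular equivariant kappa_neq0 (deck1 cover) (deckM cover) (deck_fibre cover)
    (@deck_free _ _ _ _ _ _ _ cover) (deck_transitive cover) mainP (dg := dg) (u := u).

Lemma vz_inj i j k X : uniq [:: i; j; k] -> Kt [fset i; j; k]%fset ->
  vz X i = 0 -> vz X j = 0 -> vz X k = 0 -> X = 0.
Proof.
rewrite /= !inE negb_or => /and3P[/andP[ij ik] jk _] kt.
by apply: dz_lie_inj; apply: zeta_edge => //; apply: (pairs_in covering kt); rewrite !inE eqxx ?orbT.
Qed.

Lemma vz_inj_all X : (forall w, vz X w = 0) -> X = 0.
Proof.
have [[w _] _ _] := cover_simply_connected cover.
have [T tT _] := tet_at K_manifold covering w.
by move=> H; apply: (v_tet covering (v := fun X w => vz X w) (@dz_lieB _ _ zeta) vz_inj tT) => x _; rewrite H /dz_lie !mxE !mulr0 addr0 subr0.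
Qed.

Let defect_in_family u c := cocycle_to_family rho_rep rho_regular equivariant kappa_neq0 (deck1 cover) (deckM cover) vz_inj_all (u := u) (c := c).
Let rigid (dh dz : V -> C) dg X := family_rigid rho_rep rho_regular equivariant kappa_neq0 (deck1 cover) (deckM cover) (deck_fibre cover)
    (@deck_free _ _ _ _ _ _ _ cover) (deck_transitive cover) mainP vz_inj_all (dh := dh) (dz := dz) (dg := dg) (X := X).

Lemma act_fset4 a i j k l : [fset act a w | w in [fset i; j; k; l]]%fset = [fset act a i; act a j; act a k; act a l]%fset.
Proof.
apply/fsetP => w; apply/imfsetP/idP => [[u /= us ->]|].
  by move: us; rewrite !inE => /orP[/orP[/orP[]|]|] /eqP ->; rewrite eqxx ?orbT.
by rewrite !inE => /orP[/orP[/orP[]|]|] /eqP ->; [exists i|exists j|exists k|exists l]; rewrite //= !inE eqxx ?orbT.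
Qed.

Lemma act_injective a : injective (act a).
Proof. by move=> w w' E; rewrite -(deck1 cover w) -(deck1 cover w') -(mulVg a) !(deckM cover) E. Qed.

Lemma is_tet_act a T : is_tet T -> is_tet [fset act a w | w in T]%fset.
Proof.
move=> [kT T4]; split; first exact: (deck_simplicial cover).
by rewrite card_imfset //; exact: act_injective.
Qed.

Lemma shadow_act a T : shadow p [fset act a w | w in T]%fset = shadow p T.
Proof.
apply/setP => v; apply/shadowP/shadowP => [[u /imfsetP[u' /= u'T ->]]|[u uT <-]].
  by rewrite (deck_fibre cover) => <-; exists u'.
by exists (act a u); rewrite ?(deck_fibre cover) //; apply/imfsetP; exists u.
Qed.

Lemma uniq_act a i j k l : uniq [:: i; j; k; l] -> uniq [:: act a i; act a j; act a k; act a l].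
Proof. by rewrite -[[:: act a i; _; _; _]]/(map (act a) [:: i; j; k; l]) map_inj_uniq //; exact: act_injective. Qed.

Lemma omega_div_diff_act a u u' X T : (forall w, u' (act a w) = kappa w / kappa (act a w) * u w + vz X (act a w)) ->
  is_tet T -> forall t, [fset act a w | w in T]%fset = tet_fset t ->
  (forall w, w \in T -> ov t (p w) = act a w) ->
  forall i j k l, T = [fset i; j; k; l]%fset -> uniq [:: i; j; k; l] ->
  omega t (p i) (p j) (p k) (p l) * div_diff_tet u' (tet_fset t) =
  (zeta i - zeta j) * (zeta k - zeta l) * div_diff_tet u T.
Proof.
move=> H tT t E Ha i j k l ET Uq; have [iT jT kT lT] := tet_members ET.
have [[ij ik il] [jk jl kl]] := tet_zeta tT ET Uq.
rewrite (div_diff_tetE _ ET Uq) -(div_diff_act rho_rep equivariant kappa_neq0 H ij ik il jk jl kl).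
by rewrite /omega !Ha // (div_diff_tetE _ _ (uniq_act a Uq)) // -E ET act_fset4.
Qed.

Lemma drho_lie dg a : exists X, forall w, dr dg a *m e w = lie X *m e (act a w).
Proof.
have [X EX] := lie_of_so3 (so3_drho rho_rep rho_regular dg a); exists X => w.
by rewrite (drho_e _ rho_rep equivariant) EX.
Qed.

Section Variation.
Variables (dh dz : V -> C) (dg : 'rV[C]_m).
Let u := dz_of zeta kappa (dv dh dz dg).

Lemma dz_act a : exists X, forall w, u (act a w) = kappa w / kappa (act a w) * u w + vz X (act a w).
Proof.
have [X HX] := drho_lie dg a; exists X => w.
rewrite /u /dz_of dv_act z_partD HX z_part_lie // (z_part_rho rho_rep equivariant kappa_neq0) //.
Qed.

Lemma omega_div_diff T t : is_tet T -> shadow p T = val t ->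
  forall i j k l, T = [fset i; j; k; l]%fset -> uniq [:: i; j; k; l] ->
  omega t (p i) (p j) (p k) (p l) * div_diff_tet u (tet_fset t) =
  (zeta i - zeta j) * (zeta k - zeta l) * div_diff_tet u T.
Proof.
move=> tT sT; have [a [E Ha]] := over_tet tT sT; have [X HX] := dz_act a.
exact: (omega_div_diff_act HX).
Qed.
End Variation.

Lemma f2E u t : F2 u t =
  - div_diff_tet (dz_of zeta kappa (dv 0 u.1 u.2)) (tet_fset t).
Proof.
have := tetP t; rewrite /f2 ffunE /tet_fset.
case: (tet t) => [[[w0 w1] w2] w3] [tT Uq _ _ _].
have [[n01 n02 n03] [n12 n13 n23]] := tet_zeta tT erefl Uq.
rewrite (div_diff_tetE _ erefl Uq) /=.
exact: (dln_cross_ratio (family_diff rho_regular) (family_base rho_regular) equivariant kappa_neq0 from_main_act).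
Qed.

(** The third divided difference over ijkl is (f[ijk] - f[ijl]) / zeta_kl, so the
    sum around the edge ij telescopes. *)
Lemma f3_f2 u : F3 (F2 u) = 0.
Proof.
apply/ffunP => ed; rewrite f3E ffunE.
have [_ /(_ ed) He _] := family; case: (edge ed) He => i j /= [kij Eij].
set dy := f2 _ _ _ _ _ _ _ _; pose d := dz_of zeta kappa (dv 0 u.1 u.2).
have pij : p i != p j.
  have E' : val ed = [set p i; p j]%SET := esym Eij.
  by have /andP[_] := valP ed; rewrite E' cards2; case: (p i != p j).
have ij : i != j by apply: contraNneq pij => ->.
have zij := zeta_edge ij kij.
pose d2 k : C := d i / ((zeta i - zeta j) * (zeta i - zeta k)) + d j / ((zeta j - zeta i) * (zeta j - zeta k))
   + d k / ((zeta k - zeta i) * (zeta k - zeta j)).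
pose F k := - (zeta i - zeta j) * d2 (lift_at Kt p i k).
rewrite /star_sum (eq_bigr (fun kl => F kl.1 - F kl.2)).
  by rewrite sumrB (sum_pos_tet_fst F) (sum_pos_tet_snd F) subrr.
move=> [k l] /= ps; have /andP[/andP[Up sK] _] := ps.
have [k1 pj pk pl] := @lift_at4 _ _ _ _ _ covering i (p j) k l sK.
rewrite (lift_at_p covering kij) in k1 pj.
rewrite /F; move: (lift_at Kt p i k) (lift_at Kt p i l) k1 pk pl => k' l' kT pk pl.
have Uq : uniq [:: i; j; k'; l'] by have := Up; rewrite -pk -pl -[[:: p i; _; _; _]]/(map p [:: i; j; k'; l']) => /map_uniq.
have tT : is_tet [fset i; j; k'; l']%fset.
  split=> //; have [_ <-] := covering.2.1 _ kT; rewrite shadow4 pk pl.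
  by apply/eqP; rewrite set4_uniq.
have [t Et] := tet_of tT; rewrite (@cornerE _ t); last by rewrite Et shadow4 pk pl.
rewrite /dy f2E -/d mulrN -pk -pl (omega_div_diff _ _ _ tT (esym Et) erefl Uq) -/d.
rewrite (div_diff_tetE _ erefl Uq) /div_diff /d2.
have [[_ zik zil] [zjk zjl zkl]] := tet_zeta tT erefl Uq.
have zki := subr_neq0_sym zik.
have zkj := subr_neq0_sym zjk.
have zli := subr_neq0_sym zil.
have zlj := subr_neq0_sym zjl.
have zlk := subr_neq0_sym zkl.
have zji := subr_neq0_sym zij.
move: (d i) (d j) (d k') (d l') => di dj dk dl.
by field; rewrite zij zik zil zjk zjl zkl zji zki zli zkj zlj zlk.
Qed.

(** Given dy in the kernel of f3, with values Y on the tetrahedra of the cover, the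
    problem is to find u on the cover with divided differences - Y. *)
Section ZSide.
Variable dy : {ffun tetrahedra K -> C}.
Hypothesis dy_closed : F3 dy = 0.
Variable Y : {fset W} -> C.
Hypothesis HY : forall T, is_tet T -> forall t, shadow p T = val t ->
  forall i j k l, T = [fset i; j; k; l]%fset -> uniq [:: i; j; k; l] ->
    omega t (p i) (p j) (p k) (p l) * dy t = (zeta i - zeta j) * (zeta k - zeta l) * Y T.

Definition prescribed T (u : W -> C) := div_diff_tet u T = - Y T.

(** Take u vanishing at i and j: the divided difference over ijkl only involves
    u k / ((zeta_k - zeta_i) (zeta_k - zeta_j)) and the same for l, and has to be
    their difference divided by zeta_kl.  The potential la of dy around the edge
    provides these numbers. *)
Lemma prescribed_edge_solution i j : i != j -> Kt [fset i; j]%fset ->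
  exists u, forall T, is_tet T -> i \in T -> j \in T -> prescribed T u.
Proof.
move=> ij kij.
have pij : p i != p j.
  by apply: contra ij => /eqP E; apply/eqP; apply: (Kt_inj covering kij _ _ E); rewrite !inE eqxx ?orbT.
have eK : [set p i; p j]%SET \in K by rewrite -shadow2; exact: (shadow_simplex covering kij).
have [la Hla] := edge_potential pij (star_sum_eq0 dy_closed pij eK).
have zij := zeta_edge ij kij.
exists (fun k => - ((zeta k - zeta i) * (zeta k - zeta j) * la (p k) / (zeta i - zeta j))) => T tT iT jT.
have [k [l [E Uq]]] := tet_complete2 tT ij iT jT.
wlog ps : k l E Uq / pos_tet K pos (p i) (p j) (p k) (p l).
  have T4 := tet_ordered tT E Uq.
  have [ps|ps] := boolP (pos (p i) (p j) (p k) (p l)) => W0; first by apply: (W0 k l) => //; rewrite /pos_tet T4.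
  apply: (W0 l k); first by rewrite fset_swap34.
    by move: Uq; rewrite /= !inE !negb_or (eq_sym l k) => /and4P[/and3P[-> -> ->] /andP[-> ->] -> _].
  by rewrite /pos_tet ordered_tetrahedron_swap34 T4 (pos_swap34 K_oriented).
have [t Et] := tet_of tT.
have := Hla _ _ ps; rewrite (@cornerE _ t); last by rewrite Et E shadow4.
rewrite (HY tT (esym Et) E Uq) => Hl.
rewrite /prescribed (div_diff_tetE _ E Uq) /div_diff.
have [[_ zik zil] [zjk zjl zkl]] := tet_zeta tT E Uq.
have zki := subr_neq0_sym zik.
have zkj := subr_neq0_sym zjk.
have zli := subr_neq0_sym zil.
have zlj := subr_neq0_sym zjl.
have zlk := subr_neq0_sym zkl.
have zji := subr_neq0_sym zij.
have -> : Y T = (la (p k) - la (p l)) / ((zeta i - zeta j) * (zeta k - zeta l)).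
  by rewrite Hl; field; rewrite zij zkl.
by field; rewrite zij zik zil zjk zjl zkl zji zki zli zkj zlj zlk.
Qed.

Lemma prescribed_torsor T u u' : is_tet T -> prescribed T u -> prescribed T u' ->
  exists X, forall w, w \in T -> u' w = u w + vz X w.
Proof.
move=> tT; rewrite /prescribed; have [i [j [k [l [E Uq [zij zik zil] [zjk zjl zkl]]]]]] := tet_frame tT.
rewrite !(div_diff_tetE _ E Uq) => H H'.
have [|X [Xi Xj Xk Xl]] := @div_diff0 _ _ zeta (fun w => u' w - u w) i j k l zij zik zil zjk zjl zkl.
  by rewrite -(subrr (- Y T)) -{1}H' -H /div_diff; ring.
exists X => w; rewrite E !inE => /orP[/orP[/orP[]|]|] /eqP ->; rewrite -?Xi -?Xj -?Xk -?Xl;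
  by rewrite addrC subrK.
Qed.

Lemma prescribed_shift T u u' X : is_tet T -> prescribed T u ->
  (forall w, w \in T -> u' w = u w + vz X w) -> prescribed T u'.
Proof.
move=> tT; rewrite /prescribed; have [i [j [k [l [E Uq [zij zik zil] [zjk zjl zkl]]]]]] := tet_frame tT.
rewrite !(div_diff_tetE _ E Uq) => <- H; have [iT' jT kT lT] := tet_members E.
rewrite -[RHS]addr0 -(div_diff_lie X zij zik zil zjk zjl zkl) /div_diff !H //.
by ring.
Qed.

Lemma prescribed_solution : exists u, forall T, is_tet T -> prescribed T u.
Proof.
exact: (gluing K_manifold covering (cover_simply_connected cover) (@dz_lieB _ _ zeta) vz_inj
  prescribed_torsor prescribed_shift prescribed_edge_solution).
Qed.

(** Translation by a of functions that transform as dz does. *)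
Definition push a (u : W -> C) w : C := kappa (act a^-1%g w) / kappa w * u (act a^-1%g w).

Lemma actK a w : act a^-1%g (act a w) = w.
Proof. by rewrite -(deckM cover) mulVg (deck1 cover). Qed.
Lemma actVK a w : act a (act a^-1%g w) = w.
Proof. by rewrite -(deckM cover) mulgV (deck1 cover). Qed.

Lemma dz_lie0 w : vz 0 w = 0.
Proof. by rewrite /dz_lie !mxE; ring. Qed.

Lemma push_act a u w : push a u (act a w) = kappa w / kappa (act a w) * u w + vz 0 (act a w).
Proof. by rewrite /push actK dz_lie0 addr0. Qed.

Lemma prescribed_push a u : (forall T, is_tet T -> prescribed T u) ->
  forall T, is_tet T -> prescribed T (push a u).
Proof.
move=> Hu T tT; pose T' := [fset act a^-1%g w | w in T]%fset.
have tT' : is_tet T' by exact: is_tet_act.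
have [i [j [k [l [E Uq [zij zik zil] [zjk zjl zkl]]]]]] := tet_frame tT'.
have ET : T = [fset act a i; act a j; act a k; act a l]%fset.
  rewrite -act_fset4 -E; apply/fsetP => w; apply/idP/imfsetP => [wT|[u' /imfsetP[u'' /= uT ->] ->]].
    by exists (act a^-1%g w); rewrite ?actVK //; apply/imfsetP; exists w.
  by rewrite actVK.
have Uq' := uniq_act a Uq; have [[n1 _ _] [_ _ n2]] := tet_zeta tT ET Uq'.
have := div_diff_act rho_rep equivariant kappa_neq0 (push_act a u) zij zik zil zjk zjl zkl.
have := Hu _ tT'; rewrite /prescribed (div_diff_tetE _ E Uq) => ->.
have [t Et] := tet_of tT.
have sT' : shadow p T' = val t by rewrite shadow_act.
rewrite mulrN -(HY tT' sT' E Uq) (div_diff_tetE _ ET Uq').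
have := HY tT (esym Et) ET Uq'; rewrite !(deck_fibre cover) => ->.
move=> H; apply: (mulfI (mulf_neq0 n1 n2)); rewrite H; ring.
Qed.

(** The solution u on the cover and its translates by a differ by fields c a;
    after subtraction of the infinitesimal conjugation X found by regularity, u is
    the dz of a variation in the direction dg. *)
Lemma f2_onto : exists u, F2 u = dy.
Proof.
have [u Hu] := prescribed_solution.
have /choice[c Hc] : forall a, exists X, forall w, u w - push a u w = vz X w.
  move=> a; apply: (rigidity K_manifold covering (cover_simply_connected cover) (@dz_lieB _ _ zeta) vz_inj) => T tT.
  have [X HX] := prescribed_torsor tT (prescribed_push a Hu tT) (Hu _ tT).
  by exists X => w wT; rewrite HX // addrAC subrr add0r.
have Hca a w : u (act a w) = kappa w / kappa (act a w) * u w + vz (c a) (act a w).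
  have := push_act a u w; rewrite dz_lie0 addr0 => <-.
  by rewrite -Hc addrC subrK.
have [dg [X HX]] := defect_in_family Hca.
pose u1 w := u w - vz X w.
have u1_act a w : u1 (act a w) = kappa w / kappa (act a w) * u1 w + zp (act a w) (dr dg a *m e w).
  have := congr1 (fun M => zp (act a w) (M *m e w)) (HX a).
  rewrite /= (mulmxDl (dr dg a)) mulmxBl z_partD z_partD z_partN -!mulmxA -equivariant !z_part_lie //.
  rewrite (z_part_rho rho_rep equivariant kappa_neq0) ?z_part_lie //; last exact: tangent_lie.
  by rewrite /u1 Hca => ->; ring.
exists ([ffun v => u1 (main v)], dg); apply/ffunP => t; rewrite f2E /=.
have -> : dz_of zeta kappa (dv 0 [ffun v => u1 (main v)] dg) = u1.
  apply/funext => w; rewrite /dz_of (dv_z_unique 0 u1_act).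
  by congr (zp w (dv 0 _ dg w)); apply/funext => v; rewrite ffunE.
have [tT sT] := tet_fsetP t.
have : prescribed (tet_fset t) u1.
  apply: (prescribed_shift (X := - X) tT (Hu _ tT)) => w _.
  by rewrite /u1 /dz_lie !mxE; ring.
rewrite /prescribed => ->; rewrite opprK.
have := over_in (t := t); have := tetP t; have := HY tT sT.
rewrite /tet_fset; case: (tet t) => [[[w0 w1] w2] w3] H [tT' Uq _ _ _] ov_in.
have := H _ _ _ _ erefl Uq; rewrite /omega !ov_in ?inE ?eqxx ?orbT //.
have [[zij _ _] [_ _ zkl]] := tet_zeta tT' erefl Uq.
by move=> /(mulfI (mulf_neq0 zij zkl)).
Qed.
End ZSide.

Lemma exact_f2_f3 : exact_at F2 F3.
Proof.
move=> dy; split=> [H|[u <-]]; last exact: f3_f2.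
have /choice[Y HY] := lift_dy dy.
exact: (f2_onto H HY).
Qed.

Lemma centralizer_act X a w : X \in centralizer rho ->
  vz X (act a w) = kappa w / kappa (act a w) * vz X w.
Proof.
rewrite unfold_in => /asboolP H; rewrite -(z_part_lie zeta kappa_neq0 X (act a w)) equivariant mulmxA H -mulmxA.
by rewrite (z_part_rho rho_rep equivariant kappa_neq0) ?z_part_lie //; exact: tangent_lie.
Qed.

(** The field of an X that commutes with rho is equivariant, so it vanishes if it
    does on the main vertices. *)
Lemma f1_eq0 (X : psl rho) : F1 X = 0 <-> X = 0.
Proof.
split=> [[/ffunP H]|->]; last first.
  congr (_, _); apply/ffunP => v; rewrite !ffunE /dz_lie.
  by rewrite [psl_val _](_ : _ = 0) // !mxE !mulr0 addr0 subr0.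
have Xc : psl_val X \in centralizer rho := valP X.
apply: val_inj => /=.
apply: vz_inj_all => w; rewrite -(from_main_act w) centralizer_act //.
by have := H (p w); rewrite !ffunE => ->; rewrite mulr0.
Qed.

(** If the divided differences of dz vanish, dz is on each tetrahedron a field of the
    Lie algebra, by rigidity a single one, and [family_rigid] applies. *)
Lemma exact_f1_f2 : exact_at F1 F2.
Proof.
move=> [dz dg]; split=> [/ffunP H|[X <-]]; last first.
  apply/ffunP => t; rewrite f2E ffunE /=.
  have X_act a w : vz X (act a w) = kappa w / kappa (act a w) * vz X w + zp (act a w) (dr 0 a *m e w).
    rewrite (drho0 (family_diff rho_regular)) mul0mx centralizer_act; last exact: valP.
    by rewrite /z_part !mxE mulr0 subrr mul0r addr0.
  have -> : dz_of zeta kappa (dv 0 [ffun v => vz X (main v)] 0) = (fun w => vz X w).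
    apply/funext => w; rewrite /dz_of (dv_z_unique 0 X_act w).
    by congr (zp w (dv 0 _ 0 w)); apply/funext => v; rewrite ffunE.
  have [tT _] := tet_fsetP t; have [i [j [k [l [E Uq [zij zik zil] [zjk zjl zkl]]]]]] := tet_frame tT.
  by rewrite (div_diff_tetE _ E Uq) div_diff_lie // oppr0.
pose d := dz_of zeta kappa (dv 0 dz dg).
have [X HX] : exists X, forall w, d w = vz X w.
  apply: (rigidity K_manifold covering (cover_simply_connected cover) (@dz_lieB _ _ zeta) vz_inj) => T tT.
  have [t Et] := tet_of tT; have [i [j [k [l [E Uq [zij zik zil] [zjk zjl zkl]]]]]] := tet_frame tT.
  have := omega_div_diff 0 dz dg tT (esym Et) E Uq.
  have := H t; rewrite f2E ffunE => /eqP; rewrite oppr_eq0 => /eqP ->; rewrite mulr0 => /esym/eqP.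
  rewrite mulf_eq0 (negPf (mulf_neq0 zij zkl)) /= (div_diff_tetE _ E Uq) => /eqP/div_diff0[]//.
  move=> X [Xi Xj Xk Xl]; exists X => w; rewrite E !inE.
  by move=> /orP[/orP[/orP[]|]|] /eqP ->.
have [dg0 Xc] := rigid HX; exists (Psl Xc); rewrite /f1 dg0; congr (_, _).
apply/ffunP => v; rewrite ffunE /= -HX /d /dz_of dv_main z_part_cone //.
Qed.

(** * Variations of lengths *)

(** Four isotropic vectors of a three-dimensional space have a vanishing Gram
    determinant, which factors into linear terms in the square roots zeta_ij zeta_kl
    of the products of opposite scalar products: this is the derivative of the
    resulting Ptolemy relation. *)
Lemma lengths_tetrahedron (al be : W -> C) i j k l :
  let L (x y : W) := al x + al y + (be x - be y) / (zeta x - zeta y) in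
  zeta i - zeta j != 0 -> zeta i - zeta k != 0 -> zeta i - zeta l != 0 ->
  zeta j - zeta k != 0 -> zeta j - zeta l != 0 -> zeta k - zeta l != 0 ->
  (zeta i - zeta j) * (zeta k - zeta l) * (L i j + L k l) +
  (zeta i - zeta k) * (zeta l - zeta j) * (L i k + L l j) +
  (zeta i - zeta l) * (zeta j - zeta k) * (L i l + L j k) = 0.
Proof.
move=> L zij zik zil zjk zjl zkl; rewrite /L.
have zlj := subr_neq0_sym zjl.
by field; rewrite zij zik zil zjk zkl zlj.
Qed.

(** Subtracting the field of an X that interpolates be in i, j, k leaves al alone on
    that triangle, where the three lengths kill it; then the lengths il and jl are two
    independent equations for the vertex l. *)
Lemma lengths_rigid (al be : W -> C) i j k l :
  let L (x y : W) := al x + al y + (be x - be y) / (zeta x - zeta y) in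
  zeta i - zeta j != 0 -> zeta i - zeta k != 0 -> zeta i - zeta l != 0 ->
  zeta j - zeta k != 0 -> zeta j - zeta l != 0 ->
  L i j = 0 -> L i k = 0 -> L j k = 0 -> L i l = 0 -> L j l = 0 ->
  exists X, forall w, w \in [fset i; j; k; l]%fset ->
    be w = vz X w /\ al w = - X 0 0 + zeta w * X 0 2.
Proof.
move=> L zij zik zil zjk zjl Lij Lik Ljk Lil Ljl.
have [X [Xi Xj Xk]] := interpolation be zij zik zjk; exists X.
pose al' w := al w - (- X 0 0 + zeta w * X 0 2).
pose be' w := be w - vz X w.
have L' (x y : W) : zeta x - zeta y != 0 -> L x y = 0 -> al' x + al' y + (be' x - be' y) / (zeta x - zeta y) = 0.
  by move=> xy; rewrite /L => <-; rewrite /al' /be' /dz_lie; field.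
have bi : be' i = 0 by rewrite /be' Xi subrr.
have bj : be' j = 0 by rewrite /be' Xj subrr.
have bk : be' k = 0 by rewrite /be' Xk subrr.
have := L' _ _ zij Lij; rewrite bi bj subrr mul0r addr0 => aij.
have := L' _ _ zik Lik; rewrite bi bk subrr mul0r addr0 => aik.
have := L' _ _ zjk Ljk; rewrite bj bk subrr mul0r addr0 => ajk.
have ai : al' i = 0.
  have : (al' i + al' j) + (al' i + al' k) - (al' j + al' k) = 0 by rewrite aij aik ajk subr0 addr0.
  by move=> H; apply: (lin_solve (k := 2^-1) H); field.
have aj : al' j = 0 by move: aij; rewrite ai add0r.
have ak : al' k = 0 by move: aik; rewrite ai add0r.
have := L' _ _ zil Lil; rewrite ai bi add0r sub0r => Hi.
have := L' _ _ zjl Ljl; rewrite aj bj add0r sub0r => Hj.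
have bl : be' l = 0.
  have : (al' l + - be' l / (zeta i - zeta l)) - (al' l + - be' l / (zeta j - zeta l)) = 0 by rewrite Hi Hj subrr.
  move=> H; apply: (lin_solve (k := (zeta i - zeta l) * (zeta j - zeta l) / (zeta i - zeta j)) H).
  by field; rewrite zij zil zjl.
have al0 : al' l = 0 by move: Hi; rewrite bl oppr0 mul0r addr0.
move=> w; rewrite !inE => /orP[/orP[/orP[]|]|] /eqP ->; split; apply/eqP; rewrite -subr_eq0; apply/eqP; assumption.
Qed.

Lemma bilDl (s s' t : 'cV[C]_3) : bil (s + s') t = bil s t + bil s' t :> C.
Proof. by rewrite !bilE !mxE; ring. Qed.
Lemma bilDr (s t t' : 'cV[C]_3) : bil s (t + t') = bil s t + bil s t' :> C.
Proof. by rewrite ![bil s _]bilC bilDl. Qed.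

(** Scalar products are invariant under rho a and do not vary along so(3). *)
Lemma length_diff_act (t t' : W -> 'cV[C]_3) a M i j : so3 M ->
  (forall w, tang w (t w)) -> zeta i - zeta j != 0 ->
  zeta (act a i) - zeta (act a j) != 0 ->
  (forall w, t' (act a w) = rho a *m t w + M *m e (act a w)) ->
  ldiff t' (act a i) (act a j) = ldiff t i j.
Proof.
move=> HM Ht zij zaij Ht'.
have tt w : tang (act a w) (t' (act a w)).
  rewrite Ht'; apply: tangentD; first exact: (tangent_rho rho_rep equivariant).
  exact: tangent_so3.
rewrite (length_diff_bil kappa_neq0 zaij) // (length_diff_bil kappa_neq0 zij) //.
rewrite (bil_act rho_rep equivariant) !Ht' bilDl bilDr addrACA bil_so3 // addr0.
by rewrite !equivariant !bil_SO3 //; exact: rho_rep.1.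
Qed.

Lemma length_diffC (t : W -> 'cV[C]_3) i j : ldiff t i j = ldiff t j i.
Proof.
by rewrite /length_diff [dh_of _ _ _ + _]addrC -[in RHS]opprB -[in LHS](opprB (zeta j)) invrN mulrN mulNr.
Qed.

Lemma lie_isotropicB X Y w : lie (X - Y) *m e w = lie X *m e w - lie Y *m e w.
Proof.
have := lie_linear (-1) Y X; rewrite !scaleN1r addrC => ->.
by rewrite mulmxDl mulNmx addrC.
Qed.

Lemma lie_isotropic_inj i j k X : uniq [:: i; j; k] -> Kt [fset i; j; k]%fset ->
  lie X *m e i = 0 -> lie X *m e j = 0 -> lie X *m e k = 0 -> X = 0.
Proof.
have z0 w : lie X *m e w = 0 -> vz X w = 0.
  by move=> H; rewrite -(z_part_lie zeta kappa_neq0) H /z_part !mxE mulr0 subrr mul0r.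
by move=> Uq k3 /z0 Hi /z0 Hj /z0 Hk; exact: (vz_inj Uq k3).
Qed.

Lemma tangent_lieP w s X : tang w s -> zp w s = vz X w ->
  hp w s = - X 0 0 + zeta w * X 0 2 -> s = lie X *m e w.
Proof. by move=> /(tangentE kappa_neq0) -> Hz Hh; rewrite lie_isotropic -Hz -Hh z_part_cone // h_part_cone. Qed.

Lemma length_diff_lie X i j : zeta i - zeta j != 0 -> ldiff (fun w => lie X *m e w) i j = 0.
Proof.
by move=> zij; rewrite /length_diff /dh_of /dz_of !z_part_lie // !h_part_lie // /dz_lie; field.
Qed.

Lemma length_diffD (t t' : W -> 'cV[C]_3) i j : ldiff (t + t') i j = ldiff t i j + ldiff t' i j.
Proof. by have := length_diff_linear zeta kappa i j 1 t t'; rewrite scale1r mul1r. Qed.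

(** Given functions Phi on the edges that satisfy the relation on each tetrahedron,
    the problem is to find tangent vectors that vary the lengths by Phi. *)
Section LengthSide.
Variable Phi : V -> V -> C.
Hypothesis PhiC : forall x y, Phi x y = Phi y x.

Definition prescribed_lengths T (t : W -> 'cV[C]_3) :=
  (forall w, w \in T -> tang w (t w)) /\
  (forall i j, i \in T -> j \in T -> i != j -> ldiff t i j = Phi (p i) (p j)).

Lemma lengths_torsor T (t t' : W -> 'cV[C]_3) : is_tet T -> prescribed_lengths T t -> prescribed_lengths T t' ->
  exists X, forall w, w \in T -> t' w = t w + lie X *m e w.
Proof.
move=> tT [tt Lt] [tt' Lt']; have [i [j [k [l [E Uq [zij zik zil] [zjk zjl zkl]]]]]] := tet_frame tT.
have [iT jT kT lT] := tet_members E.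
pose s := t' - t.
have L0 (x y : W) : x \in T -> y \in T -> x != y -> ldiff s x y = 0.
  move=> xT yT xy; apply: (addIr (ldiff t x y)); rewrite -length_diffD add0r.
  by rewrite /s subrK Lt // Lt'.
have n (x y : W) : zeta x - zeta y != 0 -> x != y by apply: contraNneq => ->; rewrite subrr.
have [|||||X HX] := @lengths_rigid (dh_of kappa s) (dz_of zeta kappa s) i j k l zij zik zil zjk zjl;
  try (by apply: L0 => //; apply: n).
exists X => w wT; have [|Hz Hh] := HX w; first by rewrite -E.
have -> : t' w = t w + s w by rewrite -[s w]/(t' w - t w) addrC subrK.
congr (_ + _); apply: tangent_lieP => //.
by rewrite -[s w]/(t' w - t w); apply: tangentD; [exact: tt'|apply: tangentN; exact: tt].
Qed.

Lemma lengths_shift T (t t' : W -> 'cV[C]_3) X : is_tet T -> prescribed_lengths T t ->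
  (forall w, w \in T -> t' w = t w + lie X *m e w) -> prescribed_lengths T t'.
Proof.
move=> tT [tt Lt] H; split=> [w wT|i j iT jT ij].
  by rewrite H //; apply: tangentD; [exact: tt|exact: tangent_lie].
rewrite -Lt //; have := length_diffD t (fun w => lie X *m e w) i j.
rewrite length_diff_lie ?(tet_zeta_neq tT) // addr0 => <-.
by rewrite /length_diff /dh_of /dz_of !H.
Qed.

Hypothesis Phi_rel : forall T i j k l, is_tet T -> T = [fset i; j; k; l]%fset -> uniq [:: i; j; k; l] ->
  (zeta i - zeta j) * (zeta k - zeta l) * (Phi (p i) (p j) + Phi (p k) (p l)) +
  (zeta i - zeta k) * (zeta l - zeta j) * (Phi (p i) (p k) + Phi (p l) (p j)) +
  (zeta i - zeta l) * (zeta j - zeta k) * (Phi (p i) (p l) + Phi (p j) (p k)) = 0.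

Lemma lengths_edge_solution i j : i != j -> Kt [fset i; j]%fset ->
  exists t : W -> 'cV[C]_3, forall T, is_tet T -> i \in T -> j \in T -> prescribed_lengths T t.
Proof.
move=> ij kij; have zij := zeta_edge ij kij.
(* Motions in so(3) allow al j = be i = be j = 0.  Then the length ij gives al i,
   and the lengths iw and jw are two linear equations for al w and be w.  The
   length kl follows from the relation on the tetrahedron. *)
pose r w := Phi (p i) (p w) - Phi (p i) (p j) - Phi (p j) (p w).
pose al w := if w == i then Phi (p i) (p j) else if w == j then 0 else
   Phi (p j) (p w) - r w * (zeta w - zeta i) / (zeta i - zeta j).
pose be w := if w == i then 0 else if w == j then 0 else
   r w * (zeta w - zeta i) * (zeta w - zeta j) / (zeta i - zeta j).
pose t w := cone_tangent (kappa w) (zeta w) (2 * kappa w * al w) (be w).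
exists t => T tT iT jT; split=> [w _|]; first exact: tangent_cone.
have Lt (x y : W) : ldiff t x y = al x + al y + (be x - be y) / (zeta x - zeta y).
  by rewrite /length_diff /dh_of /dz_of /t !z_part_cone // !h_part_cone.
have [k [l [E Uq]]] := tet_complete2 tT ij iT jT.
have [[_ zik zil] [zjk zjl zkl]] := tet_zeta tT E Uq.
have zki := subr_neq0_sym zik.
have zkj := subr_neq0_sym zjk.
have zli := subr_neq0_sym zil.
have zlj := subr_neq0_sym zjl.
have zlk := subr_neq0_sym zkl.
have := Uq; rewrite /= !inE !negb_or => /and4P[/and3P[_ nik nil] /andP[njk njl] nkl _].
have ai : al i = Phi (p i) (p j) by rewrite /al eqxx.
have bi : be i = 0 by rewrite /be eqxx.
have aj : al j = 0 by rewrite /al eq_sym (negPf ij) eqxx.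
have bj : be j = 0 by rewrite /be eqxx; case: ifP.
have aw w : i != w -> j != w -> al w = Phi (p j) (p w) - r w * (zeta w - zeta i) / (zeta i - zeta j).
  by rewrite /al !(eq_sym w) => /negPf -> /negPf ->.
have bw w : i != w -> j != w -> be w = r w * (zeta w - zeta i) * (zeta w - zeta j) / (zeta i - zeta j).
  by rewrite /be !(eq_sym w) => /negPf -> /negPf ->.
have Lij : ldiff t i j = Phi (p i) (p j).
  by rewrite Lt ai aj bi bj subrr mul0r !addr0.
have Liw w : i != w -> j != w -> zeta i - zeta w != 0 -> ldiff t i w = Phi (p i) (p w).
  by move=> n1 n2 n3; rewrite Lt ai bi aw // bw // /r; field; rewrite n3 zij.
have Ljw w : i != w -> j != w -> zeta j - zeta w != 0 -> ldiff t j w = Phi (p j) (p w).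
  by move=> n1 n2 n3; rewrite Lt aj bj aw // bw // /r; field; rewrite n3 zij.
have Lik := Liw _ nik njk zik; have Lil := Liw _ nil njl zil.
have Ljk := Ljw _ nik njk zjk; have Ljl := Ljw _ nil njl zjl.
have Lkl : ldiff t k l = Phi (p k) (p l).
  have := lengths_tetrahedron al be zij zik zil zjk zjl zkl; rewrite /= -!Lt.
  rewrite -(Phi_rel tT E Uq) Lij Lik Lil Ljk [length_diff _ _ _ l j]length_diffC Ljl (PhiC (p l) (p j)).
  by move=> /addIr/addIr/(mulfI (mulf_neq0 zij zkl))/addrI.
move=> x y; rewrite E !inE.
move=> /orP[/orP[/orP[]|]|] /eqP -> /orP[/orP[/orP[]|]|] /eqP ->; rewrite ?eqxx // => _;
  by rewrite ?Lij ?Lik ?Lil ?Ljk ?Ljl ?Lkl // length_diffC PhiC ?Lij ?Lik ?Lil ?Ljk ?Ljl ?Lkl.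
Qed.

Lemma lengths_solution : exists t : W -> 'cV[C]_3, forall T, is_tet T -> prescribed_lengths T t.
Proof.
exact: (gluing K_manifold covering (cover_simply_connected cover) lie_isotropicB lie_isotropic_inj
  lengths_torsor lengths_shift lengths_edge_solution).
Qed.

Lemma lengths_push a (t : W -> 'cV[C]_3) : (forall T, is_tet T -> prescribed_lengths T t) ->
  forall T, is_tet T -> prescribed_lengths T (fun w => rho a *m t (act a^-1%g w)).
Proof.
move=> Ht T tT; pose T' := [fset act a^-1%g w | w in T]%fset.
have tT' : is_tet T' by exact: is_tet_act.
have inT' w : w \in T -> act a^-1%g w \in T' by move=> wT; apply/imfsetP; exists w.
have t_tangent w : tang w (t w).
  have [S tS wS] := tet_at K_manifold covering w; exact: (Ht S tS).1.
split=> [w wT|i j iT jT ij].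
  by rewrite -[w in tangent _ _ w](actVK a); apply: (tangent_rho rho_rep equivariant).
have ij' : act a^-1%g i != act a^-1%g j by rewrite (inj_eq (@act_injective _)).
rewrite -(deck_fibre cover a^-1%g i) -(deck_fibre cover a^-1%g j) -(Ht _ tT').2 ?inT' //.
rewrite -[in LHS](actVK a i) -[in LHS](actVK a j).
apply: (@length_diff_act _ _ a 0) => //.
- by rewrite /so3 trmx0 mul0mx mulmx0 addr0.
- by apply: (tet_zeta_neq tT'); rewrite ?inT'.
- by rewrite !actVK; apply: (tet_zeta_neq tT).
by move=> w; rewrite actK mul0mx addr0.
Qed.

(** As for dz, the solution on the cover is corrected by the motion X that regularity
    associates to its defect of equivariance. *)
Lemma lengths_variation : exists (al be : V -> C) (dg : 'rV[C]_m), forall i j, i != j -> Kt [fset i; j]%fset ->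
  ldiff (dv (fun v => 2 * kappa (main v) * al v) be dg) i j = Phi (p i) (p j).
Proof.
have [t Ht] := lengths_solution.
have t_tangent w : tang w (t w).
  have [S tS wS] := tet_at K_manifold covering w; exact: (Ht S tS).1.
have /choice[c Hc] : forall a, exists X, forall w, t w - rho a *m t (act a^-1%g w) = lie X *m e w.
  move=> a; apply: (rigidity K_manifold covering (cover_simply_connected cover) lie_isotropicB lie_isotropic_inj) => T tT.
  have [X HX] := lengths_torsor tT (lengths_push a Ht tT) (Ht _ tT).
  by exists X => w wT; rewrite HX // addrAC subrr add0r.
have Hca a w : t (act a w) = rho a *m t w + lie (c a) *m e (act a w).
  by rewrite -Hc actK addrC subrK.
have [|dg [X HX]] := @defect_in_family (fun w => zp w (t w)) c.
  by move=> a w; rewrite Hca z_partD z_part_lie // (z_part_rho rho_rep equivariant kappa_neq0).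
pose t1 w := t w - lie X *m e w.
have t1_act a w : t1 (act a w) = rho a *m t1 w + dr dg a *m e w.
  have := congr1 (fun M => M *m e w) (HX a).
  rewrite /= (mulmxDl (dr dg a)) mulmxBl -!mulmxA -equivariant => E.
  rewrite /t1 Hca mulmxBr E; apply: (addIr (lie X *m e (act a w))); rewrite subrK.
  by rewrite -!addrA; congr (_ + _); rewrite [RHS]addrC -addrA.
have t1_tangent w : tang w (t1 w).
  by apply: tangentD => //; apply: tangentN; exact: tangent_lie.
have Et := dv_unique t1_act (fun v => t1_tangent (main v)).
exists (fun v => hp (main v) (t1 (main v))), (fun v => zp (main v) (t1 (main v))), dg => i j ij kij.
rewrite -Et; have [T [tT sT]] := tet_around K_manifold covering kij (fset21 i j).
have [iT jT] : i \in T /\ j \in T by split; apply: (fsubsetP sT); rewrite !inE eqxx ?orbT.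
apply: (lengths_shift (X := - X) tT (Ht _ tT) _).2 => // w _.
by rewrite /t1; congr (_ + _); have := lie_isotropicB 0 X w; rewrite sub0r /lie !mxE !scale0r !addr0 mul0mx sub0r.
Qed.
End LengthSide.

Lemma g2E (u : space_abg C V m) ed : G2 u ed =
  ldiff (dv (fun v => 2 * kappa (main v) * u.1.1 v) u.1.2 u.2) (edge ed).1 (edge ed).2.
Proof.
have [_ /(_ ed) He _] := family; rewrite /g2 ffunE; case: (edge ed) He => i j /= [kij Eij].
have pij : p i != p j.
  have E' : val ed = [set p i; p j]%SET := esym Eij.
  by have /andP[_] := valP ed; rewrite E' cards2; case: (p i != p j).
have ij : i != j by apply: contraNneq pij => ->.
apply: (d_phi_star (family_diff rho_regular) (family_base rho_regular) equivariant kappa_neq0 from_main_act).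
exact: zeta_edge.
Qed.

Lemma edgeP ed : [/\ (edge ed).1 != (edge ed).2, Kt [fset (edge ed).1; (edge ed).2]%fset,
  val ed = [set p (edge ed).1; p (edge ed).2]%SET & p (edge ed).1 != p (edge ed).2].
Proof.
have [_ /(_ ed) He _] := family; case: (edge ed) He => i j /= [kij Eij].
have E' : val ed = [set p i; p j]%SET := esym Eij.
have pij : p i != p j.
  by have /andP[_] := valP ed; rewrite E' cards2; case: (p i != p j).
by split=> //; apply: contraNneq pij => ->.
Qed.

Lemma length_diff_dv_act (dh dz : V -> C) dg a i j : i != j -> Kt [fset i; j]%fset ->
  ldiff (dv dh dz dg) (act a i) (act a j) = ldiff (dv dh dz dg) i j.
Proof.
move=> ij kij; have [T [tT sT]] := tet_around K_manifold covering kij (fset21 i j).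
have [iT jT] : i \in T /\ j \in T by split; apply: (fsubsetP sT); rewrite !inE eqxx ?orbT.
apply: (@length_diff_act _ _ a (dr dg a *m invmx (rho a))).
- exact: so3_drho rho_rep rho_regular dg a.
- by move=> w; exact: dv_tangent.
- exact: (tet_zeta_neq tT).
- apply: (tet_zeta_neq (is_tet_act a tT)); rewrite ?(inj_eq (@act_injective _)) //; apply/imfsetP.
    by exists i.
  by exists j.
by move=> w; rewrite dv_act (drho_e _ rho_rep equivariant).
Qed.

Lemma act_edge a i j i' j' : Kt [fset i; j]%fset -> Kt [fset i'; j']%fset ->
  act a i = i' -> p j = p j' -> act a j = j'.
Proof.
move=> kij kij' ai pj; apply: (neighbour_unique covering (w := i')) => //; last by rewrite (deck_fibre cover).
have := deck_simplicial cover a kij.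
by congr Kt; rewrite -ai; apply/fsetP => w; apply/imfsetP/idP => [[u /= us ->]|];
  [move: us; rewrite !inE => /orP[] /eqP ->; rewrite eqxx ?orbT
  |rewrite !inE => /orP[] /eqP ->; [exists i|exists j]; rewrite //= !inE eqxx ?orbT].
Qed.

(** A function of the edges as a symmetric function of two vertices, zero on the
    pairs that are not edges. *)
Definition edge_fun (phi : edges K -> C) x y : C := \sum_(ed | val ed == [set x; y]%SET) phi ed.

Lemma edge_funC phi x y : edge_fun phi x y = edge_fun phi y x.
Proof. by rewrite /edge_fun setUC. Qed.

Lemma edge_funE phi (ed : edges K) x y : val ed = [set x; y]%SET -> edge_fun phi x y = phi ed.
Proof.
move=> E; rewrite /edge_fun (big_pred1 ed) // => ed'; rewrite -E.
by apply/eqP/eqP => [/val_inj|->].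
Qed.

Lemma edge_of i j : i != j -> Kt [fset i; j]%fset -> exists ed : edges K, val ed = [set p i; p j]%SET.
Proof.
move=> ij kij; have [sK c] := covering.2.1 _ kij; rewrite shadow2 cardfs2 ij in sK c.
have H : ([set p i; p j]%SET \in K) && (#|[set p i; p j]%SET| == 2%N) by rewrite sK c.
by exists (exist _ [set p i; p j]%SET H).
Qed.

Lemma set2_eq x y x' y' : [set x; y]%SET = [set x'; y']%SET -> x != y -> (x' = x /\ y' = y) \/ (x' = y /\ y' = x).
Proof.
move=> E xy.
have xs : x \in [set x'; y']%SET by rewrite -E !inE eqxx.
have ys : y \in [set x'; y']%SET by rewrite -E !inE eqxx orbT.
move: xs ys; rewrite !inE => /orP[] /eqP ex /orP[] /eqP ey; subst; rewrite ?eqxx // in xy *; by [left|right].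
Qed.

(** The edge of the family over an edge ij of the cover is a translate of ij, perhaps
    with its ends exchanged, and the lengths are invariant. *)
Lemma g2_edge u i j : i != j -> Kt [fset i; j]%fset ->
  edge_fun (G2 u) (p i) (p j) =
  ldiff (dv (fun v => 2 * kappa (main v) * u.1.1 v) u.1.2 u.2) i j.
Proof.
move=> ij kij; have [ed Eed] := edge_of ij kij.
rewrite (edge_funE _ Eed) g2E; have [n12 k12 E12 p12] := edgeP ed.
move: (edge ed).1 (edge ed).2 n12 k12 E12 p12 => i' j' nij kij' E' pij'.
have pij : p i != p j.
  by have /andP[_] := valP ed; rewrite Eed cards2; case: (p i != p j).
have [[pi' pj']|[pi' pj']] := set2_eq (etrans (esym E') Eed) pij'.
  have [a ai] := deck_transitive cover pi'.
  by rewrite -(act_edge kij kij' ai pj') -ai length_diff_dv_act.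
have [a aj] := deck_transitive cover pj'.
have kji : Kt [fset j; i]%fset by rewrite fsetUC.
by rewrite [RHS]length_diffC -(act_edge kji kij' aj pi') -aj length_diff_dv_act // eq_sym.
Qed.

Definition f3_entry (ed : edges K) t : C :=
  \sum_(kl : V * V | pos_tet K pos (p (edge ed).1) (p (edge ed).2) kl.1 kl.2 &&
     (val t == [set p (edge ed).1; p (edge ed).2; kl.1; kl.2]%SET))
    omega t (p (edge ed).1) (p (edge ed).2) kl.1 kl.2.

Lemma f3_entryE (dy : {ffun tetrahedra K -> C}) ed :
  F3 dy ed = \sum_t f3_entry ed t * dy t.
Proof.
rewrite f3E /star_sum /corner /f3_entry.
transitivity (\sum_(kl : V * V | pos_tet K pos (p (edge ed).1) (p (edge ed).2) kl.1 kl.2)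
  \sum_t (if val t == [set p (edge ed).1; p (edge ed).2; kl.1; kl.2]%SET then
    omega t (p (edge ed).1) (p (edge ed).2) kl.1 kl.2 * dy t else 0)).
  by apply: eq_bigr => kl _; rewrite big_mkcond.
rewrite exchange_big /=; apply: eq_bigr => t _; rewrite mulr_suml [RHS]big_mkcondr /=.
by apply: eq_bigr => kl _; case: ifP.
Qed.

Lemma pos_tet_flip x y k l : pos_tet K pos x y k l -> pos_tet K pos k l x y.
Proof. by move=> /(pos_tet_rot K_oriented)/(pos_tet_swap K_oriented)/(pos_tet_rot K_oriented)/(pos_tet_rot K_oriented). Qed.

Lemma f3_entry_edge (ed : edges K) t x y k l : val ed = [set x; y]%SET -> val t = [set x; y; k; l]%SET ->
  pos_tet K pos x y k l -> f3_entry ed t = omega t x y k l.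
Proof.
move=> Eed Et ps; rewrite /f3_entry.
have [_ _ E12 p12] := edgeP ed.
have one x' y' k' l' : pos_tet K pos x' y' k' l' -> val t = [set x'; y'; k'; l']%SET ->
  \sum_(kl : V * V | pos_tet K pos x' y' kl.1 kl.2 && (val t == [set x'; y'; kl.1; kl.2]%SET))
    omega t x' y' kl.1 kl.2 = omega t x' y' k' l'.
  move=> ps' Et'; rewrite (big_pred1 (k', l')) // => -[k2 l2] /=.
  apply/andP/eqP => [[ps2 /eqP Et2']|[-> ->]]; last by rewrite ps' Et'.
  have Et2 : val t = [set x'; y'; k2; l2]%SET := Et2'.
  have /andP[T2 pp2] := ps2; have /andP[/andP[U2 _] _] := ps2.
  have /andP[T1 pp1] := ps'.
  have : k2 \in val t by rewrite Et2 !inE eqxx !orbT.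
  have : l2 \in val t by rewrite Et2 !inE eqxx !orbT.
  move: U2; rewrite /= !inE !negb_or !(eq_sym x') !(eq_sym y') => /and4P[/and3P[_ /negPf nk /negPf nl] /andP[/negPf nk' /negPf nl'] n2 _].
  rewrite Et' !inE nk nl nk' nl' /= => /orP[] /eqP el /orP[] /eqP ek; subst k2 l2; rewrite ?eqxx // in n2 *.
  by move: pp2; rewrite (pos_swap34 K_oriented T1) pp1.
have xy : x != y by move: ps => /andP[/andP[/=]]; rewrite !inE negb_or => /andP[/andP[]].
have [[-> ->]|[-> ->]] := set2_eq (etrans (esym Eed) E12) xy; first exact: one.
rewrite (one _ _ l k); first by rewrite /omega; ring.
  exact: pos_tet_swap.
by rewrite Et setUAC (setUC [set x]%SET).
Qed.

Lemma f3_entry_neq0 (ed : edges K) t : f3_entry ed t != 0 -> val ed \subset val t.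
Proof.
move=> c0; have [_ _ E12 _] := edgeP ed.
have [[kl Et]|n] := pselect (exists kl : V * V, val t = [set p (edge ed).1; p (edge ed).2; kl.1; kl.2]%SET).
  by rewrite Et E12 -setUA subsetUl.
move: c0; rewrite /f3_entry big1 ?eqxx // => kl /andP[_ /eqP H]; case: n; by exists kl.
Qed.

Lemma set2_neq x y x' y' : (x != x') && (x != y') || (y != x') && (y != y') -> [set x; y]%SET != [set x'; y']%SET.
Proof.
apply: contraL => /eqP E; rewrite negb_or !negb_and !negbK.
have := set21 x y; have := set22 x y; rewrite E !inE => /orP[]/eqP-> /orP[]/eqP->; by rewrite !eqxx ?orbT.
Qed.

Lemma subset4_pair (ed : edges K) x y k l : val ed \subset [set x; y; k; l]%SET ->
  [\/ val ed = [set x; y]%SET, val ed = [set k; l]%SET | [\/ val ed = [set x; k]%SET, val ed = [set l; y]%SET |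
     val ed = [set x; l]%SET \/ val ed = [set y; k]%SET]].
Proof.
have [_ _ -> pij] := edgeP ed; rewrite subUset !sub1set !inE.
move: (p _) (p _) pij => i j ij.
move=> /andP[/orP[/orP[/orP[]|]|] /eqP ei /orP[/orP[/orP[]|]|] /eqP ej]; subst i j; rewrite ?eqxx // in ij *;
  first [by apply: Or31|by apply: Or32|by apply: Or33; apply: Or31|by apply: Or33; apply: Or32
  |by apply: Or33; apply: Or33; left|by apply: Or33; apply: Or33; right
  |by apply: Or31; rewrite setUC|by apply: Or32; rewrite setUC|by apply: Or33; apply: Or31; rewrite setUC|by apply: Or33; apply: Or32; rewrite setUC
  |by apply: Or33; apply: Or33; left; rewrite setUC|by apply: Or33; apply: Or33; right; rewrite setUC].
Qed.

(** The transpose of f3: opposite edges of a tetrahedron have the same coefficient,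
    and the positive orderings xykl, xkly, xlyk run over the three pairs. *)
Lemma f3_column_sum phi t x y k l : pos_tet K pos x y k l -> val t = [set x; y; k; l]%SET ->
  \sum_ed f3_entry ed t * phi ed =
  omega t x y k l * (edge_fun phi x y + edge_fun phi k l) +
  omega t x k l y * (edge_fun phi x k + edge_fun phi l y) +
  omega t x l y k * (edge_fun phi x l + edge_fun phi y k).
Proof.
move=> ps Et; have ps2 := pos_tet_rot K_oriented ps; have ps3 := pos_tet_rot K_oriented ps2.
have Et2 : val t = [set x; k; l; y]%SET by rewrite Et -!setUA; congr (_ :|: _); rewrite setUC -setUA.
have Et3 : val t = [set x; l; y; k]%SET by rewrite Et2 -!setUA; congr (_ :|: _); rewrite setUC -setUA.
have flip a b c d : val t = [set a; b; c; d]%SET -> val t = [set c; d; a; b]%SET.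
  by move=> ->; rewrite -!setUA [RHS]setUA [RHS]setUC -!setUA.
have := ps => /andP[/andP[Uq tK] _].
have sub a b : a \in val t -> b \in val t -> a != b -> exists ed : edges K, val ed = [set a; b]%SET.
  move=> at' bt ab; have H : ([set a; b]%SET \in K) && (#|[set a; b]%SET| == 2%N).
    rewrite cards2 ab andbT; apply: (simplex_face K_manifold tK).
      by rewrite -Et subUset !sub1set at'.
    by apply/set0Pn; exists a; rewrite !inE eqxx.
  by exists (exist _ [set a; b]%SET H).
have [xt yt kt lt] : [/\ x \in val t, y \in val t, k \in val t & l \in val t] by rewrite Et !inE !eqxx !orbT.
have := Uq; rewrite /= !inE !negb_or => /and4P[/and3P[xy xk xl] /andP[yk yl] kl _].
have [e1 E1] := sub _ _ xt yt xy; have [e2 E2] := sub _ _ kt lt kl.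
have [e3 E3] := sub _ _ xt kt xk; have ly : l != y by rewrite eq_sym.
have [e4 E4] := sub _ _ lt yt ly.
have [e5 E5] := sub _ _ xt lt xl; have [e6 E6] := sub _ _ yt kt yk.
have kx : k != x by rewrite eq_sym. have lx : l != x by rewrite eq_sym. have yx : y != x by rewrite eq_sym.
have ky : k != y by rewrite eq_sym. have lk : l != k by rewrite eq_sym.
rewrite (bigID (fun ed => ed \in [:: e1; e2; e3; e4; e5; e6])) /= [X in _ + X]big1 ?addr0.
  rewrite -big_uniq; last first.
    apply: (@map_uniq _ _ (val : edges K -> {set V})); rewrite /= E1 E2 E3 E4 E5 E6 !inE !negb_or.
    by rewrite !set2_neq // ?xy ?xk ?xl ?yk ?yl ?kl ?kx ?lx ?yx ?ky ?lk ?ly ?orbT.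
  rewrite !big_cons big_nil /= addr0.
  rewrite (f3_entry_edge E1 Et ps) (f3_entry_edge E2 (flip _ _ _ _ Et) (pos_tet_flip ps)).
  rewrite (f3_entry_edge E3 Et2 ps2) (f3_entry_edge E4 (flip _ _ _ _ Et2) (pos_tet_flip ps2)).
  rewrite (f3_entry_edge E5 Et3 ps3) (f3_entry_edge E6 (flip _ _ _ _ Et3) (pos_tet_flip ps3)).
  rewrite -(edge_funE phi E1) -(edge_funE phi E2) -(edge_funE phi E3) -(edge_funE phi E4) -(edge_funE phi E5) -(edge_funE phi E6).
  by rewrite /omega; ring.
move=> ed ned; have [->|/f3_entry_neq0] := eqVneq (f3_entry ed t) 0; first by rewrite mul0r.
rewrite Et => /subset4_pair H; case/negP: ned; rewrite !inE -!(inj_eq val_inj) /= E1 E2 E3 E4 E5 E6.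
by case: H => [->|->|[->|->|[->|->]]]; rewrite eqxx ?orbT.
Qed.

Lemma fset_rot34 i j k l : [fset i; j; k; l]%fset = [fset i; k; l; j : W]%fset.
Proof. by apply/fsetP => w; rewrite !inE; do 4![case: (w == _)]. Qed.

Lemma uniq_rot34 i j k l : uniq [:: i; j; k; l] -> uniq [:: i; k; l; j : W].
Proof.
rewrite /= !inE !negb_or (eq_sym k j) (eq_sym l j).
by move=> /and4P[/and3P[-> -> ->] /andP[-> ->] -> _].
Qed.

(** The relation of [lengths_tetrahedron] holds on the tetrahedra of the family, with
    positive orderings; it is homogeneous, and odd under exchange of vertices, so that
    it holds on all tetrahedra of the cover. *)
Lemma f3_entry_relation phi : (forall t, \sum_ed f3_entry ed t * phi ed = 0) ->
  forall T i j k l, is_tet T -> T = [fset i; j; k; l]%fset -> uniq [:: i; j; k; l] ->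
  let Phi := edge_fun phi in
  (zeta i - zeta j) * (zeta k - zeta l) * (Phi (p i) (p j) + Phi (p k) (p l)) +
  (zeta i - zeta k) * (zeta l - zeta j) * (Phi (p i) (p k) + Phi (p l) (p j)) +
  (zeta i - zeta l) * (zeta j - zeta k) * (Phi (p i) (p l) + Phi (p j) (p k)) = 0.
Proof.
move=> H T i j k l tT E Uq Phi.
have pos_case (j' k' l' : W) : T = [fset i; j'; k'; l']%fset -> uniq [:: i; j'; k'; l'] -> pos_tet K pos (p i) (p j') (p k') (p l') ->
  (zeta i - zeta j') * (zeta k' - zeta l') * (Phi (p i) (p j') + Phi (p k') (p l')) +
  (zeta i - zeta k') * (zeta l' - zeta j') * (Phi (p i) (p k') + Phi (p l') (p j')) +
  (zeta i - zeta l') * (zeta j' - zeta k') * (Phi (p i) (p l') + Phi (p j') (p k')) = 0.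
  move=> E' Uq' ps; have [t Et] := tet_of tT; have [r r0 Hr] := omega_scale tT (esym Et).
  have := @f3_column_sum phi t _ _ _ _ ps; rewrite H Et E' shadow4 => /(_ erefl).
  have E2 := etrans E' (fset_rot34 i j' k' l'); have U2 := uniq_rot34 Uq'.
  have E3 := etrans E2 (fset_rot34 i k' l' j'); have U3 := uniq_rot34 U2.
  rewrite (Hr _ _ _ _ E' Uq') (Hr _ _ _ _ E2 U2) (Hr _ _ _ _ E3 U3) => H0.
  by apply: (mulfI r0); rewrite mulr0 [RHS]H0 -/Phi; ring.
have T4 := tet_ordered tT E Uq.
have [ps|ps] := boolP (pos (p i) (p j) (p k) (p l)); first by apply: pos_case => //; rewrite /pos_tet T4.
have E' : T = [fset i; j; l; k]%fset by rewrite fset_swap34.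
have Uq' : uniq [:: i; j; l; k].
  by move: Uq; rewrite /= !inE !negb_or (eq_sym l k) => /and4P[/and3P[-> -> ->] /andP[-> ->] -> _].
have := pos_case _ _ _ E' Uq'; rewrite /pos_tet ordered_tetrahedron_swap34 T4 (pos_swap34 K_oriented T4) ps => /(_ erefl) H0.
rewrite -[RHS]oppr0 -[in RHS]H0 /Phi (edge_funC _ (p l) (p k)) (edge_funC _ (p k) (p j)) (edge_funC _ (p l) (p j)).
by ring.
Qed.

Lemma f3_entry_g2 u t : \sum_ed f3_entry ed t * G2 u ed = 0.
Proof.
have := over_in (t := t); have := tetP t; rewrite /tet_fset.
case: (tet t) => [[[w0 w1] w2] w3] [tT Uq _ Et ps] ov_in.
rewrite (f3_column_sum _ ps (esym Et)) /omega !ov_in ?inE ?eqxx ?orbT //.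
have [[n01 n02 n03] [n12 n13 n23]] := tet_zeta tT erefl Uq.
have [m0 m1 m2 m3] := @tet_members _ w0 w1 w2 w3 erefl.
have k i j := tet_edge covering tT (x := i) (y := j).
have n (x y : W) : zeta x - zeta y != 0 -> x != y by apply: contraNneq => ->; rewrite subrr.
have n31 := subr_neq0_sym n13.
rewrite !g2_edge ?n //; try exact: k.
exact: (lengths_tetrahedron (dh_of kappa _) (dz_of zeta kappa _) n01 n02 n03 n12 n13 n23).
Qed.

Lemma f3_entry_exact phi : (forall t, \sum_ed f3_entry ed t * phi ed = 0) ->
  exists u, forall ed, G2 u ed = phi ed.
Proof.
move=> H; have [al [be [dg HL]]] := lengths_variation (edge_funC phi) (f3_entry_relation H).
exists ([ffun v => al v], [ffun v => be v], dg) => ed; rewrite g2E /=.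
have -> : (fun v => 2 * kappa (main v) * [ffun v => al v] v) = (fun v => 2 * kappa (main v) * al v).
  by apply/funext => v; rewrite ffunE.
have -> : [ffun v => be v] = be :> (V -> C) by apply/funext => v; rewrite ffunE.
have [n12 k12 E12 _] := edgeP ed.
by rewrite HL // (edge_funE _ E12).
Qed.

(** g1 X is the variation of the vectors under the motion X, which is equivariant
    because X commutes with rho. *)
Lemma g1_dv (X : psl rho) :
  dv (fun v => 2 * kappa (main v) * (G1 X).1.1 v) (G1 X).1.2 0 =
  (fun w => lie X *m e w).
Proof.
have Xc : psl_val X \in centralizer rho := valP X.
have X_act a w : lie X *m e (act a w) = rho a *m (lie X *m e w) + dr 0 a *m e w.
  rewrite (drho0 (family_diff rho_regular)) mul0mx addr0 equivariant !mulmxA.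
  by move: Xc; rewrite unfold_in => /asboolP ->.
rewrite [RHS](dv_unique X_act); last by move=> v; exact: tangent_lie.
by congr (dv _ _ 0); apply/funext => v; rewrite /= ffunE ?h_part_lie ?z_part_lie.
Qed.

Lemma g2_g1 X ed : G2 (G1 X) ed = 0.
Proof.
rewrite g2E; have [n12 k12 _ _] := edgeP ed.
by rewrite [length_diff _ _ _](_ : _ = ldiff (fun w => lie X *m e w)) ?length_diff_lie -?g1_dv //; exact: zeta_edge.
Qed.

(** If no length varies, the variation is a motion on each tetrahedron, by rigidity a
    single one, and [family_rigid] applies. *)
Lemma g2_exact u : (forall ed, G2 u ed = 0) ->
  exists X, G1 X = u.
Proof.
case: u => [[al be] dg] H; pose t := dv (fun v => 2 * kappa (main v) * al v) be dg.
have L0 i j : i != j -> Kt [fset i; j]%fset -> ldiff t i j = 0.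
  move=> ij kij; have := g2_edge (al, be, dg) ij kij.
  by rewrite /edge_fun big1 => [<-|ed _]; last exact: H.
have Ht T : is_tet T -> prescribed_lengths (fun _ _ => 0) T t.
  move=> tT; split=> [w _|i j iT jT ij]; first exact: dv_tangent.
  by apply: L0 => //; exact: (tet_edge covering tT).
have H0 T : is_tet T -> prescribed_lengths (fun _ _ => 0) T (fun=> 0).
  move=> tT; split=> [w _|i j iT jT ij].
    by rewrite /tangent bilE !mxE /=; ring.
  by rewrite /length_diff /dh_of /dz_of /h_part /z_part !mxE; ring.
have [X HX] : exists X, forall w, t w = lie X *m e w.
  apply: (rigidity K_manifold covering (cover_simply_connected cover) lie_isotropicB lie_isotropic_inj) => T tT.
  have [X HX] := lengths_torsor tT (H0 T tT) (Ht T tT); exists X => w wT.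
  by rewrite HX // add0r.
have [|dg0 Xc] := @rigid (fun v => 2 * kappa (main v) * al v) be dg X.
  by move=> w; rewrite -/t HX z_part_lie.
exists (Psl Xc); rewrite /g1 dg0 /=; congr (_, _, _); apply/ffunP => v; rewrite ffunE.
  rewrite -(h_part_lie zeta kappa_neq0 X (main v)) -HX /t dv_main -mulrA.
  by rewrite /h_part !mxE /=; field.
by rewrite -(z_part_lie zeta kappa_neq0 X (main v)) -HX /t dv_main z_part_cone.
Qed.

(** * Exactness in (dphi) and behind it *)

(** Coordinates on the space (dalpha) + (dbeta) + (dg)^* , which turn the
    transposes f4 and f5 into transposes of ordinary linear systems. *)
Definition abg_coord (u : space_abg C V m) (b : V + V + 'I_m) : C :=
  match b with
  | inl (inl v) => u.1.1 v | inl (inr v) => u.1.2 v | inr k => u.2 0 k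
  end.

Definition abg_of (f : V + V + 'I_m -> C) : space_abg C V m :=
  ([ffun v => f (inl (inl v))], [ffun v => f (inl (inr v))], \row_k f (inr k)).

Lemma abg_ofK f b : abg_coord (abg_of f) b = f b.
Proof. by case: b => [[v|v]|k]; rewrite /= ?ffunE ?mxE. Qed.

Lemma abg_coordK u : abg_of (abg_coord u) = u.
Proof.
case: u => [[al be] dg]; congr (_, _, _); first by apply/ffunP => v; rewrite ffunE.
  by apply/ffunP => v; rewrite ffunE.
by apply/rowP => k; rewrite mxE.
Qed.

Lemma abg_ext u u' : (forall b, abg_coord u b = abg_coord u' b) -> u = u'.
Proof.
by move=> E; rewrite -(abg_coordK u) -(abg_coordK u'); congr abg_of; apply/funext.
Qed.

Lemma abg_sum (f : V + V + 'I_m -> C) :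
  \sum_b f b = \sum_v f (inl (inl v)) + \sum_v f (inl (inr v)) + \sum_k f (inr k).
Proof. by rewrite !big_sumType. Qed.

Lemma abg_coord0 b : abg_coord 0 b = 0.
Proof. by case: b => [[v|v]|k]; rewrite /= ?ffunE ?mxE. Qed.

Lemma pairing_abgE (u u' : space_abg C V m) :
  pairing_abg u u' = \sum_b abg_coord u b * abg_coord u' b.
Proof. by rewrite abg_sum. Qed.

Definition g2_entry ed (b : V + V + 'I_m) : C :=
  G2 (abg_of (fun b' => (b' == b)%:R)) ed.

Lemma g2_sum u ed : G2 u ed = \sum_b abg_coord u b * g2_entry ed b.
Proof.
pose phi := phi_star p act main rhog zeta kappa (edge ed).1 (edge ed).2.
pose P (b : V + V + 'I_m) := match b with
  | inl (inl v) => pd_h main zeta kappa phi v * (2 * kappa (main v))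
  | inl (inr v) => pd_z main zeta kappa phi v | inr k => pd_g main zeta kappa phi k end.
have PE u' : G2 u' ed = \sum_b abg_coord u' b * P b.
  rewrite abg_sum /P /g2 ffunE /phi; case: (edge ed) => i j /=.
  by congr (_ + _ + _); apply: eq_bigr => v _; rewrite 1?mulrA mulrC.
rewrite PE; apply: eq_bigr => b _; congr (_ * _).
rewrite /g2_entry PE (bigD1 b) //= big1 ?addr0 => [|b' n]; first by rewrite abg_ofK eqxx mul1r.
by rewrite abg_ofK (negPf n) mul0r.
Qed.

Lemma f4_coord phi b : abg_coord (F4 phi) b = \sum_ed phi ed * g2_entry ed b.
Proof.
have unitE u : abg_coord u =1 (fun b' => (b' == b)%:R) ->
    \sum_ed G2 u ed * phi ed = \sum_ed phi ed * g2_entry ed b.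
  move=> E; apply: eq_bigr => ed _; rewrite mulrC; congr (_ * G2 _ ed).
  by apply: abg_ext => b'; rewrite abg_ofK E.
by case: b unitE => [[v|v]|k] unitE; rewrite /= ?ffunE ?mxE; apply: unitE => -[[v'|v']|k'];
  rewrite /= ?ffunE ?mxE ?eqxx.
Qed.

Lemma f4_adjoint phi u : \sum_b abg_coord (F4 phi) b * abg_coord u b = \sum_ed phi ed * G2 u ed.
Proof.
rewrite (eq_bigr (fun b => \sum_ed phi ed * (abg_coord u b * g2_entry ed b))); last first.
  by move=> b _; rewrite f4_coord mulr_suml; apply: eq_bigr => ed _; ring.
by rewrite exchange_big; apply: eq_bigr => ed _; rewrite g2_sum -mulr_sumr.
Qed.

(** f4 is the transpose of g2 and f3 that of the map phi |-> (f3_entry^T) phi,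
    whose kernel is the image of g2. *)
Lemma exact_f3_f4 : exact_at F3 F4.
Proof.
move=> y; split=> [H|[dy <-]]; last first.
  apply: abg_ext => b; rewrite f4_coord abg_coord0.
  rewrite (eq_bigr (fun ed => \sum_t dy t * (f3_entry ed t * g2_entry ed b))); last first.
    by move=> ed _; rewrite f3_entryE mulr_suml; apply: eq_bigr => t _; ring.
  by rewrite exchange_big big1 //= => t _; rewrite -mulr_sumr f3_entry_g2 mulr0.
have [|dy Hdy] := @solvable_dual C _ _ (fun t ed => f3_entry ed t) y.
  move=> phi /f3_entry_exact[u Hu].
  rewrite (eq_bigr (fun ed => y ed * G2 u ed)); last by move=> ed _; rewrite Hu.
  by rewrite -f4_adjoint H big1 // => b _; rewrite abg_coord0 mul0r.
exists [ffun t => dy t]; apply/ffunP => ed; rewrite f3_entryE -Hdy.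
by apply: eq_bigr => t _; rewrite ffunE mulrC.
Qed.

Lemma f5E u X : F5 u X = \sum_b abg_coord u b * abg_coord (G1 X) b.
Proof. by rewrite -pairing_abgE. Qed.

Lemma exact_f4_f5 (y : space_abg C V m) : (forall X, F5 y X = 0) <->
  exists phi : {ffun edges K -> C}, F4 phi = y.
Proof.
split=> [H|[phi <-] X]; last first.
  by rewrite f5E f4_adjoint big1 // => ed _; rewrite g2_g1 mulr0.
have [|phi Hphi] := @solvable_dual C _ _ g2_entry (abg_coord y).
  move=> z Hz; have [|X HX] := @g2_exact (abg_of z).
    by move=> ed; rewrite g2_sum -[RHS](Hz ed); apply: eq_bigr => b _; rewrite abg_ofK mulrC.
  by rewrite -[RHS](H X) f5E HX; apply: eq_bigr => b _; rewrite abg_ofK.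
exists [ffun ed => phi ed]; apply: abg_ext => b; rewrite f4_coord -Hphi.
by apply: eq_bigr => ed _; rewrite ffunE.
Qed.

Lemma g1_inj (X : psl rho) : G1 X = 0 -> X = 0.
Proof. by move=> [_ H]; apply/f1_eq0; rewrite /f1 H. Qed.

(** Since g1 is injective, every functional extends from its image to the whole
    space, that is to say, factors through g1. *)
Lemma f5_surjective (l : psl_dual rho) :
  exists y : space_abg C V m, forall X, F5 y X = l X.
Proof.
have [B [HB Bmax]] := submod_basis (@centralizer_submod C pi rho).
pose gen s : psl rho := Psl (HB s).
have genE (c : 'I_3 -> C) : psl_val (\sum_s c s *: gen s) = \sum_s c s *: row s B.
  by rewrite -[LHS]/(\val (\sum_s c s *: gen s)) linear_sum; apply: eq_bigr => s _; rewrite linearZ.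
have g1E (c : 'I_3 -> C) b : abg_coord (G1 (\sum_s c s *: gen s)) b =
    \sum_s abg_coord (G1 (gen s)) b * c s.
  have entry k : psl_val (\sum_s c s *: gen s) 0 k = \sum_s row s B 0 k * c s.
    by rewrite genE summxE; apply: eq_bigr => s _; rewrite [LHS]mxE mulrC.
  case: b => [[v|v]|k] /=; last by rewrite mxE big1 // => s _; rewrite mul0r.
    rewrite ffunE !entry -sumrN mulr_sumr -big_split /=; apply: eq_bigr => s _.
    by rewrite ffunE /=; ring.
  rewrite ffunE /dz_lie !entry !mulr_sumr -sumrN -!big_split /=; apply: eq_bigr => s _.
  by rewrite ffunE /dz_lie /=; ring.
have [|f Hf] := @solvable_dual C _ _ (fun b s => abg_coord (G1 (gen s)) b) (fun s => l (gen s)).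
  move=> c Hc; have c0 : \sum_s c s *: gen s = 0.
    by apply/g1_inj/abg_ext => b; rewrite g1E Hc abg_coord0.
  rewrite -[RHS](linear0 l) -c0 linear_sum; apply: eq_bigr => s _.
  by rewrite linearZ /GRing.scale /= mulrC.
exists (abg_of f) => X; have [c ->] : exists c : 'I_3 -> C, X = \sum_s c s *: gen s.
  have /submxP[D ED] := Bmax _ (valP X); exists (fun s => D 0 s).
  by apply: val_inj; rewrite /= genE [LHS]ED mulmx_sum_row.
rewrite !linear_sum; apply: eq_bigr => s _; rewrite !linearZ; congr (_ *: _).
by rewrite f5E -Hf; apply: eq_bigr => b _; rewrite abg_ofK.
Qed.
End Complex.

Theorem theorem5 (R : realType)
    (* M, its triangulation and its orientation *)
    (V : finType) (K : {set {set V}}) (pos : V -> V -> V -> V -> bool)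
    (K_manifold : closed_3manifold K) (K_oriented : orientation K pos)
    (* the universal cover, with pi = pi_1(M) acting by deck transformations *)
    (W : choiceType) (Kt : set {fset W}) (p : W -> V)
    (pi : groupType) (act : pi -> W -> W)
    (cover : universal_cover K Kt p act)
    (main : V -> W) (edge : edges K -> W * W)
    (tet : tetrahedra K -> W * W * W * W)
    (family : fundamental_family pos Kt p main edge tet)
    (* the representation and its deformations *)
    (rho : pi -> 'M[R[i]]_3) (rho_rep : representation rho)
    (m : nat) (U : set 'rV[R[i]]_m) (rhog : 'rV[R[i]]_m -> pi -> 'M[R[i]]_3)
    (rho_regular : regular_family rho U rhog)
    (* the vertex parameters, in general position *)
    (zeta kappa : W -> R[i])
    (equivariant : forall a w,
       isotropic (kappa (act a w)) (zeta (act a w))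
       = rho a *m isotropic (kappa w) (zeta w))
    (kappa_neq0 : forall w, kappa w != 0)
    (zeta_edge : forall i j, i != j -> Kt [fset i; j]%fset ->
       zeta i - zeta j != 0) :
  let F1 := @f1 _ V W pi main rho m zeta in
  let F2 := f2 p act main tet rhog zeta kappa in
  let F3 := f3 pos Kt p edge tet zeta in
  let F4 := f4 p act main edge rhog zeta kappa in
  let F5 := @f5 _ V W pi main rho m zeta in
  (forall X, F1 X = 0 <-> X = 0) /\
  exact_at F1 F2 /\
  exact_at F2 F3 /\
  exact_at F3 F4 /\
  (forall y, (forall X, F5 y X = 0) <-> exists x, F4 x = y) /\
  (forall l : psl_dual rho, exists y, forall X, F5 y X = l X).
Proof.
split; first by move=> X; exact: (f1_eq0 K_manifold cover family m rho_rep equivariant kappa_neq0 zeta_edge).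
split; first exact: (exact_f1_f2 K_manifold cover family rho_rep rho_regular equivariant kappa_neq0 zeta_edge).
split; first exact: (exact_f2_f3 K_manifold K_oriented cover family rho_rep rho_regular equivariant kappa_neq0 zeta_edge).
split; first exact: (exact_f3_f4 K_manifold K_oriented cover family rho_rep rho_regular equivariant kappa_neq0 zeta_edge).
split; first by move=> y; exact: (exact_f4_f5 K_manifold cover family rho_rep rho_regular equivariant kappa_neq0 zeta_edge).
by move=> l; exact: (f5_surjective K_manifold cover family m rho_rep equivariant kappa_neq0 zeta_edge).
Qed.
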